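(* Let $1\le m<n$, let $s,t>0$ with $s + t \ge 2m$, and let $\mu,\nu$ be finite nonzero Borel measures on $\mathbb{R}^n$ with compact support such that $I_{s}(\mu) < \infty$ and $I_{t}(\nu) < \infty$. Then $$\gamma_{n,m}\left(\{V\in G(n,m): P_V(\operatorname{spt}\mu)\cap P_V(\operatorname{spt}\nu)\neq \emptyset\}\right)>0.$$ If moreover $s>2m$ and $t>2m$, then $$\gamma_{n,m}\left(\{V\in G(n,m): \operatorname{Int}(P_V(\operatorname{spt}\mu)\cap P_V(\operatorname{spt}\nu))\neq \emptyset\}\right)>0.$$
   Context: For a Borel measure $\mu$ on $\mathbb{R}^n$, $I_s(\mu)=\iint|x-y|^{-s}\,d\mu x\,d\mu y$ is its $s$-energy and $\operatorname{spt}\mu$ its support. $G(n,m)$ is the Grassmannian of $m$-dimensional linear subspaces of $\mathbb{R}^n$, $\gamma_{n,m}$ its orthogonally invariant Borel probability measure, $P_V$ the orthogonal projection onto $V$, and $\operatorname{Int}$ the interior relative to $V$. *)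

(* Defs.v *)
From HB Require Import structures.
From mathcomp Require Import all_boot all_order all_algebra.
From mathcomp Require Import all_classical all_reals all_analysis.
Set Implicit Arguments. Unset Strict Implicit. Unset Printing Implicit Defensive.
Import Order.TTheory GRing.Theory Num.Theory.
Import numFieldNormedType.Exports.
Local Open Scope classical_set_scope.
Local Open Scope ring_scope.

Definition Borel (T : topologicalType) := g_sigma_algebraType (@open T).

Section Defs.
Variables (R : realType) (n : nat).

Definition enorm (x : 'rV[R]_n) : R := Num.sqrt (\sum_(i < n) x ord0 i ^+ 2).

Definition rieszk (s : R) (x y : 'rV[R]_n) : \bar R :=
  if x == y then +oo%E else ((enorm (x - y)) `^ (- s))%:E.

Definition energy (mu : {measure set (Borel 'rV[R]_n) -> \bar R}) (s : R)
  : \bar R :=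
  (\int[mu]_x (\int[mu]_y rieszk s x y))%E.

Definition spt (mu : {measure set (Borel 'rV[R]_n) -> \bar R})
  : set 'rV[R]_n :=
  [set x | forall U : set 'rV[R]_n, open U -> U x -> (0 < mu U)%E].

(* G(n,m) is represented by orthogonal projection matrices: a subspace V
   corresponds to the unique P with P^T = P, P P = P, rank P = m and
   V = { x | x *m P = x }; P_V x = x *m P (row-vector convention). *)
Definition grass (m : nat) : set 'M[R]_n :=
  [set P | P^T = P /\ P *m P = P /\ \rank P = m].

Definition subsp (P : 'M[R]_n) : set 'rV[R]_n := [set x | x *m P = x].

Definition projset (P : 'M[R]_n) (A : set 'rV[R]_n) : set 'rV[R]_n :=
  [set x *m P | x in A].

Definition relint (V A : set 'rV[R]_n) : set 'rV[R]_n :=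
  [set x | V x /\ A x /\
     exists2 e : R, 0 < e & forall y, V y -> enorm (y - x) < e -> A y].

Definition orthogonal_mx (g : 'M[R]_n) : Prop := g *m g^T = 1%:M.

(* gamma is an orthogonally invariant Borel probability measure on G(n,m)
   (viewed as a Borel probability measure on matrices concentrated on the
   closed set G(n,m)).  The action of g in O(n) sends V to V g, whose
   projection is g^T P g. *)
Definition grass_invariant_prob (m : nat)
  (gam : probability (Borel 'M[R]_n) R) : Prop :=
  gam (grass m : set (Borel 'M[R]_n)) = 1%E /\
  forall g : 'M[R]_n, orthogonal_mx g ->
  forall A : set (Borel 'M[R]_n), measurable A ->
    gam ([set P : 'M[R]_n | A (g^T *m P *m g)] : set (Borel 'M[R]_n)) = gam A.

End Defs.

(* Main.v *)
(* Write psi_tau(z) = tau^(-m/2) (1 + |zP|^2/tau)^(-n/2), a kernel on the m-plane of the projection P.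
   Rotation invariance and Gaussian integrals show that its mean over G(n,m) is (tau + |z|^2)^(-m/2);
   on the plane its Fourier transform is a mixture of Gaussians.  With tau_k = 2^-k, combine
   psi_((i+1) tau_k), i < j, into an approximate identity Psi_k whose transform mixes 1 - (1 - y)^j
   (y Gaussian).  The increments D_k = Psi_(k+1) - Psi_k are then positive definite, and their means are
   so small that sum_k tau_k^((m-s)/2) mean(D_k)(z) <= C |z|^-s once s < m + 2j.  When s + t = 2m the
   weights tau_k^((m-s)/2) and tau_k^((m-t)/2) are inverse to each other, so Cauchy-Schwarz bounds
   sum_k |D_k(mu, nu)| by the weighted sums of D_k(mu, mu) and D_k(nu, nu), whose means are controlled by
   I_s(mu) and I_t(nu).  Thus P |-> Psi_k(mu, nu) is dominated by an integrable function, while its mean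
   stays above the integral of (1 + |x - y|^2)^(-m/2): it cannot tend to 0 for almost every P.

   It does tend to 0, since m < n, whenever the projected supports are disjoint.  If s, t > 2m, then for
   almost every P the potentials of mu and nu converge uniformly to f and g, continuous on the plane and
   vanishing off the projected supports.  If the intersection has no interior, then f g = 0; polarising
   Psi_k(|f| nu, |f| nu) shows that |f| nu has nonpositive energy for a positive kernel, so f = 0
   nu-almost everywhere and again Psi_k(mu, nu) tends to 0. *)

Require Import Defs.
From HB Require Import structures.
From mathcomp Require Import all_boot all_order all_algebra.
From mathcomp Require Import all_classical all_reals all_analysis.
From mathcomp Require Import measurable_realfun.
From mathcomp Require Import ring lra.
Set Implicit Arguments. Unset Strict Implicit. Unset Printing Implicit Defensive.
Import Order.TTheory GRing.Theory Num.Theory.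
Import numFieldNormedType.Exports.
Local Open Scope classical_set_scope.
Local Open Scope ring_scope.

(** * Bounded measurable functions *)

Section bounded_measurable.
Context {R : realType}.

(** When s < t the measure mu may have infinite m-energy, so its projections need not have square
    integrable densities and only the pairing with nu can be controlled; hence the work with
    increments instead of limits. The exponent n of the kernel, where m would be natural on an
    m-plane, serves two ends: a Gaussian vector of the ambient space can be exchanged with z under
    rotations, and at fixed |zP| > 0 the kernel has size tau^((n-m)/2), which tends to 0. The order
    j is there because the plain difference of psi_tau and psi_(2 tau) has a mean of order tau
    |z|^(-m-2), which restricts the exponents to s < m + 2, while s may be any number below 2m.
    Fourier analysis stays at the level of cosines and sines integrated against probability
    measures: neither an inversion formula nor a disintegration of measures occurs. *)

Definition bmf d (T : measurableType d) (f : T -> R) :=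
  measurable_fun setT f /\ exists M, forall x, `|f x| <= M.

Lemma bmf_cst d (T : measurableType d) (c : R) : bmf (fun _ : T => c).
Proof. by split; [exact: measurable_cst|exists `|c|]. Qed.

Lemma bmfD d (T : measurableType d) (f g : T -> R) :
  bmf f -> bmf g -> bmf (fun x => f x + g x).
Proof.
move=> [mf [M fM]] [mg [N gN]]; split; first exact: measurable_funD.
by exists (M + N) => x; rewrite (le_trans (ler_normD _ _))// lerD.
Qed.

Lemma bmfN d (T : measurableType d) (f : T -> R) :
  bmf f -> bmf (fun x => - f x).
Proof.
move=> [mf [M fM]]; split; first exact: measurableT_comp.
by exists M => x; rewrite normrN.
Qed.

Lemma bmfB d (T : measurableType d) (f g : T -> R) :
  bmf f -> bmf g -> bmf (fun x => f x - g x).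
Proof. by move=> bf bg; apply: bmfD => //; exact: bmfN. Qed.

Lemma bmfM d (T : measurableType d) (f g : T -> R) :
  bmf f -> bmf g -> bmf (fun x => f x * g x).
Proof.
move=> [mf [M fM]] [mg [N gN]]; split; first exact: measurable_funM.
by exists (M * N) => x; rewrite normrM ler_pM.
Qed.

Lemma bmfX d (T : measurableType d) (f : T -> R) k :
  bmf f -> bmf (fun x => f x ^+ k).
Proof.
move=> bf; elim: k => [|k IH]; first exact: bmf_cst.
by rewrite (_ : (fun x => _) = fun x => f x * f x ^+ k); [exact: bmfM|apply/funext => x; rewrite exprS].
Qed.

Lemma bmf_norm d (T : measurableType d) (f : T -> R) :
  bmf f -> bmf (fun x => `|f x|).
Proof.
move=> [mf [M fM]]; split; first exact: measurableT_comp.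
by exists M => x; rewrite normr_id.
Qed.

Lemma bmf_sum d (T : measurableType d) I (s : seq I) (f : I -> T -> R) :
  (forall i, bmf (f i)) -> bmf (fun x => \sum_(i <- s) f i x).
Proof.
move=> bf; elim: s => [|i s IH].
  by under eq_fun do rewrite big_nil; exact: bmf_cst.
by under eq_fun do rewrite big_cons; exact: bmfD.
Qed.

Lemma bmf_comp d d' (T : measurableType d) (T' : measurableType d')
  (f : T -> R) (h : T' -> T) : measurable_fun setT h -> bmf f ->
  bmf (fun x => f (h x)).
Proof.
move=> mh [mf [M fM]]; split; first exact: measurableT_comp.
by exists M.
Qed.

Lemma bmf_fst d d' (T : measurableType d) (T' : measurableType d')
  (f : T -> R) : bmf f -> bmf (fun x : T * T' => f x.1).
Proof. by move=> ?; apply: (bmf_comp (h := fst)). Qed.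

Lemma bmf_snd d d' (T : measurableType d) (T' : measurableType d')
  (f : T -> R) : bmf f -> bmf (fun x : T' * T => f x.2).
Proof. by move=> ?; apply: (bmf_comp (h := snd)). Qed.

Lemma bmf_pair1 d d' (T : measurableType d) (T' : measurableType d')
  (f : T * T' -> R) x : bmf f -> bmf (fun y => f (x, y)).
Proof. by move=> ?; apply: (bmf_comp (h := pair x)) => //; exact: pair1_measurable. Qed.

Lemma bmf_pair2 d d' (T : measurableType d) (T' : measurableType d')
  (f : T * T' -> R) y : bmf f -> bmf (fun x => f (x, y)).
Proof. by move=> ?; apply: (bmf_comp (h := pair^~ y)) => //; exact: pair2_measurable. Qed.

Lemma bmf_cos d (T : measurableType d) (f : T -> R) :
  measurable_fun setT f -> bmf (fun x => cos (f x)).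
Proof.
move=> mf; split.
  apply: (measurableT_comp _ mf); apply: continuous_measurable_fun.
  exact: continuous_cos.
by exists 1 => x; rewrite ler_norml cos_geN1 cos_le1.
Qed.

Lemma bmf_sin d (T : measurableType d) (f : T -> R) :
  measurable_fun setT f -> bmf (fun x => sin (f x)).
Proof.
move=> mf; split.
  apply: (measurableT_comp _ mf); apply: continuous_measurable_fun.
  exact: continuous_sin.
by exists 1 => x; rewrite ler_norml sin_geN1 sin_le1.
Qed.

Lemma bmf_expN d (T : measurableType d) (f : T -> R) :
  measurable_fun setT f -> (forall x, 0 <= f x) ->
  bmf (fun x => expR (- f x)).
Proof.
move=> mf f0; split.
  by apply: measurableT_comp => //; exact: measurableT_comp.
by exists 1 => x; rewrite ger0_norm ?expR_ge0// expRN invf_le1 ?expR_gt0// -expR0 ler_expR.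
Qed.

Section integral.
Context d (T : measurableType d) (mu : {finite_measure set T -> \bar R}).

(** Over a finite measure boundedness settles integrability, so the side conditions of linearity and
    of Fubini reduce to closure properties of [bmf]. *)
Lemma bmf_integrable (f : T -> R) : bmf f -> mu.-integrable setT (EFin \o f).
Proof.
move=> [mf [M fM]]; apply: measurable_bounded_integrable => //.
  by rewrite ltey_eq fin_num_measure.
by exists M; split; [exact: num_real|move=> x Mx y _; exact: le_trans (fM y) (ltW Mx)].
Qed.

Lemma bintD (f g : T -> R) : bmf f -> bmf g ->
  \int[mu]_x (f x + g x) = \int[mu]_x f x + \int[mu]_x g x.
Proof. by move=> bf bg; rewrite RintegralD//; exact: bmf_integrable. Qed.

Lemma bintB (f g : T -> R) : bmf f -> bmf g ->
  \int[mu]_x (f x - g x) = \int[mu]_x f x - \int[mu]_x g x.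
Proof. by move=> bf bg; rewrite RintegralB//; exact: bmf_integrable. Qed.

Lemma bintZl c (f : T -> R) : bmf f ->
  \int[mu]_x (c * f x) = c * \int[mu]_x f x.
Proof. by move=> bf; rewrite RintegralZl//; exact: bmf_integrable. Qed.

Lemma bintZr c (f : T -> R) : bmf f ->
  \int[mu]_x (f x * c) = \int[mu]_x f x * c.
Proof. by move=> bf; rewrite RintegralZr//; exact: bmf_integrable. Qed.

Lemma bint_le (f g : T -> R) : bmf f -> bmf g -> (forall x, f x <= g x) ->
  \int[mu]_x f x <= \int[mu]_x g x.
Proof. by move=> bf bg fg; apply: le_Rintegral => //; exact: bmf_integrable. Qed.

Lemma bint_ge0 (f : T -> R) : (forall x, 0 <= f x) -> 0 <= \int[mu]_x f x.
Proof. by move=> f0; exact: Rintegral_ge0. Qed.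

Lemma bint_cst c : \int[mu]_x c = c * fine (mu setT).
Proof. by rewrite Rintegral_cst. Qed.

Lemma bint_norm (f : T -> R) : bmf f -> `|\int[mu]_x f x| <= \int[mu]_x `|f x|.
Proof. by move=> bf; apply: le_normr_Rintegral => //; exact: bmf_integrable. Qed.

Lemma bint_norm_le (f : T -> R) M : bmf f -> (forall x, `|f x| <= M) ->
  `|\int[mu]_x f x| <= M * fine (mu setT).
Proof.
move=> bf fM; rewrite (le_trans (bint_norm bf))// -bint_cst.
by apply: bint_le => //; [exact: bmf_norm|exact: bmf_cst].
Qed.

Lemma bint_sum I (s : seq I) (f : I -> T -> R) : (forall i, bmf (f i)) ->
  \int[mu]_x (\sum_(i <- s) f i x) = \sum_(i <- s) \int[mu]_x f i x.
Proof.
move=> bf; elim: s => [|i s IH].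
  under eq_Rintegral do rewrite big_nil.
  by rewrite big_nil bint_cst mul0r.
under eq_Rintegral do rewrite big_cons.
by rewrite bintD// ?IH ?big_cons//; exact: bmf_sum.
Qed.

Lemma EFin_bint (f : T -> R) : bmf f ->
  (\int[mu]_x f x)%:E = (\int[mu]_x (f x)%:E)%E.
Proof.
move=> bf; rewrite /Rintegral fineK//.
by apply: integrable_fin_num => //; exact: bmf_integrable.
Qed.

End integral.

Section fubini.
Context d d' (T : measurableType d) (T' : measurableType d')
  (mu : {finite_measure set T -> \bar R}) (nu : {finite_measure set T' -> \bar R}).
Variable f : T * T' -> R.
Hypothesis bf : bmf f.

Let intf : (mu \x nu)%E.-integrable setT (EFin \o f).
Proof.
case: bf => mf [M fM]; apply: measurable_bounded_integrable => //.
  rewrite -setXTT [ltLHS]product_measure1E// -ge0_fin_numE ?mule_ge0//.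
  by rewrite fin_numM// fin_num_measure.
by exists M; split; [exact: num_real|move=> x Mx y _; exact: le_trans (fM y) (ltW Mx)].
Qed.

Lemma bmf_bint1 : bmf (fun x => \int[nu]_y f (x, y)).
Proof.
split.
  have : measurable_fun setT (fubini_F nu (EFin \o f)) by exact: (measurable_fubini_F intf).
  by move=> /(measurableT_comp (fine_measurable measurableT)).
case: (bf) => _ [M fM]; exists (M * fine (nu setT)) => x.
by apply: bint_norm_le => //; exact: bmf_pair1.
Qed.

Lemma bmf_bint2 : bmf (fun y => \int[mu]_x f (x, y)).
Proof.
split.
  have : measurable_fun setT (fubini_G mu (EFin \o f)) by exact: (measurable_fubini_G intf).
  by move=> /(measurableT_comp (fine_measurable measurableT)).
case: (bf) => _ [M fM]; exists (M * fine (mu setT)) => x.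
by apply: bint_norm_le => //; exact: bmf_pair2.
Qed.

Lemma bint_fubini :
  \int[mu]_x \int[nu]_y f (x, y) = \int[nu]_y \int[mu]_x f (x, y).
Proof.
congr fine; transitivity (\int[mu]_x \int[nu]_y (f (x, y))%:E)%E.
  by apply: eq_integral => x _; rewrite EFin_bint//; exact: bmf_pair1.
rewrite (Fubini intf); apply: eq_integral => x _.
by rewrite EFin_bint//; exact: bmf_pair2.
Qed.

Lemma bint_prod :
  \int[(mu \x nu)%E]_z f z = \int[mu]_x \int[nu]_y f (x, y).
Proof.
rewrite /Rintegral -(integral12_prod_meas1 intf); congr fine.
by apply: eq_integral => x _; rewrite /fubini_F EFin_bint//; exact: bmf_pair1.
Qed.

End fubini.

End bounded_measurable.

(** * Gaussian integrals *)

Section gauss1.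
Context {R : realType}.
Notation leb := (@lebesgue_measure R).

Definition gfun (L x : R) : R := expR (- (L * x ^+ 2 / 2)).

Lemma gfun_normal (L : R) : 0 < L -> gfun L = normal_fun 0 (Num.sqrt L)^-1.
Proof.
move=> L0; apply/funext => x; rewrite /gfun /normal_fun subr0; congr expR.
rewrite exprVn sqr_sqrtr ?ltW// -mulr_natr mulNr; congr (- _).
by field; rewrite gt_eqF.
Qed.

Lemma gfun_gt0 L x : 0 < gfun L x. Proof. exact: expR_gt0. Qed.

Lemma gfun_ge0 L x : 0 <= gfun L x. Proof. exact: expR_ge0. Qed.

Lemma measurable_gfun L : measurable_fun [set: R] (gfun L).
Proof.
apply: measurableT_comp => //; apply: measurableT_comp => //.
by apply: measurable_funM => //; apply: measurable_funM => //; exact: measurable_funX.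
Qed.

Lemma integral_gfun (L : R) : 0 < L ->
  (\int[leb]_x (gfun L x)%:E)%E = (Num.sqrt L^-1 * Num.sqrt (pi *+ 2))%:E.
Proof.
move=> L0; have s0 : (Num.sqrt L)^-1 != 0 :> R by rewrite invr_neq0// gt_eqF ?sqrtr_gt0.
have pk := normal_peak_gt0 s0.
have := integral_normal_pdf 0 (Num.sqrt L)^-1.
under eq_integral do rewrite (normal_pdfE _ s0) -gfun_normal// EFinM.
rewrite ge0_integralZl//; last 3 first.
- by apply/measurable_EFinP; exact: measurable_gfun.
- by move=> x _; rewrite lee_fin ltW ?gfun_gt0.
- by rewrite lee_fin ltW.
move=> h; have : (((normal_peak (Num.sqrt L)^-1)^-1%:E) * ((normal_peak (Num.sqrt L)^-1)%:E * \int[leb]_x (gfun L x)%:E) = ((normal_peak (Num.sqrt L)^-1)^-1)%:E)%E by rewrite h mule1.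
rewrite muleA -EFinM mulVf ?gt_eqF// mul1e => ->; congr EFin.
rewrite /normal_peak invrK exprVn sqr_sqrtr ?ltW// -mulrnAr sqrtrM//.
by rewrite invr_ge0 ltW.
Qed.

Lemma integrable_gfun (L : R) : 0 < L -> leb.-integrable setT (EFin \o gfun L).
Proof.
move=> L0; apply/integrableP; split; first by apply/measurable_EFinP; exact: measurable_gfun.
under eq_integral do rewrite /= ger0_norm ?ltW ?gfun_gt0//.
by rewrite integral_gfun// ltry.
Qed.

Lemma Rintegral_gfun (L : R) : 0 < L ->
  \int[leb]_x gfun L x = Num.sqrt L^-1 * Num.sqrt (pi *+ 2).
Proof. by move=> L0; rewrite /Rintegral integral_gfun. Qed.

Lemma le_integrableR (f g : R -> R) : measurable_fun setT f ->
  leb.-integrable setT (EFin \o g) -> (forall x, `|f x| <= g x) ->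
  leb.-integrable setT (EFin \o f).
Proof.
move=> mf ig fg; apply: (le_integrable measurableT _ _ ig) => /=.
  exact/measurable_EFinP.
by move=> x _; rewrite lee_fin (le_trans (fg x))// ler_norm.
Qed.

Lemma integrable_gfunZ (c L : R) : 0 < L ->
  leb.-integrable setT (EFin \o (fun x => c * gfun L x)).
Proof. by move=> L0; exact: (integrableZl measurableT c (integrable_gfun L0)). Qed.

(** Half of the Gaussian absorbs the factor [|x|], through [expR_ge1Dx]. The right side is the
    integrable majorant for differentiation under the integral. *)
Lemma xgfun_le (L x : R) : 0 < L -> `|x| * gfun L x <= (1 + 4 / L) * gfun (L / 2) x.
Proof.
move=> L0; have -> : gfun L x = gfun (L / 2) x * gfun (L / 2) x.
  by rewrite /gfun -expRD; congr expR; field.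
rewrite mulrA ler_pM2r ?gfun_gt0//.
rewrite /gfun expRN ler_pdivrMr ?expR_gt0//.
have h : 1 + L / 2 * x ^+ 2 / 2 <= expR (L / 2 * x ^+ 2 / 2) := expR_ge1Dx _.
apply: (@le_trans _ _ ((1 + 4 / L) * (1 + L / 2 * x ^+ 2 / 2))); last first.
  by rewrite ler_pM2l// ltr_wpDr// divr_ge0// ltW.
have -> : (1 + 4 / L) * (1 + L / 2 * x ^+ 2 / 2) = 1 + 4 / L + L * x ^+2 / 4 + x ^+ 2.
  by field; rewrite gt_eqF.
have h1 : 0 <= 4 / L by rewrite divr_ge0// ltW.
have h2 : 0 <= L * x ^+ 2 / 4 by rewrite divr_ge0// mulr_ge0 ?sqr_ge0// ltW.
have h3 : 0 <= (`|x| - 1) ^+ 2 by rewrite sqr_ge0.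
have h4 : `|x| ^+ 2 = x ^+ 2 by rewrite real_normK// num_real.
have : 0 <= `|x| := normr_ge0 x.
nra.
Qed.

(* [hfun] vanishes at infinity, so the integral of [hfun'] is 0: this is the differential equation in [b] satisfied by
   the Fourier transform of [gfun L]. *)
Definition hfun (L a b x : R) : R := sin (a + b * x) * gfun L x.
Definition hfun' (L a b x : R) : R :=
  b * (cos (a + b * x) * gfun L x) - L * (x * sin (a + b * x) * gfun L x).

Lemma is_derive_hfun (L a b x : R) : is_derive x 1 (hfun L a b) (hfun' L a b x).
Proof.
rewrite /hfun /gfun; apply: is_derive_eq.
by rewrite /hfun' /gfun /GRing.scale /=; field.
Qed.

Lemma is_derive_cosf (L a b x : R) :
  is_derive b 1 (fun b => cos (a + b * x) * gfun L x) (- (x * sin (a + b * x) * gfun L x)).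
Proof.
apply: is_derive_eq.
by rewrite /GRing.scale /=; ring.
Qed.

Lemma continuous_derive (f f' : R -> R) : (forall x : R, is_derive x 1 f (f' x)) -> continuous f.
Proof.
move=> df x; apply: differentiable_continuous; apply/derivable1_diffP.
by case: (df x).
Qed.

(** The fundamental theorem of calculus asks for a continuous derivative; here continuity comes from
    differentiating once more. *)
Lemma continuous_hfun' (L a b : R) : continuous (hfun' L a b).
Proof.
apply: (@continuous_derive _ (fun x => - (b ^+ 2 * sin (a + b * x) * gfun L x)
  - L * b * x * cos (a + b * x) * gfun L x - L * (sin (a + b * x) * gfun L x
   + b * x * cos (a + b * x) * gfun L x - L * x ^+ 2 * sin (a + b * x) * gfun L x))) => x.
rewrite /hfun' /gfun; apply: is_derive_eq.
by rewrite /GRing.scale /=; field.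
Qed.

Lemma integrable_cosf (L a b : R) : 0 < L ->
  leb.-integrable setT (EFin \o (fun x => cos (a + b * x) * gfun L x)).
Proof.
move=> L0; apply: (le_integrableR _ (integrable_gfun L0)).
  apply: measurable_funM (measurable_gfun L).
  apply: measurableT_comp; first by apply: continuous_measurable_fun; exact: continuous_cos.
  by apply: measurable_funD => //; exact: measurable_funM.
move=> x; rewrite normrM [X in _ * X]ger0_norm ?gfun_ge0//.
by rewrite ler_piMl ?gfun_ge0//; exact: cos_max.
Qed.

Lemma integrable_sinf (L a b : R) : 0 < L ->
  leb.-integrable setT (EFin \o (fun x => x * sin (a + b * x) * gfun L x)).
Proof.
move=> L0; have L20 : 0 < L / 2 by rewrite divr_gt0.
apply: (le_integrableR _ (integrable_gfunZ (1 + 4 / L) L20)).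
  apply: measurable_funM (measurable_gfun L).
  apply: measurable_funM => //.
  apply: measurableT_comp; first by apply: continuous_measurable_fun; exact: continuous_sin.
  by apply: measurable_funD => //; exact: measurable_funM.
move=> x; rewrite !normrM [X in _ * X]ger0_norm ?gfun_ge0//.
apply: le_trans (xgfun_le x L0); rewrite ler_pM2r ?gfun_gt0//.
by rewrite ler_piMr//; exact: sin_max.
Qed.

Lemma hfun_cvg0 (L a b : R) (u : R^nat) : 0 < L -> (forall n, n%:R <= `|u n|) ->
  hfun L a b (u n) @[n --> \oo] --> (0 : R).
Proof.
move=> L0 un; apply: norm_cvg0.
(* Both bounds on [c] serve [c / 2 * n.+1%:R <= 1 + L * u n ^+ 2 / 2], which turns Gaussian decay
   into a multiple of [harmonic]. *)
pose c := Num.min 1 (L / 2); have c0 : 0 < c by rewrite lt_min ltr01 divr_gt0.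
have c1 : c <= 1 by rewrite ge_min lexx.
have cL : c <= L / 2 by rewrite ge_min lexx orbT.
have hub n : `|hfun L a b (u n)| <= 2 / c * harmonic n.
  rewrite normrM [X in _ * X]ger0_norm ?gfun_ge0//.
  have h1 : `|sin (a + b * u n)| * gfun L (u n) <= gfun L (u n).
    by rewrite ler_piMl ?gfun_ge0//; exact: sin_max.
  apply: (le_trans h1); have -> : 2 / c * harmonic n = (c / 2 * n.+1%:R)^-1 by rewrite invfM invf_div.
  rewrite /gfun expRN lef_pV2 ?posrE ?expR_gt0//; last first.
    by rewrite !mulr_gt0// invr_gt0.
  apply: le_trans (expR_ge1Dx _).
  have : n%:R ^+ 2 <= u n ^+ 2 :> R.
    by rewrite -[u n ^+ 2]real_normK ?num_real// ler_pXn2r ?nnegrE.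
  have n0 : 0 <= n%:R :> R by [].
  rewrite -[n.+1%:R]natr1; move: (n%:R : R) (u n ^+ 2) n0 => x y x0 xy.
  have : 0 <= (x - 1) ^+ 2 := sqr_ge0 _.
  have : c * x ^+ 2 <= L / 2 * y by apply: ler_pM => //; rewrite ?sqr_ge0// ltW.
  nra.
have h0 : 2 / c * harmonic n @[n --> \oo] --> (0 : R).
  by rewrite -[X in _ --> X](mulr0 (2 / c)); apply: cvgMr; exact: cvg_harmonic.
apply: (@squeeze_cvgr _ _ _ _ (cst 0) _ _ _ _ _ h0).
  by apply: nearW => n; rewrite /= normr_ge0 hub.
exact: cvg_cst.
Qed.

Lemma integral_hfun' (L a b : R) : 0 < L -> \int[leb]_x hfun' L a b x = 0.
Proof.
move=> L0.
have ih : leb.-integrable setT (EFin \o hfun' L a b).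
  rewrite /hfun' (_ : _ \o _ = (fun x => ((b * (cos (a + b * x) * gfun L x))%:E - (L * (x * sin (a + b * x) * gfun L x))%:E)%E)) //.
  apply: integrableB => //.
    exact: (integrableZl measurableT b (integrable_cosf a b L0)).
  exact: (integrableZl measurableT L (integrable_sinf a b L0)).
have mh : measurable_fun setT (hfun' L a b).
  by apply: continuous_measurable_fun; exact: continuous_hfun'.
(* The half-width is [n.+1] so that the interval is never degenerate, as [continuous_FTC2]
   requires. *)
pose f_ n : R -> \bar R := (EFin \o hfun' L a b) \_ `[- n.+1%:R, n.+1%:R].
have [] := @dominated_convergence _ _ _ leb setT measurableT f_ (EFin \o hfun' L a b) (abse \o (EFin \o hfun' L a b)).
- move=> n; apply: (measurable_restrictT _ _).1 => //=.
  by apply/measurable_EFinP; exact: measurable_funTS.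
- exact/measurable_EFinP.
- apply: aeW => x _; apply: cvg_near_cst; near=> n.
  rewrite /f_ patchE mem_set//= in_itv/= -ler_norml.
  apply: (@le_trans _ _ n%:R); last by rewrite ler_nat.
  by near: n; exact: nbhs_infty_ger.
- exact: integrable_abse.
- apply: aeW => x n _; rewrite /f_ patchE; case: ifP => // _.
  by rewrite (_ : point = 0%E)// abse0 abse_ge0.
move=> _ _ H.
have {}H : (\int[leb]_(x in `[(- n.+1%:R)%R, (n.+1%:R : R)]) (hfun' L a b x)%:E)%E @[n --> \oo] --> (\int[leb]_x (hfun' L a b x)%:E)%E.
  apply: cvg_trans H; apply: near_eq_cvg; near=> n => /=.
  by rewrite [RHS]integral_mkcond.
have FTC n : (\int[leb]_(x in `[(- n.+1%:R)%R, (n.+1%:R : R)]) (hfun' L a b x)%:E)%E = (hfun L a b n.+1%:R - hfun L a b (- n.+1%:R))%:E.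
  rewrite (@continuous_FTC2 _ _ (hfun L a b)).
  - by rewrite EFinB.
  - by rewrite gtrN// ltr0n.
  - by apply: continuous_subspaceT; exact: continuous_hfun'.
  - split.
    + by move=> x _; case: (is_derive_hfun L a b x).
    + by apply: cvg_at_right_filter; exact: (continuous_derive (is_derive_hfun L a b)).
    + by apply: cvg_at_left_filter; exact: (continuous_derive (is_derive_hfun L a b)).
  - by move=> x _; rewrite derive1E; case: (is_derive_hfun L a b x).
rewrite /Rintegral; have {FTC}H0 : (\int[leb]_(x in `[(- n.+1%:R)%R, (n.+1%:R : R)]) (hfun' L a b x)%:E)%E @[n --> \oo] --> (0%:E : \bar R).
  under eq_fun do rewrite FTC.
  apply: cvg_EFin; first by apply: nearW.
  rewrite /comp/= -[X in _ --> X](subr0 (0:R)); apply: cvgB.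
    by apply: hfun_cvg0 => // n; rewrite ger0_norm// ler_nat.
  by apply: hfun_cvg0 => // n; rewrite normrN ger0_norm// ler_nat.
have -> // := cvg_unique (@ereal_hausdorff R) H H0.
Unshelve. all: by end_near. Qed.

(** The integrating factor [expR (b ^+ 2 / (2 * L))] makes the product constant. *)
Lemma fourier_ode (L a : R) (F : R -> R) : 0 < L ->
  (forall b : R, is_derive b 1 F (- (b / L) * F b)) -> forall b, F b = F 0 * expR (- (b ^+ 2 / (2 * L))).
Proof.
move=> L0 dF b.
pose G (b : R) : R := F b * expR (b ^+ 2 / (2 * L)).
have dG (x : R) : is_derive x 1 G 0.
  apply: is_derive_eq.
  by rewrite /GRing.scale /=; field; rewrite gt_eqF.
have : G b = G 0 := is_derive_0_is_cst b 0 dG.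
rewrite /G expr0n/= mul0r expR0 mulr1 => <-.
by rewrite -mulrA -expRD subrr expR0 mulr1.
Qed.

(** Differentiating in [b] brings down [x * sin], which [integral_hfun'] turns back into the cosine
    integral, so the equation of [fourier_ode] holds. The phase [a] later carries the other
    coordinates, in place of complex exponentials. *)
Lemma gauss_fourier (L a b : R) : 0 < L ->
  \int[leb]_x (cos (a + b * x) * gfun L x) =
  cos a * expR (- (b ^+ 2 / (2 * L))) * (Num.sqrt L^-1 * Num.sqrt (pi *+ 2)).
Proof.
move=> L0; pose F b := \int[leb]_x (cos (a + b * x) * gfun L x).
have d1 x y : partial1of2 (fun b x => cos (a + b * x) * gfun L x) x y = - (y * sin (a + x * y) * gfun L y).
  by rewrite partial1of2E; case: (is_derive_cosf L a x y).
have L20 : 0 < L / 2 by rewrite divr_gt0.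
have dF (c : R) : is_derive c 1 F (- (c / L) * F c).
  (* Differentiation under the integral is local in the parameter; the majorant does not depend on
     [b], so any interval around [c] will do. *)
  have cI : `]c - 1, c + 1[%classic c by rewrite /= in_itv/=; apply/andP; split; lra.
  have H1 x : `]c - 1, c + 1[%classic x -> leb.-integrable setT (EFin \o (fun y => cos (a + x * y) * gfun L y)).
    by move=> _; exact: integrable_cosf.
  have H2 (x y : R) : `]c - 1, c + 1[%classic x -> [set: R] y -> derivable (fun b : R => cos (a + b * y) * gfun L y) x 1.
    by move=> _ _; case: (is_derive_cosf L a x y).
  have H3 : forall y : R, 0 <= (1 + 4 / L) * gfun (L / 2) y.
    by move=> y; rewrite mulr_ge0 ?gfun_ge0// addr_ge0// divr_ge0// ltW.
  have H4 (x y : R) : `]c - 1, c + 1[%classic x -> [set: R] y ->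
     `|partial1of2 (fun b x => cos (a + b * x) * gfun L x) x y| <= (1 + 4 / L) * gfun (L / 2) y.
    move=> _ _; rewrite d1 normrN !normrM [X in _ * X]ger0_norm ?gfun_ge0//.
    apply: le_trans (xgfun_le y L0); rewrite ler_pM2r ?gfun_gt0//.
    by rewrite ler_piMr//; exact: sin_max.
  have mT := @measurableT _ (measurableTypeR R).
  have D := derivable_under_integral mT cI H1 H2 H3 (integrable_gfunZ _ L20) H4.
  have E := differentiation_under_integral mT cI H1 H2 H3 (integrable_gfunZ _ L20) H4.
  apply: DeriveDef; first exact: D.
  rewrite -derive1E [LHS]E.
  under eq_Rintegral do rewrite d1.
  have := integral_hfun' a c L0; rewrite /hfun' RintegralB//; last 2 first.
  - exact: (integrableZl measurableT c (integrable_cosf a c L0)).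
  - exact: (integrableZl measurableT L (integrable_sinf a c L0)).
  rewrite RintegralZl//; last exact: integrable_cosf.
  rewrite RintegralZl//; last exact: integrable_sinf.
  move/eqP; rewrite subr_eq0 => /eqP E2.
  under eq_Rintegral do rewrite -mulN1r.
  rewrite RintegralZl//; last exact: integrable_sinf.
  rewrite mulN1r mulNr; congr (- _).
  by rewrite mulrAC E2 mulrC mulKf// gt_eqF.
rewrite -/(F b) (fourier_ode a L0 dF) /F.
under eq_Rintegral do rewrite mul0r addr0.
rewrite RintegralZl ?Rintegral_gfun//; last exact: integrable_gfun.
by rewrite mulrAC.
Qed.

End gauss1.

Section normal.
Context {R : realType}.
Notation leb := (@lebesgue_measure R).
Notation N := (@normal_prob R 0 1).

Lemma integral_normal_prob (f : R -> \bar R) : measurable_fun setT f ->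
  N.-integrable setT f ->
  (\int[N]_x f x = \int[leb]_x (f x * (normal_pdf 0 1 x)%:E))%E.
Proof.
move=> mf intf.
have dom := @normal_prob_dominates R 0 1.
rewrite -(Radon_Nikodym_change_of_variables dom)//=.
apply: ae_eq_integral => //.
- by apply: emeasurable_funM => //; apply: (measurable_int leb).
- apply: emeasurable_funM => //=; apply/measurableT_comp => //=.
  exact: measurable_normal_pdf.
- apply: ae_eqe_mul2l => /=.
  rewrite Radon_NikodymE//=.
  case: cid => /= h [h1 h2 h3].
  apply: integral_ae_eq => //=.
  + by apply/measurableT_comp => //; exact: measurable_normal_pdf.
  + by move=> E E01 mE; rewrite -h3.
Qed.

Lemma normal_pdf01 (x : R) : normal_pdf 0 1 x = (Num.sqrt (pi *+ 2))^-1 * gfun 1 x.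
Proof.
rewrite normal_pdfE ?oner_neq0// /normal_peak expr1n mul1r.
by rewrite gfun_normal// sqrtr1 invr1.
Qed.

Lemma bint_normal (f : R -> R) : bmf f ->
  \int[N]_x f x = (Num.sqrt (pi *+ 2))^-1 * \int[leb]_x (f x * gfun 1 x).
Proof.
move=> bf; have mf := bf.1.
have ifN := @bmf_integrable _ _ _ N _ bf.
rewrite /Rintegral integral_normal_prob//; last exact/measurable_EFinP.
have ifg : leb.-integrable setT (EFin \o (fun x => f x * gfun 1 x)).
  case: bf => _ [M fM].
  apply: (@le_integrableR _ _ (fun x => M * gfun 1 x)).
  - by apply: measurable_funM => //; exact: measurable_gfun.
  - exact: integrable_gfunZ.
  - by move=> x; rewrite normrM [X in _ * X]ger0_norm ?gfun_ge0// ler_wpM2r ?gfun_ge0.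
rewrite -RintegralZl//; congr fine.
by apply: eq_integral => x _; rewrite -EFinM normal_pdf01; congr EFin; ring.
Qed.

(** The factor with [l] merges with the normal density into a Gaussian of precision [1 + l]. One
    formula thus covers the characteristic function at [l = 0] and the Laplace transform of the
    square at [b = 0]. *)
Lemma normal_fourier (a b l : R) : 0 <= l ->
  \int[N]_x (cos (a + b * x) * expR (- (l * x ^+ 2 / 2))) =
  cos a * expR (- (b ^+ 2 / (2 * (1 + l)))) * (Num.sqrt (1 + l))^-1.
Proof.
move=> l0; have l1 : 0 < 1 + l by rewrite ltr_pwDl.
rewrite bint_normal.
  under eq_Rintegral.
    move=> x _; rewrite /gfun -mulrA -expRD.
    rewrite [X in expR X](_ : _ = - ((1 + l) * x ^+ 2 / 2)); last by field.
    over.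
  rewrite (gauss_fourier a b l1) sqrtrV; last exact: ltW.
  set u := Num.sqrt (pi *+ 2); have u0 : u != 0 by rewrite gt_eqF// sqrtr_gt0 pmulrn_lgt0// pi_gt0.
  rewrite mulrC mulrA -[RHS]mulr1 -(mulfV u0); ring.
apply: bmfM.
  by apply: bmf_cos; apply: measurable_funD => //; exact: measurable_funM.
apply: bmf_expN; last by move=> x; rewrite divr_ge0// mulr_ge0// sqr_ge0.
by apply: measurable_funM => //; apply: measurable_funM => //; exact: measurable_funX.
Qed.

(* Truncated, so that it is bounded and its moments need no integrability argument. *)
Definition exp_trunc (x M : R) := Num.min (expR (x / 4)) M.

Lemma exp_trunc_ge0 x M : 0 <= M -> 0 <= exp_trunc x M.
Proof. by move=> M0; rewrite le_min expR_ge0. Qed.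

(** Both exponentials and [M] are at least 1, so truncating the factors separately loses nothing.
    This lets the moment bound pass to products of coordinates. *)
Lemma exp_truncD x y M : 0 <= x -> 0 <= y -> 1 <= M ->
  exp_trunc (x + y) M <= exp_trunc x M * exp_trunc y M.
Proof.
move=> x0 y0 M1; rewrite /exp_trunc mulrDl expRD.
have : 1 <= expR (x / 4) by rewrite -expR0 ler_expR divr_ge0.
have : 1 <= expR (y / 4) by rewrite -expR0 ler_expR divr_ge0.
move: (expR _) (expR _) => u v u1 v1.
rewrite ge_min; case: (leP v M) => vM; case: (leP u M) => uM; apply/orP.
- by left.
- by right; rewrite ler_peMr// (le_trans ler01).
- by right; rewrite ler_peMl// (le_trans ler01).
- by right; rewrite ler_peMr// (le_trans ler01).
Qed.

Lemma bmf_exp_trunc d (T : measurableType d) (f : T -> R) M : 0 <= M ->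
  measurable_fun setT f -> bmf (fun x => exp_trunc (f x) M).
Proof.
move=> M0 mf; split.
  apply: measurable_minr => //; apply: measurableT_comp => //.
  exact: measurable_funM.
by exists M => x; rewrite ger0_norm ?exp_trunc_ge0// ge_min lexx orbT.
Qed.

(** The exponent [x ^+ 2 / 4] uses up only half of the Gaussian; the integral of the other half is a
    bound uniform in [M]. *)
Lemma normal_exp_moment : exists2 C, 0 <= C &
  forall M, 1 <= M -> \int[N]_x exp_trunc (x ^+ 2) M <= C.
Proof.
pose c : R := (Num.sqrt (pi *+ 2))^-1.
have c0 : 0 <= c by rewrite invr_ge0.
have h0 : 0 < (1 / 2 : R) by rewrite divr_gt0.
exists (c * \int[leb]_x gfun (1 / 2) x).
  by rewrite mulr_ge0// Rintegral_ge0// => x _; exact: gfun_ge0.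
move=> M M1; have M0 : 0 <= M by rewrite (le_trans ler01).
have bE : bmf (fun x : R => exp_trunc (x ^+ 2) M).
  by apply: bmf_exp_trunc => //; exact: measurable_funX.
rewrite bint_normal// ler_wpM2l//.
have E x : exp_trunc (x ^+ 2) M * gfun 1 x <= gfun (1 / 2) x.
  have -> : gfun (1 / 2) x = expR (x ^+ 2 / 4) * gfun 1 x.
    by rewrite /gfun -expRD; congr expR; field.
  by rewrite ler_wpM2r ?gfun_ge0// ge_min lexx.
apply: le_Rintegral => //; last exact: integrable_gfun.
apply: (@le_integrableR _ _ (gfun (1 / 2))).
- by apply: measurable_funM; [exact: bE.1|exact: measurable_gfun].
- exact: integrable_gfun.
- by move=> x; rewrite ger0_norm// mulr_ge0 ?gfun_ge0// exp_trunc_ge0.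
Qed.

End normal.

Section gaussian_vector.
Context {R : realType}.

Lemma bint_cstP d (T : measurableType d) (P : probability T R) (c : R) :
  \int[P]_x c = c.
Proof.
transitivity (c * fine (P setT)); first exact: bint_cst.
by rewrite probability_setT mulr1.
Qed.

Definition sqn k (x : 'rV[R]_k) : R := \sum_(i < k) x ord0 i ^+ 2.
Definition dot k (x y : 'rV[R]_k) : R := \sum_(i < k) x ord0 i * y ord0 i.

Lemma sqn_ge0 k (x : 'rV[R]_k) : 0 <= sqn x.
Proof. by apply: sumr_ge0 => i _; exact: sqr_ge0. Qed.

(** Measurability entry by entry needs no sigma-algebra on matrices, and so applies alike to
    Gaussian vectors on product spaces and to Borel matrices. *)
Definition coord_meas d (T : measurableType d) m k (X : T -> 'M[R]_(m, k)) :=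
  forall i j, measurable_fun setT (fun w => X w i j).

Lemma measurable_sqn d (T : measurableType d) k (X : T -> 'rV[R]_k) :
  coord_meas X -> measurable_fun setT (fun w => sqn (X w)).
Proof.
move=> mX; apply: measurable_sum => i; exact: measurable_funX.
Qed.

Lemma measurable_dot d (T : measurableType d) k (X Y : T -> 'rV[R]_k) :
  coord_meas X -> coord_meas Y -> measurable_fun setT (fun w => dot (X w) (Y w)).
Proof.
move=> mX mY; apply: measurable_sum => i; exact: measurable_funM.
Qed.

Lemma coord_meas_cst d (T : measurableType d) m k (x : 'M[R]_(m, k)) :
  coord_meas (fun _ : T => x).
Proof. by move=> i j. Qed.

Lemma coord_meas_comp d d' (T : measurableType d) (T' : measurableType d') m k
  (X : T -> 'M[R]_(m, k)) (h : T' -> T) : measurable_fun setT h ->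
  coord_meas X -> coord_meas (fun w => X (h w)).
Proof. by move=> mh mX i j; exact: (measurableT_comp (mX i j) mh). Qed.

Definition row_cons k (r : R) (x : 'rV[R]_k) : 'rV[R]_k.+1 :=
  \row_j oapp (fun j' => x ord0 j') r (unlift ord0 j).

Lemma row_cons0 k r (x : 'rV[R]_k) : row_cons r x ord0 ord0 = r.
Proof. by rewrite mxE unlift_none. Qed.

Lemma row_consS k r (x : 'rV[R]_k) i : row_cons r x ord0 (lift ord0 i) = x ord0 i.
Proof. by rewrite mxE liftK. Qed.

Lemma sqn_cons k r (x : 'rV[R]_k) : sqn (row_cons r x) = r ^+ 2 + sqn x.
Proof.
rewrite /sqn big_ord_recl row_cons0; congr (_ + _).
by apply: eq_bigr => i _; rewrite row_consS.
Qed.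

(** Only the joint Fourier-Laplace formula and one exponential moment are ever used, so the law
    stays abstract. Each step of the induction multiplies the space by a standard normal
    coordinate. *)
Lemma gaussian_vector k : exists d (T : measurableType d) (Q : probability T R)
    (X : T -> 'rV[R]_k),
  [/\ coord_meas X,
   forall a (b : 'rV[R]_k) l, 0 <= l ->
     \int[Q]_w (cos (a + dot b (X w)) * expR (- (l * sqn (X w) / 2))) =
     cos a * expR (- (sqn b / (2 * (1 + l)))) * (Num.sqrt (1 + l)) ^- k &
   exists2 C, 0 <= C & forall M, 1 <= M -> \int[Q]_w exp_trunc (sqn (X w)) M <= C].
Proof.
elim: k => [|k [d [T [Q [X [mX fX [C C0 eX]]]]]]].
  exists _, (measurableTypeR R), (@normal_prob R 0 1), (fun=> 0); split.
  - exact: coord_meas_cst.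
  - move=> a b l l0; under eq_Rintegral do rewrite /sqn /dot !big_ord0 addr0 mulr0 mul0r oppr0 expR0 mulr1.
    by rewrite bint_cstP /sqn big_ord0 mul0r oppr0 expR0 expr0 invr1 !mulr1.
  - exists 1 => // M M1; under eq_Rintegral do rewrite /sqn big_ord0.
    by rewrite bint_cstP /exp_trunc mul0r expR0 ge_min lexx.
pose Q' : probability (measurableTypeR R * T)%type R := (@normal_prob R 0 1 \x Q)%E.
pose X' (w : measurableTypeR R * T) := row_cons w.1 (X w.2).
have mX' : coord_meas X'.
  move=> i j; rewrite ord1 => {i}; case: (unliftP ord0 j) => [j'|] ->.
    under eq_fun do rewrite row_consS.
    exact: (measurableT_comp (mX ord0 j') measurable_snd).
  by under eq_fun do rewrite row_cons0; exact: measurable_fst.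
exists _, _, Q', X'; split => //.
- move=> a b l l0.
  have l1 : 0 < 1 + l by rewrite ltr_pwDl.
  have bf : bmf (fun w => cos (a + dot b (X' w)) * expR (- (l * sqn (X' w) / 2))).
    apply: bmfM.
      apply: bmf_cos; apply: measurable_funD => //.
      by apply: measurable_dot => //; exact: coord_meas_cst.
    apply: bmf_expN; last by move=> x; rewrite divr_ge0// mulr_ge0// sqn_ge0.
    by apply: measurable_funM => //; apply: measurable_funM => //; exact: measurable_sqn.
  rewrite (bint_prod _ _ bf).
  (* With the first coordinate fixed, its contribution is a mere shift of the phase, and the
     induction hypothesis applies to the rest. *)
  pose b' : 'rV_k := \row_j b ord0 (lift ord0 j).
  pose c := expR (- (sqn b' / (2 * (1 + l)))) * (Num.sqrt (1 + l)) ^- k.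
  under eq_Rintegral => x _.
    have E w : cos (a + dot b (X' (x, w))) * expR (- (l * sqn (X' (x, w)) / 2)) =
        expR (- (l * x ^+ 2 / 2)) * (cos ((a + b ord0 ord0 * x) + dot b' (X w)) * expR (- (l * sqn (X w) / 2))).
      rewrite /X' sqn_cons /= mulrCA -expRD; congr (cos _ * expR _); last by field.
      rewrite /dot big_ord_recl row_cons0 addrA; congr (_ + _).
      by apply: eq_bigr => i _; rewrite row_consS mxE.
    under eq_Rintegral do rewrite E.
    rewrite bintZl; last first.
      apply: bmfM.
        apply: bmf_cos; apply: measurable_funD => //.
        by apply: measurable_dot => //; exact: coord_meas_cst.
      apply: bmf_expN; last by move=> y; rewrite divr_ge0// mulr_ge0// sqn_ge0.
      by apply: measurable_funM => //; apply: measurable_funM => //; exact: measurable_sqn.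
    rewrite fX// (_ : _ * _ = cos (a + b ord0 ord0 * x) * expR (- (l * x ^+ 2 / 2)) * c); last by rewrite /c; ring.
    over.
  rewrite bintZr; last first.
    apply: bmfM.
      by apply: bmf_cos; apply: measurable_funD => //; exact: measurable_funM.
    apply: bmf_expN; last by move=> x; rewrite divr_ge0// mulr_ge0// sqr_ge0.
    by apply: measurable_funM => //; apply: measurable_funM => //; exact: measurable_funX.
  rewrite normal_fourier// /c.
  have -> : Num.sqrt (1 + l) ^- k.+1 = Num.sqrt (1 + l) ^- k * (Num.sqrt (1 + l))^-1 by rewrite exprSr invfM.
  have -> : sqn b = b ord0 ord0 ^+ 2 + sqn b'.
    by rewrite /sqn big_ord_recl; congr (_ + _); apply: eq_bigr => i _; rewrite mxE.
  rewrite [(_ + sqn b') / _]mulrDl opprD expRD; ring.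
- have [C1 C10 e1] := @normal_exp_moment R.
  exists (C1 * C); first exact: mulr_ge0.
  move=> M M1; have M0 : 0 <= M by rewrite (le_trans ler01).
  have b1 : bmf (fun x : R => exp_trunc (x ^+ 2) M).
    by apply: bmf_exp_trunc => //; exact: measurable_funX.
  have b2 : bmf (fun w => exp_trunc (sqn (X w)) M).
    by apply: bmf_exp_trunc => //; exact: measurable_sqn.
  have b12 : bmf (fun w : measurableTypeR R * T => exp_trunc (w.1 ^+ 2) M * exp_trunc (sqn (X w.2)) M).
    by apply: bmfM; [exact: (bmf_comp measurable_fst b1)|exact: (bmf_comp measurable_snd b2)].
  apply: (@le_trans _ _ (\int[Q']_w (exp_trunc (w.1 ^+ 2) M * exp_trunc (sqn (X w.2)) M))).
    apply: bint_le => //.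
      by apply: bmf_exp_trunc => //; exact: measurable_sqn.
    by move=> w; rewrite sqn_cons exp_truncD// ?sqr_ge0// sqn_ge0.
  rewrite (bint_prod _ _ b12)/=.
  under eq_Rintegral do rewrite bintZl//.
  rewrite bintZr// ler_pM ?e1 ?eX//.
    by apply: bint_ge0 => x; exact: exp_trunc_ge0.
  by apply: bint_ge0 => x; exact: exp_trunc_ge0.
Qed.

End gaussian_vector.

(** * Projections and the Grassmannian *)

Section projections.
Context {R : realType}.

Lemma dotE k (x y : 'rV[R]_k) : dot x y = (x *m y^T) ord0 ord0.
Proof. by rewrite mxE; apply: eq_bigr => i _; rewrite mxE. Qed.

Lemma sqn_dot k (x : 'rV[R]_k) : sqn x = dot x x.
Proof. by apply: eq_bigr => i _; rewrite expr2. Qed.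

Lemma sqnE k (x : 'rV[R]_k) : sqn x = (x *m x^T) ord0 ord0.
Proof. by rewrite sqn_dot dotE. Qed.

Lemma dotC k (x y : 'rV[R]_k) : dot x y = dot y x.
Proof. by apply: eq_bigr => i _; rewrite mulrC. Qed.

Lemma dotBl k (x y z : 'rV[R]_k) : dot (x - y) z = dot x z - dot y z.
Proof. by rewrite !dotE mulmxBl !mxE. Qed.

Lemma dotZr k c (x y : 'rV[R]_k) : dot x (c *: y) = c * dot x y.
Proof. by rewrite !dotE linearZ/= -scalemxAr mxE. Qed.

Lemma dotZl k c (x y : 'rV[R]_k) : dot (c *: x) y = c * dot x y.
Proof. by rewrite dotC dotZr dotC. Qed.

Lemma dot_mulmx k l (x : 'rV[R]_k) (A : 'M[R]_(k, l)) (y : 'rV[R]_l) :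
  dot (x *m A) y = dot x (y *m A^T).
Proof. by rewrite !dotE trmx_mul trmxK mulmxA. Qed.

Lemma sqnZ k c (x : 'rV[R]_k) : sqn (c *: x) = c ^+ 2 * sqn x.
Proof. by rewrite !sqn_dot dotZl dotZr mulrA expr2. Qed.

Lemma sqnN k (x : 'rV[R]_k) : sqn (- x) = sqn x.
Proof. by apply: eq_bigr => i _; rewrite mxE sqrrN. Qed.

Lemma sqnB k (x y : 'rV[R]_k) : sqn (x - y) = sqn (y - x).
Proof. by rewrite -sqnN opprB. Qed.

Lemma sqn0 k : sqn (0 : 'rV[R]_k) = 0.
Proof. by rewrite /sqn big1// => i _; rewrite mxE expr0n. Qed.

Lemma sqn_eq0 k (x : 'rV[R]_k) : (sqn x == 0) = (x == 0).
Proof.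
apply/eqP/eqP => [|->]; last exact: sqn0.
move=> /eqP; rewrite psumr_eq0 => [/allP h|i _]; last exact: sqr_ge0.
apply/rowP => i; have := h i (mem_index_enum i); rewrite sqrf_eq0 => /eqP ->.
by rewrite mxE.
Qed.

Lemma enorm_sqn k (x : 'rV[R]_k) : enorm x = Num.sqrt (sqn x).
Proof. by []. Qed.

(** Gram-Schmidt inside the range of [P], by induction on [n - k]. *)
Lemma orthonormal_extend n k (P : 'M[R]_n) (B : 'M[R]_(k, n)) :
  P^T = P -> P *m P = P -> B *m B^T = 1%:M -> B *m P = B ->
  exists k' (B' : 'M[R]_(k', n)), B' *m B'^T = 1%:M /\ B'^T *m B' = P.
Proof.
move=> PT PP.
have [d] := ubnP (n - k); elim: d => // d IH in k B *.
move=> dk BB BP.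
have kn : (k <= n)%N.
  have : row_free B by apply/row_freeP; exists B^T.
  by rewrite /row_free => /eqP <-; exact: rank_leq_col.
(* [Q] projects onto the part of the plane orthogonal to the rows of [B]; a nonzero row of it,
   normalised, is the next basis vector. *)
pose Q := P - B^T *m B.
have BQ : B *m Q = 0 by rewrite mulmxBr BP mulmxA BB mul1mx subrr.
have QT : Q^T = Q by rewrite /Q linearB/= trmx_mul trmxK PT.
have QB : Q *m B^T = 0 by rewrite -QT -trmx_mul BQ trmx0.
have QP : Q *m P = Q by rewrite /Q mulmxBl PP -mulmxA BP.
have [Q0|Q0] := eqVneq Q 0.
  by exists k, B; split => //; apply/eqP; rewrite eq_sym -subr_eq0; apply/eqP.
have [i ri0] : exists i, row i Q != 0.
  apply: contrapT => /forallNP h; move: Q0; apply/negP; rewrite negbK; apply/eqP.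
  by apply/row_matrixP => i; rewrite row0; apply/eqP; have /negP := h i; rewrite negbK.
pose u := (Num.sqrt (sqn (row i Q)))^-1 *: row i Q.
have su : sqn u = 1.
  by rewrite sqnZ exprVn sqr_sqrtr ?sqn_ge0// mulVf// sqn_eq0.
have uu : u *m u^T = 1%:M.
  by apply/rowP => j; rewrite !ord1 -sqnE su mxE.
have uB : u *m B^T = 0 by rewrite -scalemxAl -row_mul QB row0 scaler0.
have Bu : B *m u^T = 0 by rewrite -[LHS]trmxK trmx_mul trmxK uB trmx0.
have uP : u *m P = u by rewrite -scalemxAl -row_mul QP.
pose B' : 'M[R]_(1 + k, n) := col_mx u B.
have BB' : B' *m B'^T = 1%:M.
  by rewrite tr_col_mx mul_col_row uu uB Bu BB -scalar_mx_block.
have kn' : (1 + k <= n)%N.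
  have : row_free B' by apply/row_freeP; exists B'^T.
  by rewrite /row_free => /eqP <-; exact: rank_leq_col.
apply: (IH _ B') => //.
- by apply: leq_trans (_ : n - k <= d)%N => //; rewrite ltn_sub2l.
- by rewrite mul_col_mx uP BP.
Qed.

Lemma orthonormal_rank n k (P : 'M[R]_n) (B : 'M[R]_(k, n)) :
  B *m B^T = 1%:M -> B^T *m B = P -> \rank P = k.
Proof.
move=> BB BP; have BPB : B *m P = B by rewrite -BP mulmxA BB mul1mx.
apply/eqP; rewrite eqn_leq; apply/andP; split.
  by rewrite -BP (leq_trans (mxrankM_maxr _ _))// rank_leq_row.
have : row_free B by apply/row_freeP; exists B^T.
rewrite /row_free => /eqP <-; rewrite -[X in (\rank X <= _)%N]BPB.
exact: mxrankM_maxr.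
Qed.

(** The rows of [B] form an orthonormal basis of the plane, so [z *m B^T] is the coordinate vector
    of the projection of [z]. It comes from extending the empty family. *)
Lemma grassP n m (P : 'M[R]_n) : grass m P <->
  exists B : 'M[R]_(m, n), B *m B^T = 1%:M /\ B^T *m B = P.
Proof.
split=> [[PT [PP rP]]|[B [BB BP]]].
  have [k [B [BB BP]]] : exists k (B : 'M[R]_(k, n)), B *m B^T = 1%:M /\ B^T *m B = P.
    apply: (@orthonormal_extend _ 0 P 0) => //.
      by apply/matrixP => -[].
    by apply/matrixP => -[].
  have := orthonormal_rank BB BP; rewrite rP => mk.
  by subst k; exists B.
split; first by rewrite -BP trmx_mul trmxK.
split; last exact: orthonormal_rank BB BP.
by rewrite -BP mulmxA -[_ *m B *m _]mulmxA BB mulmx1.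
Qed.

(** The trace is continuous and the rank is not: this form makes the Grassmannian visibly closed. *)
Lemma grass_trP n m (P : 'M[R]_n) : grass m P <->
  P^T = P /\ P *m P = P /\ \tr P = m%:R.
Proof.
split=> [[PT [PP rP]]|[PT [PP tP]]]; split => //; split => //.
  have /grassP[B [BB <-]] : grass m P by [].
  by rewrite mxtrace_mulC BB mxtrace1.
have /grassP[B [BB BP]] : grass (\rank P) P by [].
move: tP; rewrite -{1}BP mxtrace_mulC BB mxtrace1 => /eqP.
by rewrite eqr_nat => /eqP.
Qed.

Lemma sqn_proj n k (P : 'M[R]_n) (B : 'M[R]_(k, n)) (z : 'rV[R]_n) :
  B *m B^T = 1%:M -> B^T *m B = P -> sqn (z *m P) = sqn (z *m B^T).
Proof.
move=> BB BP; rewrite !sqn_dot dot_mulmx -BP trmx_mul trmxK -!mulmxA.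
by rewrite [B *m _]mulmxA BB mul1mx [RHS]dot_mulmx trmxK mulmxA.
Qed.

Lemma sqn_proj_le n m (P : 'M[R]_n) (z : 'rV[R]_n) : grass m P ->
  sqn (z *m P) <= sqn z.
Proof.
move=> [PT [PP _]].
have h : sqn z = sqn (z *m P) + sqn (z *m (1%:M - P)).
  have QT : (1%:M - P)^T = 1%:M - P by rewrite linearB/= trmx1 PT.
  have QQ : (1%:M - P) *m (1%:M - P) = 1%:M - P.
    by rewrite mulmxBl mul1mx mulmxBr mulmx1 PP subrr subr0.
  rewrite !sqn_dot !dot_mulmx PT QT -!mulmxA PP QQ.
  by rewrite mulmxBr mulmx1 [dot z (z - _)]dotC dotBl [dot (z *m P) z]dotC addrC subrK.
by rewrite h lerDl sqn_ge0.
Qed.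

Lemma orthogonal_mxT n (g : 'M[R]_n) : orthogonal_mx g -> orthogonal_mx g^T.
Proof. by rewrite /orthogonal_mx trmxK => /mulmx1C. Qed.

Lemma sqn_orth n (g : 'M[R]_n) (x : 'rV[R]_n) : orthogonal_mx g ->
  sqn (x *m g) = sqn x.
Proof. by move=> og; rewrite !sqn_dot dot_mulmx -mulmxA og mulmx1. Qed.

Lemma orthogonal_transitive n (x y : 'rV[R]_n) : sqn x = sqn y ->
  exists2 g : 'M[R]_n, orthogonal_mx g & x *m g = y.
Proof.
move=> xy; have [->|neq] := eqVneq x y.
  by exists 1%:M; [rewrite /orthogonal_mx trmx1 mulmx1|rewrite mulmx1].
pose u := y - x; pose c := sqn u.
have c0 : c != 0 by rewrite sqn_eq0 subr_eq0 eq_sym.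
have uu : u *m u^T = c%:M by apply/rowP => j; rewrite !ord1 -sqnE mxE eqxx mulr1n.
(* [g] is the reflection in the hyperplane orthogonal to [y - x]; it exchanges two vectors of equal
   length. *)
pose E := (2 / c) *: (u^T *m u); pose g := 1%:M - E.
have EE : E *m E = E + E.
  rewrite /E -scalemxAl -scalemxAr mulmxA -[_ *m u *m _]mulmxA uu mul_mx_scalar -scalemxAl.
  by rewrite -scalerDl !scalerA; congr (_ *: _); field.
have gT : g^T = g by rewrite /g linearB/= trmx1 linearZ/= trmx_mul trmxK.
exists g.
  rewrite /orthogonal_mx gT /g mulmxBl mul1mx [E *m _]mulmxBr mulmx1 EE.
  by rewrite opprB addrK subrK.
have xu : x *m u^T = (- (c / 2))%:M.
  apply/rowP => j; rewrite !ord1 -dotE mxE eqxx mulr1n.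
  have : c = - 2 * dot x u.
    rewrite /c /u sqn_dot dotBl [dot x _]dotC dotBl -/u.
    rewrite ![dot _ (y - x)]dotC !dotBl -!sqn_dot xy [dot x y]dotC; ring.
  by move=> ->; field.
rewrite /g mulmxBr mulmx1 /E -scalemxAr mulmxA xu mul_scalar_mx scalerA.
rewrite (_ : 2 / c * - (c / 2) = -1); last by field.
by rewrite scaleN1r opprK /u addrC subrK.
Qed.

End projections.

(** * Borel measurability of matrix functions and closedness of the Grassmannian *)

Section borel.
Context {R : realType}.

Lemma open_Borel (T : ptopologicalType) (A : set T) : open A ->
  measurable (A : set (Borel T)).
Proof. by move=> oA; exact: sub_sigma_algebra. Qed.

Lemma closed_Borel (T : ptopologicalType) (A : set T) : closed A ->
  measurable (A : set (Borel T)).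
Proof.
by move=> cA; rewrite -[A]setCK; apply: measurableC; apply: open_Borel; exact: closed_openC.
Qed.

Lemma continuous_Borel_fun (T : ptopologicalType) (f : T -> R) : continuous f ->
  measurable_fun (setT : set (Borel T)) (f : Borel T -> R).
Proof.
move=> cf; apply: (measurability _ (RGenOInfty.measurableE R)) => //= _ [_ [x ->] <-].
rewrite setTI; apply: open_Borel; apply: open_comp; last exact: interval_open.
by move=> y _; exact: cf.
Qed.

Lemma continuous_Borel (T U : ptopologicalType) (f : T -> U) : continuous f ->
  measurable_fun (setT : set (Borel T)) (f : Borel T -> Borel U).
Proof.
move=> cf; apply: (@measurability _ _ (Borel T) (Borel U) _ _ (@open U)) => // _ [A oA <-].
rewrite setTI; apply: open_Borel; apply: open_comp => // y _; exact: cf.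
Qed.

Lemma coord_meas_Borel m k : coord_meas (fun P : Borel 'M[R]_(m, k) => P : 'M[R]_(m, k)).
Proof. by move=> i j; apply: continuous_Borel_fun; exact: coord_continuous. Qed.

Lemma coord_meas_mul d (T : measurableType d) m k l (X : T -> 'M[R]_(m, k))
   (Y : T -> 'M[R]_(k, l)) :
  coord_meas X -> coord_meas Y -> coord_meas (fun w => X w *m Y w).
Proof.
move=> mX mY i j; under eq_fun do rewrite mxE.
by apply: measurable_sum => h; exact: measurable_funM.
Qed.

Lemma coord_measB d (T : measurableType d) m k (X Y : T -> 'M[R]_(m, k)) :
  coord_meas X -> coord_meas Y -> coord_meas (fun w => X w - Y w).
Proof.
move=> mX mY i j; under eq_fun do rewrite !mxE.
by apply: measurable_funB.
Qed.

Lemma coord_measZ d (T : measurableType d) m k (c : T -> R) (X : T -> 'M[R]_(m, k)) :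
  measurable_fun setT c -> coord_meas X -> coord_meas (fun w => c w *: X w).
Proof.
move=> mc mX i j; under eq_fun do rewrite !mxE.
by apply: measurable_funM.
Qed.

Lemma continuous_mx_fun (T : topologicalType) m k (f : T -> 'M[R]_(m, k)) :
  (forall i j, continuous (fun x => f x i j)) -> continuous f.
Proof.
move=> cf x; apply/cvg_ballP => e e0.
have : \forall y \near x, forall ij : 'I_m * 'I_k, ball (f x ij.1 ij.2) e (f y ij.1 ij.2).
  apply: filter_forall => -[i j] /=.
  by have /cvg_ballP/(_ e e0) := cf i j x.
by apply: filterS => y h; split => // i j; exact: (h (i, j)).
Qed.

Lemma continuous_sum_fun (T : topologicalType) I (s : seq I) (f : I -> T -> R) :
  (forall i, continuous (f i)) -> continuous (fun x => \sum_(i <- s) f i x).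
Proof.
move=> cf; elim: s => [|i s IH].
  by under eq_fun do rewrite big_nil; exact: cst_continuous.
by under eq_fun do rewrite big_cons; move=> x; apply: cvgD; [exact: cf|exact: IH].
Qed.

Lemma continuous_mulmx (T : topologicalType) m k l (f : T -> 'M[R]_(m, k)) (g : T -> 'M[R]_(k, l)) :
  continuous f -> continuous g -> continuous (fun x => f x *m g x).
Proof.
move=> cf cg; apply: continuous_mx_fun => i j; under eq_fun do rewrite mxE.
apply: continuous_sum_fun => h x; apply: cvgM.
  apply: (@continuous_comp _ _ _ f (fun M : 'M[R]_(m, k) => M i h)); first exact: cf.
  exact: coord_continuous.
apply: (@continuous_comp _ _ _ g (fun M : 'M[R]_(k, l) => M h j)); first exact: cg.
exact: coord_continuous.
Qed.

Lemma continuous_mxB (T : topologicalType) m k (f g : T -> 'M[R]_(m, k)) :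
  continuous f -> continuous g -> continuous (fun x => f x - g x).
Proof.
move=> cf cg; apply: continuous_mx_fun => i j; under eq_fun do rewrite !mxE.
move=> x; apply: cvgB.
  apply: (@continuous_comp _ _ _ f (fun M : 'M[R]_(m, k) => M i j)); first exact: cf.
  exact: coord_continuous.
apply: (@continuous_comp _ _ _ g (fun M : 'M[R]_(m, k) => M i j)); first exact: cg.
exact: coord_continuous.
Qed.

Lemma continuous_sqn n : continuous (@sqn R n).
Proof.
apply: continuous_sum_fun => i x.
apply: (@continuous_comp _ _ _ (fun M : 'rV[R]_n => M ord0 i) (fun y => y ^+ 2)).
  exact: coord_continuous.
exact: exprn_continuous.
Qed.

Lemma continuous_mxtrace n : continuous (@mxtrace R n).
Proof. by apply: continuous_sum_fun => i; exact: coord_continuous. Qed.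

Lemma closed_grass n m : closed (@grass R n m).
Proof.
have -> : @grass R n m = (fun P : 'M[R]_n => P^T - P) @^-1` [set 0] `&`
    ((fun P : 'M[R]_n => P *m P - P) @^-1` [set 0] `&` (@mxtrace R n) @^-1` [set m%:R]).
  apply/seteqP; split => P.
    by move=> /grass_trP [PT [PP tP]]; rewrite /= PT PP tP !subrr.
  move=> /= [/eqP]; rewrite subr_eq0 => /eqP PT [/eqP]; rewrite subr_eq0 => /eqP PP tP.
  by apply/grass_trP.
have cl0 k l (f : 'M[R]_n -> 'M[R]_(k, l)) : continuous f -> closed (f @^-1` [set 0]).
  move=> cf; apply: closed_comp; last first.
    by apply: accessible_closed_set1; apply: hausdorff_accessible; exact: norm_hausdorff.
  by move=> x _; exact: cf.
apply: closedI; first apply: cl0.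
  apply: continuous_mxB; last by move=> ?; exact: cvg_id.
  apply: continuous_mx_fun => i j; under eq_fun do rewrite mxE.
  exact: coord_continuous.
apply: closedI.
  apply: cl0; apply: continuous_mxB; last by move=> ?; exact: cvg_id.
  by apply: continuous_mulmx => ?; exact: cvg_id.
apply: closed_comp; first by move=> x _; exact: continuous_mxtrace.
by apply: accessible_closed_set1; apply: hausdorff_accessible; exact: Rhausdorff.
Qed.

End borel.

(** * Integration against the invariant measure *)

Section grass_integral.
Context {R : realType} (n m : nat) (gam : probability (Borel 'M[R]_n) R).
Hypothesis gamP : grass_invariant_prob m gam.

Let measurable_grass : measurable (grass m : set (Borel 'M[R]_n)).
Proof. by apply: closed_Borel; exact: closed_grass. Qed.

Let gam_grassC : gam (~` (grass m : set (Borel 'M[R]_n))) = 0%E.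
Proof.
rewrite probability_setC//; case: gamP => -> _.
by rewrite subee.
Qed.

Lemma ae_grass : {ae gam, forall P : Borel 'M[R]_n, grass m (P : 'M[R]_n)}.
Proof.
exists (~` (grass m : set (Borel 'M[R]_n))); split => //; exact: measurableC.
Qed.

Lemma gint_le (f g : Borel 'M[R]_n -> R) : bmf f -> bmf g ->
  (forall P : 'M[R]_n, grass m P -> f P <= g P) ->
  \int[gam]_P f P <= \int[gam]_P g P.
Proof.
move=> bf bg fg.
have E h : bmf h -> \int[gam]_P h P = \int[gam]_(P in (grass m : set (Borel 'M[R]_n))) h P.
  move=> bh; rewrite /Rintegral; congr fine.
  rewrite (negligible_integral (measurableC measurable_grass) measurableT _ gam_grassC).
    by rewrite setTD setCK.
  exact: bmf_integrable.
rewrite !E//; apply: le_Rintegral => //.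
  by apply: integrableS (bmf_integrable _ bf).
by apply: integrableS (bmf_integrable _ bg).
Qed.

Lemma gint_eq (f g : Borel 'M[R]_n -> R) : bmf f -> bmf g ->
  (forall P : 'M[R]_n, grass m P -> f P = g P) ->
  \int[gam]_P f P = \int[gam]_P g P.
Proof.
move=> bf bg fg; apply/eqP; rewrite eq_le; apply/andP; split.
  by apply: gint_le => // P gP; rewrite fg.
by apply: gint_le => // P gP; rewrite fg.
Qed.

Lemma measurable_sqn_proj (z : 'rV[R]_n) :
  measurable_fun setT (fun P : Borel 'M[R]_n => sqn (z *m P)).
Proof.
apply: measurable_sqn; apply: (@coord_meas_mul _ _ (Borel 'M[R]_n) _ _ _ (fun=> z)).
  exact: coord_meas_cst.
exact: coord_meas_Borel.
Qed.

(** An orthogonal matrix carries [x] to [y], and conjugating [P] by it preserves [gam]. *)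
Lemma gint_rotation (phi : R -> R) (x y : 'rV[R]_n) : sqn x = sqn y ->
  bmf (fun P : Borel 'M[R]_n => phi (sqn (x *m P))) ->
  bmf (fun P : Borel 'M[R]_n => phi (sqn (y *m P))) ->
  \int[gam]_P phi (sqn (x *m (P : 'M[R]_n))) = \int[gam]_P phi (sqn (y *m (P : 'M[R]_n))).
Proof.
move=> xy bx by_; have [g og xg] := orthogonal_transitive xy.
(* The double transpose reproduces the action in [grass_invariant_prob], taken at the orthogonal
   matrix [g^T]. *)
pose T (P : Borel 'M[R]_n) : Borel 'M[R]_n := (g^T)^T *m P *m g^T.
have mT : measurable_fun setT T.
  apply: (@continuous_Borel 'M[R]_n 'M[R]_n (fun P => (g^T)^T *m P *m g^T)).
  apply: continuous_mulmx; last by move=> ?; exact: cst_continuous.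
  by apply: continuous_mulmx => ?; [exact: cst_continuous|exact: cvg_id].
have TE P : sqn (x *m T P) = sqn (y *m P).
  by rewrite /T trmxK !mulmxA xg sqn_orth//; exact: orthogonal_mxT.
under [RHS]eq_Rintegral do rewrite -TE.
rewrite /Rintegral; congr fine.
transitivity (\int[pushforward gam T]_P (phi (sqn (x *m (P : 'M[R]_n))))%:E)%E.
  apply: eq_measure_integral => A mA _.
  rewrite /pushforward; have [_ inv] := gamP.
  exact: esym (inv g^T (orthogonal_mxT og) A mA).
rewrite integral_pushforward//.
- by apply/measurable_EFinP; exact: bx.1.
- apply: bmf_integrable; under eq_fun do rewrite TE; exact: by_.
Qed.

End grass_integral.

(** * The kernels and their averages *)

Section kernel.
Context {R : realType}.

(* [n] is the dimension of the ambient space and [q] stands for [|zP|^2]; at [n = m] this is [(tau + q)^(-m/2)]. *)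
Definition psi (m n : nat) (tau q : R) : R :=
  Num.sqrt tau ^- m * Num.sqrt (1 + q / tau) ^- n.

Lemma psi_gt0 m n tau q : 0 < tau -> 0 <= q -> 0 < psi m n tau q.
Proof.
move=> t0 q0; rewrite mulr_gt0// invr_gt0 exprn_gt0// sqrtr_gt0//.
by rewrite ltr_pwDl// divr_ge0// ltW.
Qed.

Lemma psi_le m n tau q : 0 < tau -> 0 <= q -> psi m n tau q <= Num.sqrt tau ^- m.
Proof.
move=> t0 q0; rewrite /psi ler_piMr ?invr_ge0 ?exprn_ge0//.
have s1 : 1 <= Num.sqrt (1 + q / tau).
  by rewrite -[leLHS]sqrtr1 ler_sqrt ?lerDl ?divr_ge0// ?ltW// ltr_pwDl// divr_ge0// ltW.
by rewrite invf_le1 ?exprn_ege1// (lt_le_trans ltr01)// exprn_ege1.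
Qed.

Lemma psi_anti m n tau q q' : 0 < tau -> 0 <= q -> q <= q' ->
  psi m n tau q' <= psi m n tau q.
Proof.
move=> t0 q0 qq'; rewrite /psi ler_wpM2l ?invr_ge0 ?exprn_ge0//.
have p x : 0 <= x -> 0 < Num.sqrt (1 + x / tau).
  by move=> x0; rewrite sqrtr_gt0 ltr_pwDl// divr_ge0// ltW.
have q'0 := le_trans q0 qq'.
rewrite lef_pV2 ?posrE ?exprn_gt0 ?p// lerXn2r ?nnegrE//.
by rewrite ler_wsqrtr// lerD2l ler_pM2r ?invr_gt0.
Qed.

(** With the absolute value the base [1 + q / tau] stays positive, so continuity holds on the whole
    line; [psi] is only evaluated at [q >= 0]. *)
Lemma continuous_psi m n tau : 0 < tau -> continuous (fun x : R => psi m n tau `|x|).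
Proof.
move=> t0 x; apply: cvgMr; apply: cvgV.
  by rewrite expf_neq0// gt_eqF// sqrtr_gt0 ltr_pwDl// divr_ge0// ltW.
apply: (@continuous_comp _ _ _ (fun x : R => Num.sqrt (1 + `|x| / tau)) (fun y => y ^+ n)); last exact: exprn_continuous.
apply: (@continuous_comp _ _ _ (fun x : R => 1 + `|x| / tau) Num.sqrt); last exact: sqrt_continuous.
by apply: cvgD; [exact: cvg_cst|apply: cvgMl; exact: norm_continuous].
Qed.

Lemma bmf_psi d (T : measurableType d) m n tau (q : T -> R) : 0 < tau ->
  (forall x, 0 <= q x) -> measurable_fun setT q -> bmf (fun x => psi m n tau (q x)).
Proof.
move=> t0 q0 mq; split.
  have -> : (fun x => psi m n tau (q x)) = (fun x : R => psi m n tau `|x|) \o q.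
    by apply/funext => x /=; rewrite ger0_norm.
  apply: measurableT_comp => //; apply: continuous_measurable_fun.
  exact: continuous_psi.
exists (Num.sqrt tau ^- m) => x.
by rewrite ger0_norm ?psi_le// ltW// psi_gt0.
Qed.

(* A pair [(c, i)] of [l] stands for the term [c * psi ((i + 1) tau)]; the transform of [psi ((i + 1) tau)] mixes
   the powers [y ^+ i.+1], so [y * wpol l y] is the symbol of [Ker l]. *)
Definition Ker m n (l : seq (R * nat)) tau q := \sum_(p <- l) p.1 * psi m n (p.2.+1%:R * tau) q.
Definition wpol (l : seq (R * nat)) (y : R) := \sum_(p <- l) p.1 * y ^+ p.2.

Lemma bmf_Ker d (T : measurableType d) m n l tau (q : T -> R) : 0 < tau ->
  (forall x, 0 <= q x) -> measurable_fun setT q -> bmf (fun x => Ker m n l tau (q x)).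
Proof.
move=> t0 q0 mq; apply: bmf_sum => -[c i]; apply: bmfM; first exact: bmf_cst.
by apply: bmf_psi => //; rewrite mulr_gt0.
Qed.

Lemma Ker_le m n l tau q : 0 < tau -> 0 <= q ->
  Ker m n l tau q <= (\sum_(p <- l) `|p.1|) * Num.sqrt tau ^- m.
Proof.
move=> t0 q0; rewrite /Ker mulr_suml; apply: ler_sum => p _.
rewrite (le_trans (ler_norm _))// normrM ler_wpM2l//.
have N0 : 0 < p.2.+1%:R * tau by rewrite mulr_gt0.
rewrite ger0_norm; last by rewrite ltW// psi_gt0.
rewrite (le_trans (psi_le _ _ N0 q0))//.
rewrite lef_pV2 ?posrE ?exprn_gt0 ?sqrtr_gt0// lerXn2r ?nnegrE//.
by rewrite ler_wsqrtr// ler_peMl ?ler1n// ltW.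
Qed.

End kernel.

Section gaussian.
Context {R : realType} d (T : measurableType d) (Q : probability T R) (k : nat)
  (Y : T -> 'rV[R]_k).
Hypothesis mY : coord_meas Y.
Hypothesis fY : forall a (b : 'rV[R]_k) l, 0 <= l ->
     \int[Q]_w (cos (a + dot b (Y w)) * expR (- (l * sqn (Y w) / 2))) =
     cos a * expR (- (sqn b / (2 * (1 + l)))) * (Num.sqrt (1 + l)) ^- k.

Lemma gaussian_laplace l : 0 <= l ->
  \int[Q]_w expR (- (l * sqn (Y w) / 2)) = Num.sqrt (1 + l) ^- k.
Proof.
move=> l0; have := fY 0 0 l0.
have E w : dot 0 (Y w) = 0 by rewrite /dot big1// => i _; rewrite mxE mul0r.
under eq_Rintegral do rewrite E addr0 cos0 mul1r.
by move=> ->; rewrite cos0 sqn0 mul0r oppr0 expR0 !mul1r.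
Qed.

Lemma gaussian_char b : \int[Q]_w cos (dot b (Y w)) = expR (- (sqn b / 2)).
Proof.
have := fY 0 b (lexx 0).
under eq_Rintegral do rewrite add0r mul0r mul0r oppr0 expR0 mulr1.
by move=> ->; rewrite cos0 addr0 mulr1 mul1r sqrtr1 expr1n invr1 mulr1.
Qed.

End gaussian.

Section averaging.
Context {R : realType} d (T : measurableType d) (Q : probability T R) (n : nat)
  (Y : T -> 'rV[R]_n).
Hypothesis mY : coord_meas Y.
Hypothesis fY : forall a (b : 'rV[R]_n) l, 0 <= l ->
     \int[Q]_w (cos (a + dot b (Y w)) * expR (- (l * sqn (Y w) / 2))) =
     cos a * expR (- (sqn b / (2 * (1 + l)))) * (Num.sqrt (1 + l)) ^- n.
Context d' (T' : measurableType d') (Q' : probability T' R) (m : nat)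
  (X : T' -> 'rV[R]_m).
Hypothesis mX : coord_meas X.
Hypothesis fX : forall a (b : 'rV[R]_m) l, 0 <= l ->
     \int[Q']_w (cos (a + dot b (X w)) * expR (- (l * sqn (X w) / 2))) =
     cos a * expR (- (sqn b / (2 * (1 + l)))) * (Num.sqrt (1 + l)) ^- m.

(* The projection of a standard Gaussian vector to an m-plane is a standard Gaussian of that plane. *)
Lemma gaussian_proj_laplace (P : 'M[R]_n) l : grass m P -> 0 <= l ->
  \int[Q]_w expR (- (l * sqn (Y w *m P) / 2)) = Num.sqrt (1 + l) ^- m.
Proof.
move=> /grassP[B [BB BP]] l0.
have ms : measurable_fun setT (fun w : T * T' => dot (X w.2 *m B) (Y w.1)).
  apply: measurable_dot; last exact: (coord_meas_comp (h := fst)).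
  apply: coord_meas_mul; last exact: coord_meas_cst.
  exact: (coord_meas_comp (h := snd)).
have bf : bmf (fun w : T * T' => cos (Num.sqrt l * dot (X w.2 *m B) (Y w.1))).
  by apply: bmf_cos; apply: measurable_funM.
(* The exponential of a square is the characteristic function of an auxiliary Gaussian [X] of
   dimension [m]. The phase is then linear in [Y], and the isometry [B] can be moved onto [X]. *)
transitivity (\int[Q]_w \int[Q']_w' cos (Num.sqrt l * dot (X w' *m B) (Y w))).
  apply: eq_Rintegral => w _; have E w' : Num.sqrt l * dot (X w' *m B) (Y w) =
      dot (Num.sqrt l *: (Y w *m B^T)) (X w').
    by rewrite dot_mulmx dotC dotZl.
  under [RHS]eq_Rintegral do rewrite E.
  by rewrite (gaussian_char fX) sqnZ sqr_sqrtr// (sqn_proj _ BB BP).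
rewrite (bint_fubini Q Q' bf) -(gaussian_laplace fX)//.
apply: eq_Rintegral => w' _.
under eq_Rintegral do rewrite /= -dotZl.
rewrite (gaussian_char fY) sqnZ sqr_sqrtr//.
suff -> : sqn (X w' *m B) = sqn (X w') by [].
by rewrite !sqn_dot dot_mulmx -mulmxA BB mulmx1.
Qed.

(** The power n is the mean of a Gaussian in |zP||Y|, with [Y] Gaussian in the ambient space.
    Averaged over [P], this depends on |z||Y| only, so [z] and [Y] may trade places; and YP is an
    m-dimensional Gaussian, whence the power m. *)
Lemma gint_psi (gam : probability (Borel 'M[R]_n) R) tau (z : 'rV[R]_n) :
  grass_invariant_prob m gam -> 0 < tau ->
  \int[gam]_P psi m n tau (sqn (z *m (P : 'M[R]_n))) = psi m m tau (sqn z).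
Proof.
move=> gamP t0.
pose c (a b : R) := expR (- (a / tau * b / 2)).
have ms : measurable_fun setT (fun w : T * Borel 'M[R]_n => sqn (Y w.1 *m (w.2 : 'M[R]_n))).
  apply: measurable_sqn; apply: coord_meas_mul.
    exact: (coord_meas_comp (h := fst)).
  exact: (coord_meas_comp (h := snd) _ (@coord_meas_Borel R n n)).
have bz y : bmf (fun P : Borel 'M[R]_n => expR (- (sqn (y *m (P : 'M[R]_n)) / tau / 2))).
  apply: bmf_expN; last by move=> P; rewrite !divr_ge0 ?sqn_ge0// ltW.
  by do 2 apply: measurable_funM => //; exact: measurable_sqn_proj.
have msY : measurable_fun setT (fun w => sqn (Y w)) by exact: measurable_sqn.
have bzY : bmf (fun w : Borel 'M[R]_n * T => expR (- (sqn (z *m (w.1 : 'M[R]_n)) / tau * sqn (Y w.2) / 2))).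
  apply: bmf_expN; last by move=> w; rewrite divr_ge0// mulr_ge0 ?divr_ge0 ?sqn_ge0// ltW.
  apply: measurable_funM => //; apply: measurable_funM.
    apply: measurable_funM => //.
    exact: (measurableT_comp (@measurable_sqn_proj R n z) measurable_fst).
  exact: (measurableT_comp msY measurable_snd).
have bYz : bmf (fun w : T * Borel 'M[R]_n => expR (- (sqn z / tau * sqn (Y w.1 *m (w.2 : 'M[R]_n)) / 2))).
  apply: bmf_expN; last by move=> w; rewrite divr_ge0// mulr_ge0 ?divr_ge0 ?sqn_ge0// ltW.
  by apply: measurable_funM => //; apply: measurable_funM.
rewrite /psi bintZl; last first.
  (* Taking [m = 0] in [psi] removes the prefactor, so that [bmf_psi] covers the bare power. *)
  have -> : (fun P : Borel 'M[R]_n => Num.sqrt (1 + sqn (z *m P) / tau) ^- n) =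
     (fun P : Borel 'M[R]_n => psi 0 n tau (sqn (z *m P))).
    by apply/funext => P; rewrite /psi expr0 invr1 mul1r.
  apply: bmf_psi => //; last exact: measurable_sqn_proj.
  by move=> P; exact: sqn_ge0.
congr (_ * _).
transitivity (\int[gam]_P \int[Q]_w expR (- (sqn (z *m (P : 'M[R]_n)) / tau * sqn (Y w) / 2))).
  by apply: eq_Rintegral => P _; rewrite (gaussian_laplace fY)// divr_ge0 ?sqn_ge0// ltW.
rewrite (bint_fubini gam Q bzY).
transitivity (\int[Q]_w \int[gam]_P expR (- (sqn z / tau * sqn (Y w *m (P : 'M[R]_n)) / 2))).
  apply: eq_Rintegral => w _.
  (* The vectors |Y| z and |z| Y have the same length, which is what [gint_rotation] needs. *)
  have E1 P : sqn (z *m P) / tau * sqn (Y w) / 2 = sqn (Num.sqrt (sqn (Y w)) *: z *m P) / tau / 2.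
    by rewrite -scalemxAl sqnZ sqr_sqrtr ?sqn_ge0//; ring.
  have E2 P : sqn z / tau * sqn (Y w *m P) / 2 = sqn (Num.sqrt (sqn z) *: Y w *m P) / tau / 2.
    by rewrite -scalemxAl sqnZ sqr_sqrtr ?sqn_ge0//; ring.
  under eq_Rintegral do rewrite E1.
  under [RHS]eq_Rintegral do rewrite E2.
  apply: (gint_rotation gamP (phi := fun t => expR (- (t / tau / 2)))); try exact: bz.
  by rewrite !sqnZ !sqr_sqrtr ?sqn_ge0// mulrC.
rewrite (bint_fubini Q gam bYz).
rewrite (gint_eq gamP (g := fun=> Num.sqrt (1 + sqn z / tau) ^- m)) ?bint_cstP//.
- exact: (bmf_bint2 Q gam bYz).
- exact: bmf_cst.
- by move=> P gP; apply: gaussian_proj_laplace => //; rewrite divr_ge0 ?sqn_ge0// ltW.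
Qed.

End averaging.

(** * Positive definiteness *)

Section mutual_energy.
Context {R : realType} (n : nat).
Notation V := (Borel 'rV[R]_n).
Notation fmeas := {finite_measure set V -> \bar R}.

(** The densities [f] and [g] remain factors of the integrand, so that weights of either sign
    require no signed measures. *)
Definition En (kap : 'rV[R]_n -> R) (mu : fmeas) (f : V -> R) (nu : fmeas) (g : V -> R) : R :=
  \int[mu]_x \int[nu]_y (f x * g y * kap ((x : 'rV[R]_n) - y)).

Context d (T : measurableType d) (Q : probability T R) (xi : T -> 'rV[R]_n) (W : T -> R).
Hypothesis mxi : coord_meas xi.
Hypothesis bW : bmf W.

(** [Cf] and [Sf] are, up to sign, the real and imaginary parts of the Fourier transform of f mu at
    the random frequency [xi w]. *)
Definition Cf (mu : fmeas) (f : V -> R) (w : T) : R := \int[mu]_x (f x * cos (dot (x : 'rV[R]_n) (xi w))).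
Definition Sf (mu : fmeas) (f : V -> R) (w : T) : R := \int[mu]_x (f x * sin (dot (x : 'rV[R]_n) (xi w))).

Let mdot : measurable_fun setT (fun p : V * T => dot (p.1 : 'rV[R]_n) (xi p.2)).
Proof.
apply: measurable_dot; last exact: (coord_meas_comp (h := snd)).
exact: (coord_meas_comp (h := fst) _ (@coord_meas_Borel R 1 n)).
Qed.

Let mdot1 w : measurable_fun setT (fun p : V => dot (p : 'rV[R]_n) (xi w)).
Proof. apply: measurable_dot; [exact: coord_meas_Borel|exact: coord_meas_cst]. Qed.

Let mdot2 (x : 'rV[R]_n) : measurable_fun setT (fun w => dot x (xi w)).
Proof. apply: measurable_dot => //; exact: coord_meas_cst. Qed.

Let bmf_fc f : bmf f -> bmf (fun p : V * T => f p.1 * cos (dot (p.1 : 'rV[R]_n) (xi p.2))).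
Proof.
move=> bf; apply: bmfM; last exact: bmf_cos.
exact: (bmf_comp measurable_fst bf).
Qed.

Let bmf_fs f : bmf f -> bmf (fun p : V * T => f p.1 * sin (dot (p.1 : 'rV[R]_n) (xi p.2))).
Proof.
move=> bf; apply: bmfM; last exact: bmf_sin.
exact: (bmf_comp measurable_fst bf).
Qed.

Lemma bmf_Cf mu f : bmf f -> bmf (Cf mu f).
Proof. by move=> bf; exact: (bmf_bint2 mu Q (bmf_fc bf)). Qed.

Lemma bmf_Sf mu f : bmf f -> bmf (Sf mu f).
Proof. by move=> bf; exact: (bmf_bint2 mu Q (bmf_fs bf)). Qed.

Lemma En_fourier kap c (mu nu : fmeas) f g : bmf f -> bmf g ->
  (forall z, kap z = c * \int[Q]_w (cos (dot z (xi w)) * W w)) ->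
  En kap mu f nu g =
  c * \int[Q]_w (W w * (Cf mu f w * Cf nu g w + Sf mu f w * Sf nu g w)).
Proof.
move=> bf bg kE.
have bfc w : bmf (fun x : V => f x * cos (dot (x : 'rV[R]_n) (xi w))) by apply: bmfM => //; exact: bmf_cos.
have bfs w : bmf (fun x : V => f x * sin (dot (x : 'rV[R]_n) (xi w))) by apply: bmfM => //; exact: bmf_sin.
have bgc w : bmf (fun x : V => g x * cos (dot (x : 'rV[R]_n) (xi w))) by apply: bmfM => //; exact: bmf_cos.
have bgs w : bmf (fun x : V => g x * sin (dot (x : 'rV[R]_n) (xi w))) by apply: bmfM => //; exact: bmf_sin.
have bC := bmf_Cf nu bg; have bS := bmf_Sf nu bg.
have inner (x : V) : \int[nu]_y (f x * g y * kap ((x : 'rV[R]_n) - y)) =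
   c * \int[Q]_w (W w * (f x * cos (dot (x : 'rV[R]_n) (xi w)) * Cf nu g w + f x * sin (dot (x : 'rV[R]_n) (xi w)) * Sf nu g w)).
  have bG : bmf (fun p : V * T => W p.2 * (f x * cos (dot (x : 'rV[R]_n) (xi p.2)) * (g p.1 * cos (dot (p.1 : 'rV[R]_n) (xi p.2)))
        + f x * sin (dot (x : 'rV[R]_n) (xi p.2)) * (g p.1 * sin (dot (p.1 : 'rV[R]_n) (xi p.2))))).
    apply: bmfM; first exact: (bmf_comp measurable_snd bW).
    apply: bmfD; apply: bmfM; [|exact: bmf_fc| |exact: bmf_fs].
      apply: bmfM; first exact: bmf_cst.
      by apply: bmf_cos; exact: (measurableT_comp (mdot2 x) measurable_snd).
    apply: bmfM; first exact: bmf_cst.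
    by apply: bmf_sin; exact: (measurableT_comp (mdot2 x) measurable_snd).
  transitivity (\int[nu]_y (c * \int[Q]_w (W w * (f x * cos (dot (x : 'rV[R]_n) (xi w)) * (g y * cos (dot (y : 'rV[R]_n) (xi w)))
        + f x * sin (dot (x : 'rV[R]_n) (xi w)) * (g y * sin (dot (y : 'rV[R]_n) (xi w))))))).
    apply: eq_Rintegral => y _; rewrite kE mulrCA; congr (c * _).
    rewrite -bintZl; last by apply: bmfM => //; exact: bmf_cos.
    by apply: eq_Rintegral => w _; rewrite dotBl cosB; ring.
  rewrite bintZl; last exact: (bmf_bint1 nu Q bG).
  rewrite (bint_fubini nu Q bG) /=; congr (c * _).
  apply: eq_Rintegral => w _; rewrite bintZl; last by apply: bmfD; apply: bmfM => //; exact: bmf_cst.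
  congr (_ * _); rewrite bintD; [|by apply: bmfM => //; exact: bmf_cst..].
  by rewrite !bintZl.
rewrite /En; under eq_Rintegral do rewrite inner.
have bG : bmf (fun p : V * T => W p.2 * (f p.1 * cos (dot (p.1 : 'rV[R]_n) (xi p.2)) * Cf nu g p.2
      + f p.1 * sin (dot (p.1 : 'rV[R]_n) (xi p.2)) * Sf nu g p.2)).
  apply: bmfM; first exact: (bmf_comp measurable_snd bW).
  apply: bmfD; apply: bmfM; [exact: bmf_fc| |exact: bmf_fs|].
    exact: (bmf_comp measurable_snd bC).
  exact: (bmf_comp measurable_snd bS).
rewrite bintZl; last exact: (bmf_bint1 mu Q bG).
rewrite (bint_fubini mu Q bG) /=; congr (c * _).
apply: eq_Rintegral => w _; rewrite bintZl; last by apply: bmfD; apply: bmfM => //; exact: bmf_cst.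
congr (_ * _); rewrite bintD; [|by apply: bmfM => //; exact: bmf_cst..].
by rewrite !bintZr.
Qed.

(** On the Fourier side the expression is [c] times the [W]-weighted mean of the squared modulus of
    the transform of f mu + g nu. *)
Lemma En_pd kap c (mu nu : fmeas) f g : bmf f -> bmf g -> 0 <= c -> (forall w, 0 <= W w) ->
  (forall z, kap z = c * \int[Q]_w (cos (dot z (xi w)) * W w)) ->
  0 <= En kap mu f mu f + 2 * En kap mu f nu g + En kap nu g nu g.
Proof.
move=> bf bg c0 W0 kE; rewrite !(En_fourier _ _ _ _ kE)//.
have bC1 := bmf_Cf mu bf; have bS1 := bmf_Sf mu bf.
have bC2 := bmf_Cf nu bg; have bS2 := bmf_Sf nu bg.
have b u v u' v' : bmf u -> bmf v -> bmf u' -> bmf v' -> bmf (fun w => W w * (u w * v w + u' w * v' w)).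
  by move=> *; apply: bmfM => //; apply: bmfD; exact: bmfM.
have b1 := b _ _ _ _ bC1 bC1 bS1 bS1; have b2 := b _ _ _ _ bC1 bC2 bS1 bS2.
have b3 := b _ _ _ _ bC2 bC2 bS2 bS2; have b2' := bmfM (bmf_cst _ 2) b2.
rewrite mulrCA -mulrDr -mulrDr mulr_ge0// -bintZl//.
rewrite -bintD// -bintD//; last exact: bmfD.
apply: bint_ge0 => w.
have -> : forall a b c d W : R, W * (a * a + b * b) + 2 * (W * (a * c + b * d)) + W * (c * c + d * d)
   = W * ((a + c) ^+ 2 + (b + d) ^+ 2) by move=> *; ring.
by rewrite mulr_ge0// addr_ge0// sqr_ge0.
Qed.

End mutual_energy.

Section positive_definite.
Context {R : realType} (m n : nat).
Notation V := (Borel 'rV[R]_n).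
Notation fmeas := {finite_measure set V -> \bar R}.

(* [xi] is [|Y| X / sqrt tau] in the plane of [P], with [X] and [Y] independent Gaussian vectors of dimensions [m] and
   [n], and [y = exp (- |X|^2 / 2)]. *)
Lemma Ker_fourier (P : 'M[R]_n) : grass m P ->
  exists d (T : measurableType d) (Q : probability T R) (xi : R -> T -> 'rV[R]_n) (y : T -> R),
  [/\ (forall tau, 0 < tau -> coord_meas (xi tau)),
      (forall w, 0 < y w <= 1), bmf y &
  forall l tau z, 0 < tau -> Ker m n l tau (sqn (z *m P)) =
     Num.sqrt tau ^- m * \int[Q]_w (cos (dot z (xi tau w)) * wpol l (y w))].
Proof.
move=> /grassP[B [BB BP]].
have [d1 [T1 [Q1 [Y [mY fY _]]]]] := @gaussian_vector R n.
have [d2 [T2 [Q2 [X [mX fX _]]]]] := @gaussian_vector R m.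
pose Q : probability (T1 * T2)%type R := (Q1 \x Q2)%E.
pose xi tau (w : T1 * T2) := Num.sqrt (sqn (Y w.1) / tau) *: (X w.2 *m B).
pose y (w : T1 * T2) := expR (- (sqn (X w.2) / 2)).
have mxi tau : 0 < tau -> coord_meas (xi tau).
  move=> t0; apply: coord_measZ.
    apply: measurableT_comp; first by apply: continuous_measurable_fun; exact: sqrt_continuous.
    apply: measurable_funM => //; apply: measurable_sqn.
    exact: (coord_meas_comp (h := fst)).
  apply: coord_meas_mul; last exact: coord_meas_cst.
  exact: (coord_meas_comp (h := snd)).
have by_ : bmf y.
  apply: bmf_expN; last by move=> w; rewrite divr_ge0// sqn_ge0.
  apply: measurable_funM => //; apply: measurable_sqn.
  exact: (coord_meas_comp (h := snd)).
have bcy tau z i : 0 < tau -> bmf (fun w => cos (dot z (xi tau w)) * y w ^+ i).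
  move=> t0; apply: bmfM; last exact: bmfX.
  by apply: bmf_cos; apply: measurable_dot; [exact: coord_meas_cst|exact: mxi].
have psiE tau z i : 0 < tau -> psi m n (i.+1%:R * tau) (sqn (z *m P)) =
    Num.sqrt tau ^- m * \int[Q]_w (cos (dot z (xi tau w)) * y w ^+ i).
  move=> t0; rewrite (bint_prod Q1 Q2 (bcy _ _ _ t0)).
  pose q := sqn (z *m P).
  have q0 : 0 <= q by exact: sqn_ge0.
  (* Integrating over [X], with [y ^+ i] as Laplace weight, leaves a Gaussian in |Y|; integrating
     that over the n-dimensional [Y] gives the power n of [psi]. *)
  transitivity (Num.sqrt tau ^- m * \int[Q1]_w (Num.sqrt i.+1%:R ^- m * expR (- (q / (i.+1%:R * tau) * sqn (Y w) / 2)))).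
    rewrite bintZl; last first.
      apply: bmf_expN; last by move=> w; rewrite divr_ge0// mulr_ge0 ?sqn_ge0// divr_ge0// mulr_ge0// ltW.
      by apply: measurable_funM => //; apply: measurable_funM => //; exact: measurable_sqn.
    rewrite (gaussian_laplace fY); last by rewrite divr_ge0// mulr_ge0// ltW.
    by rewrite /psi -/q sqrtrM// exprMn invfM; ring.
  congr (_ * _); apply: eq_Rintegral => w _.
  have E w' : cos (dot z (xi tau (w, w'))) * y (w, w') ^+ i =
     cos (0 + dot (Num.sqrt (sqn (Y w) / tau) *: (z *m B^T)) (X w')) * expR (- (i%:R * sqn (X w') / 2)).
    rewrite /xi /y /= add0r dotZr dotZl dot_mulmx trmxK -expRM_natl; congr (_ * expR _).
    by rewrite mulrN mulrA.
  under [RHS]eq_Rintegral do rewrite E.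
  rewrite fX// cos0 mul1r sqnZ sqr_sqrtr ?divr_ge0 ?sqn_ge0 ?(ltW t0)//.
  rewrite -(sqn_proj _ BB BP) -/q mulrC [1 + i%:R]addrC natr1; congr (expR _ * _).
  have i0 : i.+1%:R != 0 :> R by rewrite pnatr_eq0.
  move: i0; move: (i.+1%:R : R) => N N0.
  by field; rewrite N0 gt_eqF.
exists _, _, Q, xi, y; split => //.
  by move=> w; rewrite expR_gt0/= -expR0 ler_expR oppr_le0 divr_ge0// sqn_ge0.
move=> l tau z t0; rewrite /wpol /Ker.
under [in RHS]eq_Rintegral do rewrite mulr_sumr.
under [in RHS]eq_Rintegral do under eq_bigr do rewrite mulrCA.
rewrite bint_sum; last by move=> p; apply: bmfM; [exact: bmf_cst|exact: bcy].
rewrite mulr_sumr; apply: eq_bigr => p _.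
by rewrite psiE// bintZl; [rewrite mulrCA|exact: bcy].
Qed.

Definition KP (P : 'M[R]_n) l tau (z : 'rV[R]_n) := Ker m n l tau (sqn (z *m P)).

Lemma Ker_pd (P : 'M[R]_n) l tau (mu nu : fmeas) f g : grass m P -> 0 < tau ->
  (forall y, 0 < y -> y <= 1 -> 0 <= wpol l y) -> bmf f -> bmf g ->
  0 <= En (KP P l tau) mu f mu f + 2 * En (KP P l tau) mu f nu g
       + En (KP P l tau) nu g nu g.
Proof.
move=> gP t0 wl0 bf bg.
have [d [T [Q [xi [y [mxi y01 by_ kE]]]]]] := Ker_fourier gP.
have bW : bmf (fun w => wpol l (y w)).
  by apply: bmf_sum => p; apply: bmfM; [exact: bmf_cst|exact: bmfX].
have kEt z : KP P l tau z = Num.sqrt tau ^- m * \int[Q]_w (cos (dot z (xi tau w)) * wpol l (y w)).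
  exact: kE.
apply: (@En_pd _ _ _ _ Q _ _ (mxi _ t0) bW _ _ mu nu f g bf bg _ _ kEt).
  by rewrite invr_ge0 exprn_ge0.
by move=> w; have /andP[] := y01 w => ? ?; exact: wl0.
Qed.

End positive_definite.

(** * Dyadic decomposition of the Riesz kernel *)

Section lists.
Context {R : realType}.
Implicit Types (l : seq (R * nat)) (j k : nat).

Definition lone i : seq (R * nat) := [:: (1, i)].
Definition lopp l : seq (R * nat) := [seq (- p.1, p.2) | p <- l].
(* Replaces [tau] by [2 tau]. *)
Definition lscale l : seq (R * nat) := [seq (p.1, p.2.*2.+1) | p <- l].
(* The coefficients of [1 - (1 - y) ^+ j], see [wpol_Psi]. *)
Definition lPsi j : seq (R * nat) := [seq ((-1) ^+ i * 'C(j, i.+1)%:R, i) | i <- iota 0 j].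
Definition lD j := lPsi j ++ lopp (lscale (lPsi j)).

Lemma Ker_cat m n l1 l2 tau (q : R) : Ker m n (l1 ++ l2) tau q = Ker m n l1 tau q + Ker m n l2 tau q.
Proof. by rewrite /Ker big_cat. Qed.

Lemma Ker_opp m n l tau (q : R) : Ker m n (lopp l) tau q = - Ker m n l tau q.
Proof. by rewrite /Ker big_map -sumrN; apply: eq_bigr => p _; rewrite mulNr. Qed.

Lemma Ker_scale m n l tau (q : R) : Ker m n (lscale l) tau q = Ker m n l (2 * tau) q.
Proof.
rewrite /Ker big_map; apply: eq_bigr => p _; congr (_ * psi _ _ _ _).
by rewrite -doubleS -mul2n natrM /=; ring.
Qed.

Lemma Ker_one m n i tau (q : R) : Ker m n (lone i) tau q = psi m n (i.+1%:R * tau) q.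
Proof. by rewrite /Ker big_seq1 mul1r. Qed.

Lemma wpol_cat l1 l2 y : wpol (l1 ++ l2) y = wpol l1 y + wpol l2 y.
Proof. by rewrite /wpol big_cat. Qed.

Lemma wpol_opp l y : wpol (lopp l) y = - wpol l y.
Proof. by rewrite /wpol big_map -sumrN; apply: eq_bigr => p _; rewrite mulNr. Qed.

Lemma wpol_scale l y : wpol (lscale l) y = y * wpol l (y ^+ 2).
Proof.
rewrite /wpol big_map mulr_sumr; apply: eq_bigr => p _.
by rewrite -exprM mulrCA -exprS mul2n.
Qed.

Lemma wpol_one i y : wpol (lone i) y = y ^+ i.
Proof. by rewrite /wpol big_seq1 mul1r. Qed.

Lemma wpol_Psi j y : y * wpol (lPsi j) y = 1 - (1 - y) ^+ j.
Proof.
rewrite exprDn big_ord_recl /= subn0 expr1n mul1r expr0 bin0 mulr1n opprD addrA subrr sub0r.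
have ji : iota 0 j = index_iota 0 j by rewrite /index_iota subn0.
rewrite /wpol big_map ji big_mkord mulr_sumr -sumrN.
apply: eq_bigr => i _; rewrite /= expr1n mul1r /bump /= add1n exprS.
by rewrite -mulr_natr [(- y) ^+ i]exprNn; ring.
Qed.

(** Doubling [tau] squares [y]. The result is nonnegative on [0, 1] and, near [y = 0], of first
    order, but as a function of [1 - y] it vanishes to order [j] at [y = 1]; this order is the decay
    exponent in [Ker_mm_D_le]. *)
Lemma wpol_D j y : y * wpol (lD j) y = (1 - y ^+ 2) ^+ j - (1 - y) ^+ j.
Proof.
rewrite wpol_cat wpol_opp wpol_scale mulrDr wpol_Psi mulrN mulrA -expr2 wpol_Psi.
by ring.
Qed.

Lemma wpol_ge0 l y : 0 < y -> 0 <= y * wpol l y -> 0 <= wpol l y.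
Proof. by move=> y0; rewrite pmulr_rge0. Qed.

Lemma wpol_D_ge0 j y : 0 < y -> y <= 1 -> 0 <= wpol (lD j) y.
Proof.
move=> y0 y1; apply: wpol_ge0 => //; rewrite wpol_D subr_ge0 lerXn2r ?nnegrE ?subr_ge0//.
  by rewrite expr_le1// ltW.
by rewrite lerD2l lerN2 expr2 ler_piMl// ltW.
Qed.

(* [y - y^(i+1)] and [1 - (1 - y)^j - y] are nonnegative on [0, 1]. *)
Lemma wpol_one_ge0 i y : 0 < y -> y <= 1 -> 0 <= wpol (lone 0 ++ lopp (lone i)) y.
Proof.
move=> y0 y1; rewrite wpol_cat wpol_opp !wpol_one expr0 subr_ge0.
by rewrite exprn_ile1// ltW.
Qed.

Lemma wpol_Psi_ge0 j y : 0 < y -> y <= 1 -> 0 <= wpol (lPsi j.+1 ++ lopp (lone 0)) y.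
Proof.
move=> y0 y1; apply: wpol_ge0 => //.
rewrite wpol_cat wpol_opp mulrDr wpol_Psi wpol_one expr0 mulrN mulr1.
have : (1 - y) ^+ j.+1 <= 1 - y.
  rewrite exprS ler_piMr ?subr_ge0// exprn_ile1// ?subr_ge0//.
  by rewrite lerBlDr lerDl ltW.
lra.
Qed.

Lemma KerD m n j tau (q : R) :
  Ker m n (lD j) tau q = Ker m n (lPsi j) tau q - Ker m n (lPsi j) (2 * tau) q.
Proof. by rewrite Ker_cat Ker_opp Ker_scale. Qed.

End lists.

Section averaged.
Context {R : realType}.
Variable m : nat.

Lemma psi_mm tau (r : R) : 0 < tau -> 0 < r ->
  psi m m tau r = Num.sqrt r ^- m * Num.sqrt (1 + tau / r) ^- m.
Proof.
move=> t0 r0; rewrite /psi -!invfM -!exprMn; congr (_ ^- _).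
rewrite -!sqrtrM ?ltW//; congr Num.sqrt; field.
by rewrite !gt_eqF.
Qed.

Context d (T : measurableType d) (Q : probability T R) (X : T -> 'rV[R]_m) (C : R).
Hypothesis mX : coord_meas X.
Hypothesis fX : forall a (b : 'rV[R]_m) l, 0 <= l ->
     \int[Q]_w (cos (a + dot b (X w)) * expR (- (l * sqn (X w) / 2))) =
     cos a * expR (- (sqn b / (2 * (1 + l)))) * (Num.sqrt (1 + l)) ^- m.
Hypothesis C0 : 0 <= C.
Hypothesis eX : forall M, 1 <= M -> \int[Q]_w exp_trunc (sqn (X w)) M <= C.

Let yX h w := expR (- (h * sqn (X w) / 2)).

Let byX h : 0 <= h -> bmf (yX h).
Proof.
move=> h0; apply: bmf_expN; last by move=> w; rewrite divr_ge0// mulr_ge0// sqn_ge0.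
by apply: measurable_funM => //; apply: measurable_funM => //; exact: measurable_sqn.
Qed.

Let yX01 h w : 0 <= h -> 0 < yX h w <= 1.
Proof.
by move=> h0; rewrite expR_gt0/= -expR0 ler_expR oppr_le0 divr_ge0// mulr_ge0// sqn_ge0.
Qed.

(** The averaged kernel is a Laplace mean of the symbol, with parameter [tau / r]: small scale or
    large distance means [y] near 1. *)
Lemma Ker_mm l tau (r : R) : 0 < tau -> 0 < r ->
  Ker m m l tau r = Num.sqrt r ^- m * \int[Q]_w (yX (tau / r) w * wpol l (yX (tau / r) w)).
Proof.
move=> t0 r0; have h0 : 0 <= tau / r by rewrite divr_ge0// ltW.
rewrite /wpol; under eq_Rintegral do rewrite mulr_sumr.
rewrite bint_sum; last first.
  by move=> p; apply: bmfM; [exact: byX|apply: bmfM; [exact: bmf_cst|exact/bmfX/byX]].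
rewrite mulr_sumr /Ker; apply: eq_bigr => p _.
under eq_Rintegral do rewrite mulrCA -exprS.
rewrite bintZl; last exact/bmfX/byX.
rewrite psi_mm ?mulr_gt0// mulrCA; congr (_ * (_ * _)).
rewrite -(gaussian_laplace fX); last by rewrite divr_ge0// ?mulr_ge0// ltW.
by apply: eq_Rintegral => w _; rewrite /yX -expRM_natl; congr expR; ring.
Qed.

(** With [u = a x / 2 = 2 a (x / 4)], combine [1 - expR (- u) <= u] with the j-th term of the series
    of [expR (x / 4)]. The truncation level is such that the truncated branch is at least 1, a
    trivial bound for the left side. *)
Lemma pow_exp_trunc (x : R) j a : 0 <= x -> 0 < a ->
  (1 - expR (- (a * x / 2))) ^+ j <= (2 * a) ^+ j * j`!%:R * exp_trunc x (Num.max 1 ((2 * a) ^+ j * j`!%:R)^-1).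
Proof.
move=> x0 a0; set A := (2 * a) ^+ j * j`!%:R.
have A0 : 0 < A by rewrite mulr_gt0 ?exprn_gt0 ?mulr_gt0// ltr0n fact_gt0.
have u0 : 0 <= a * x / 2 by rewrite divr_ge0// mulr_ge0// ltW.
have e01 : 0 <= 1 - expR (- (a * x / 2)) <= 1.
  by rewrite subr_ge0 expR_le1 oppr_le0 u0/= lerBlDr lerDl expR_ge0.
have [e0 e1] := andP e01.
rewrite /exp_trunc minr_pMr ?(ltW A0)// le_min; apply/andP; split; last first.
  rewrite (@le_trans _ _ 1)// ?exprn_ile1//.
  by rewrite -(mulfV (lt0r_neq0 A0)) ler_pM2l// le_max lexx orbT.
have h1 : 1 - expR (- (a * x / 2)) <= a * x / 2.
  by have := @expR_ge1Dx R (- (a * x / 2)); lra.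
apply: (@le_trans _ _ ((a * x / 2) ^+ j)); first by rewrite lerXn2r ?nnegrE.
have -> : a * x / 2 = 2 * a * (x / 4) by field.
rewrite exprMn /A -mulrA ler_pM2l ?exprn_gt0 ?mulr_gt0//.
have x40 : 0 <= x / 4 by rewrite divr_ge0.
have j0 : 0 < j`!%:R :> R by rewrite ltr0n fact_gt0.
case: j {A A0 e01 e0 e1 h1} j0 => [|j] j0.
  by rewrite expr0 fact0 mul1r; apply: le_trans (expR_ge1Dx _); rewrite lerDl.
rewrite [leRHS]mulrC -ler_pdivrMr//.
by rewrite (le_trans _ (expR_ge1Dxn j x40))// lerDr.
Qed.

Lemma Ker_mm_D_le j : exists2 C', 0 <= C' & forall tau r : R, 0 < tau -> 0 < r ->
  Ker m m (lD j) tau r <= C' * (Num.sqrt r ^- m * (tau / r) ^+ j).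
Proof.
(* The first [2 ^+ j] comes from [1 - y ^+ 2 <= 2 (1 - y)], the next two factors from
   [pow_exp_trunc], and [C] is the exponential moment of [X]. *)
exists (2 ^+ j * (2 ^+ j * j`!%:R * C)).
  by rewrite !mulr_ge0 ?exprn_ge0.
move=> tau r t0 r0; have h0 : 0 < tau / r by rewrite divr_gt0.
rewrite Ker_mm// mulrCA ler_wpM2l ?invr_ge0 ?exprn_ge0//.
set h := tau / r in h0 *.
set M := Num.max 1 ((2 * h) ^+ j * j`!%:R)^-1.
have M1 : 1 <= M by rewrite le_max lexx.
have bE : bmf (fun w => exp_trunc (sqn (X w)) M).
  by apply: bmf_exp_trunc (le_trans ler01 M1) (measurable_sqn mX).
apply: (@le_trans _ _ (\int[Q]_w (2 ^+ j * ((2 * h) ^+ j * j`!%:R) * exp_trunc (sqn (X w)) M))).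
  apply: bint_le.
  - apply: bmfM; first exact/byX/ltW.
    by apply: bmf_sum => p; apply: bmfM; [exact: bmf_cst|exact/bmfX/byX/ltW].
  - by apply: bmfM => //; exact: bmf_cst.
  - move=> w; have /andP[y0 y1] := yX01 w (ltW h0).
    rewrite wpol_D -mulrA.
    apply: (@le_trans _ _ (2 ^+ j * (1 - yX h w) ^+ j)); last first.
      by rewrite ler_pM2l ?exprn_gt0// pow_exp_trunc// sqn_ge0.
    apply: (@le_trans _ _ ((1 - yX h w ^+ 2) ^+ j)).
      by rewrite lerBlDr lerDl exprn_ge0// subr_ge0.
    rewrite -exprMn lerXn2r ?nnegrE ?mulr_ge0 ?subr_ge0//.
      by rewrite expr_le1// ltW.
    have -> : 1 - yX h w ^+ 2 = (1 + yX h w) * (1 - yX h w) by ring.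
    by rewrite ler_wpM2r ?subr_ge0//; lra.
rewrite bintZl// exprMn; have := eX M1.
have A0 : 0 <= 2 ^+ j * (2 ^+ j * h ^+ j * j`!%:R).
  by rewrite !mulr_ge0 ?exprn_ge0// ltW.
move=> eM; apply: (le_trans (ler_wpM2l A0 eM)).
by rewrite le_eqVlt; apply/orP; left; apply/eqP; ring.
Qed.

End averaged.

Section geometric.
Context {R : realType}.

(* [H] is a bounded primitive: [min(v, 1/v) <= H v - H (rho v)]. *)
Lemma sum_min_geometric (rho : R) : 0 < rho < 1 -> exists2 C, 0 <= C &
  forall K u, 0 < u -> \sum_(0 <= k < K) Num.min (u * rho ^+ k) (u * rho ^+ k)^-1 <= C.
Proof.
move=> /andP[p0 p1]; have q0 : 0 < 1 - rho by rewrite subr_gt0.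
(* [c] makes [c / (rho v) - c / v] equal to [1 / v], and [C0] makes the drop of [H] across [v = 1]
   at least 1. *)
pose c := rho / (1 - rho); pose C0 := 1 + c + (1 - rho)^-1.
have c0 : 0 < c by rewrite divr_gt0.
have i0 : 0 < (1 - rho)^-1 by rewrite invr_gt0.
pose H v := if v <= 1 then v / (1 - rho) else C0 - c / v.
have C00 : 0 <= C0 by rewrite /C0; lra.
have H0 v : 0 < v -> 0 <= H v.
  move=> v0; rewrite /H; case: ifPn => [v1|]; first by rewrite divr_ge0// ltW.
  rewrite -ltNge => v1; have : c / v <= c by rewrite ler_pdivrMr// ler_peMr// ltW.
  by rewrite /C0; lra.
have HC v : 0 < v -> H v <= C0.
  move=> v0; rewrite /H; case: ifPn => [v1|_].
    have : v / (1 - rho) <= (1 - rho)^-1 by rewrite ler_piMl// ltW.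
    by rewrite /C0; lra.
  by rewrite gerBl divr_ge0// ltW.
have HH v : 0 < v -> Num.min v v^-1 <= H v - H (v * rho).
  move=> v0; have vr : v * rho <= v by rewrite ler_piMr// ltW.
  rewrite /H; case: ifPn => [v1|].
    rewrite (le_trans vr v1) ge_min; apply/orP; left.
    by rewrite -mulrBl -{2}[v]mulr1 -mulrBr mulfK ?gt_eqF.
  rewrite -ltNge => v1; rewrite ge_min; apply/orP; right.
  have iv : v^-1 <= 1 by rewrite invf_le1// ltW.
  case: ifPn => [vr1|].
    have : v * rho / (1 - rho) <= (1 - rho)^-1 by rewrite ler_piMl// ltW.
    have : c / v <= c by rewrite ler_pdivrMr// ler_peMr// ltW.
    by rewrite /C0; lra.
  move=> _; have -> : C0 - c / v - (C0 - c / (v * rho)) = v^-1; last by [].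
  rewrite /c; field; rewrite !gt_eqF//; lra.
exists C0 => // K u u0.
have : \sum_(0 <= k < K) Num.min (u * rho ^+ k) (u * rho ^+ k)^-1 <= H u - H (u * rho ^+ K).
  elim: K => [|K IH]; first by rewrite big_geq// expr0 mulr1 subrr.
  rewrite big_nat_recr//=.
  have := HH (u * rho ^+ K); rewrite mulr_gt0 ?exprn_gt0// => /(_ isT).
  rewrite -mulrA -exprSr => h; apply: le_trans (lerD IH h) _.
  by rewrite addrA subrK.
move/le_trans; apply; rewrite lerBlDr (le_trans (HC _ u0))// lerDl H0//.
by rewrite mulr_gt0// exprn_gt0.
Qed.

Definition tk k : R := 2^-1 ^+ k.

Lemma tk_gt0 k : 0 < tk k. Proof. by rewrite exprn_gt0// invr_gt0. Qed.

Lemma tk2 k : 2 * tk k.+1 = tk k.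
Proof. by rewrite /tk exprS mulrA mulfV ?mul1r. Qed.

Definition theta m (s tau : R) := tau `^ ((m%:R - s) / 2).

Lemma sqrtXn_powR m (x : R) : 0 <= x -> Num.sqrt x ^- m = x `^ (- (m%:R / 2)).
Proof.
move=> x0; rewrite -powR12_sqrt// -powR_invn ?powR_ge0// -powRrM.
by congr (_ `^ _); rewrite mulrN mulrC.
Qed.

(** With [x = tau / r], the size bound [Ker_le] and the decay bound [Ker_mm_D_le] give a term of at
    most a constant times r^(-s/2) x^(-s/2) min(1, x^L), where L = m/2 + j. The hypotheses say 0 <
    s/2 < L, so it decays geometrically on both sides of [x = 1]. *)
Lemma averaged_sum m j (s : R) : 0 < s -> s < m%:R + 2 * j%:R ->
  exists2 C, 0 <= C & forall K (r : R), 0 < r ->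
  \sum_(0 <= k < K) theta m s (tk k.+1) * Ker m m (lD j) (tk k.+1) r <= C * Num.sqrt r `^ (- s).
Proof.
move=> s0 sL.
have [d [T [Q [X [mX fX [C C0 eX]]]]]] := @gaussian_vector R m.
have [C1 C10 K1] := Ker_mm_D_le mX fX C0 eX j.
pose C2 := \sum_(p <- @lD R j) `|p.1|.
have K2 tau r : 0 < tau -> 0 < r -> Ker m m (lD j) tau r <= C2 * Num.sqrt tau ^- m.
  by move=> t0 /ltW r0; exact: Ker_le.
have C20 : 0 <= C2 by apply: sumr_ge0.
pose C3 := Num.max C1 C2; have C30 : 0 <= C3 by rewrite le_max C10.
(* [del] is the smaller of the decay exponents for [x > 1] and [x <= 1], so one call of
   [sum_min_geometric] covers both ranges. *)
pose L : R := m%:R / 2 + j%:R; pose del := Num.min (s / 2) (L - s / 2).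
have del0 : 0 < del by rewrite lt_min divr_gt0//= /L; lra.
pose rho : R := 2^-1 `^ del.
have rho01 : 0 < rho < 1.
  rewrite powR_gt0 ?invr_gt0//=.
  have : 2^-1 `^ del < 1 `^ del :> R by apply: gt0_ltr_powR; rewrite ?nnegrE ?invr_ge0//; lra.
  by rewrite powR1.
have [C4 C40 S4] := sum_min_geometric rho01.
exists (C3 * C4); first exact: mulr_ge0.
move=> K r r0.
have term k : theta m s (tk k.+1) * Ker m m (lD j) (tk k.+1) r <=
   C3 * Num.sqrt r `^ (- s) * Num.min ((tk 1 / r) `^ del * rho ^+ k) ((tk 1 / r) `^ del * rho ^+ k)^-1.
  set tau := tk k.+1; have t0 : 0 < tau := tk_gt0 _.
  pose x := tau / r; have x0 : 0 < x by rewrite divr_gt0.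
  have xE : (tk 1 / r) `^ del * rho ^+ k = x `^ del.
    rewrite /rho -powR_mulrn ?powR_ge0// -powRrM mulrC -[_ * _]mulrC.
    rewrite (mulrC del) powRrM powR_mulrn ?invr_ge0// -powRM ?divr_ge0 ?exprn_ge0 ?ltW ?tk_gt0//.
    by congr (_ `^ _); rewrite /x /tau /tk expr1 exprS; ring.
  have xn : x != 0 by rewrite gt_eqF.
  have tn : tau != 0 by rewrite gt_eqF.
  have rn : r != 0 by rewrite gt_eqF.
  have rE : Num.sqrt r `^ (- s) = r `^ (- (s / 2)).
    by rewrite -powR12_sqrt ?(ltW t0) ?(ltW r0) ?(ltW x0)// -powRrM; congr (_ `^ _); rewrite mulrN mulrC.
  have KE : Ker m m (lD j) tau r <= C3 * (tau `^ (- (m%:R / 2)) * Num.min 1 (x `^ L)).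
    rewrite minr_pMr ?powR_ge0// minr_pMr// le_min mulr1; apply/andP; split.
      rewrite (le_trans (K2 _ _ t0 r0))// sqrtXn_powR ?(ltW t0) ?(ltW r0) ?(ltW x0)// ler_wpM2r ?powR_ge0//.
      by rewrite le_max lexx orbT.
    rewrite (le_trans (K1 _ _ t0 r0))//.
    have -> : tau `^ (- (m%:R / 2)) * x `^ L = Num.sqrt r ^- m * x ^+ j.
      rewrite /L powRD ?xn ?tn ?rn ?implybT// powR_mulrn ?(ltW t0) ?(ltW r0) ?(ltW x0)// mulrA; congr (_ * _).
      rewrite sqrtXn_powR ?(ltW t0) ?(ltW r0) ?(ltW x0)//.
      rewrite {1}(_ : tau = x * r); last by rewrite /x divfK ?gt_eqF.
      rewrite powRM ?(ltW t0) ?(ltW r0) ?(ltW x0)// mulrAC -powRD ?xn ?tn ?rn ?implybT// addNr powRr0 mul1r//.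
    by rewrite ler_wpM2r ?mulr_ge0 ?invr_ge0 ?exprn_ge0 ?(ltW t0) ?(ltW r0) ?(ltW x0)// le_max lexx.
  apply: (@le_trans _ _ (theta m s tau * (C3 * (tau `^ (- (m%:R / 2)) * Num.min 1 (x `^ L))))).
    by rewrite ler_wpM2l// powR_ge0.
  have -> : theta m s tau * (C3 * (tau `^ (- (m%:R / 2)) * Num.min 1 (x `^ L))) =
     C3 * r `^ (- (s / 2)) * (x `^ (- (s / 2)) * Num.min 1 (x `^ L)).
    have rxE : r `^ (- (s / 2)) * (x `^ (- (s / 2)) * Num.min 1 (x `^ L)) = tau `^ (- (s / 2)) * Num.min 1 (x `^ L) :> R.
      by rewrite mulrA -powRM ?(ltW t0) ?(ltW r0) ?(ltW x0)// [r * x]mulrC /x divfK.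
    rewrite -[RHS]mulrA rxE.
    have -> : tau `^ (- (s / 2)) = theta m s tau * tau `^ (- (m%:R / 2)) :> R.
      rewrite /theta -powRD ?xn ?tn ?rn ?implybT//; congr (_ `^ _).
      by rewrite mulrBl; ring.
    by ring.
  rewrite rE xE ler_wpM2l ?mulr_ge0 ?powR_ge0//.
  rewrite minr_pMr ?powR_ge0// mulr1 -powRD ?xn ?tn ?rn ?implybT//.
  have d1 : del <= s / 2 by rewrite ge_min lexx.
  have d2 : del <= L - s / 2 by rewrite ge_min lexx orbT.
  rewrite -powRN; case: (leP x 1) => x1.
    have x01 : 0 < x <= 1 by rewrite x0.
    rewrite le_min !ge_min; apply/andP; split; apply/orP; right; apply: ger_powR => //; lra.
  rewrite le_min !ge_min; apply/andP; split; apply/orP; left; apply: ler_powR; rewrite ?(ltW x1)//; lra.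
apply: le_trans (ler_sum _ (fun k _ => term k)) _.
rewrite -mulr_sumr mulrAC ler_wpM2r ?powR_ge0// ler_wpM2l//.
by apply: S4; rewrite powR_gt0// divr_gt0// tk_gt0.
Qed.

End geometric.

(** * Supports and measurability *)

Section countable.
Context d (T : measurableType d) (J : countType) (F : J -> set T).

Lemma countable_bigcup_measurable : (forall i, measurable (F i)) -> measurable (\bigcup_i F i).
Proof.
move=> mF; rewrite (_ : \bigcup_i F i = \bigcup_n (if unpickle n is Some i then F i else set0)).
  by apply: bigcupT_measurable => n; case: (unpickle n).
apply/seteqP; split => x [i _ Fx]; first by exists (pickle i) => //; rewrite pickleK.
by case: (unpickle i) Fx => // i' Fx; exists i'.
Qed.

Lemma countable_bigcap_measurable : (forall i, measurable (F i)) -> measurable (\bigcap_i F i).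
Proof.
move=> mF; rewrite (_ : \bigcap_i F i = \bigcap_n (if unpickle n is Some i then F i else setT)).
  by apply: bigcapT_measurable => n; case: (unpickle n).
apply/seteqP; split => x Fx i _; last by have := Fx (pickle i) I; rewrite pickleK; exact.
by case: (unpickle i) => // i'; exact: Fx.
Qed.

Lemma countable_negligible (R : realType) (mu : {measure set T -> \bar R}) :
  (forall i, mu.-negligible (F i)) -> mu.-negligible (\bigcup_i F i).
Proof.
move=> mF; rewrite (_ : \bigcup_i F i = \bigcup_n (if unpickle n is Some i then F i else set0)).
  by apply: negligible_bigcup => n; case: (unpickle n) => // ; exact: negligible_set0.
apply/seteqP; split => x [i _ Fx]; first by exists (pickle i) => //; rewrite pickleK.
by case: (unpickle i) Fx => // i' Fx; exists i'.
Qed.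

End countable.

Section metric.
Context {R : realType} (n : nat).
Implicit Types x y z : 'rV[R]_n.

Lemma sqnD_le x y : sqn (x + y) <= 2 * sqn x + 2 * sqn y.
Proof.
rewrite !mulr_sumr -big_split /=; apply: ler_sum => i _; rewrite mxE.
by have := sqr_ge0 (x ord0 i - y ord0 i); nra.
Qed.

Lemma sqn_tri x y z : sqn (x - z) <= 2 * sqn (x - y) + 2 * sqn (y - z).
Proof. by have := sqnD_le (x - y) (y - z); rewrite addrA subrK. Qed.

Definition vrat (a : 'rV[rat]_n) : 'rV[R]_n := \row_i ratr (a ord0 i).

Lemma vrat_dense x (e : R) : 0 < e -> exists a, sqn (vrat a - x) < e.
Proof.
move=> e0; pose del := Num.sqrt (e / n.+1%:R).
have d0 : 0 < del by rewrite sqrtr_gt0 divr_gt0.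
have q i : exists q : rat, `|ratr q - x ord0 i| < del.
  have /rat_in_itvoo[q] : x ord0 i - del < x ord0 i + del by lra.
  rewrite in_itv/= => /andP[h1 h2]; exists q.
  by rewrite ltr_norml; apply/andP; split; lra.
have [f Hf] := choice q.
exists (\row_i f i); apply: (@le_lt_trans _ _ (\sum_(i < n) (e / n.+1%:R))).
  apply: ler_sum => i _; rewrite !mxE.
  have -> : e / n.+1%:R = del ^+ 2 by rewrite sqr_sqrtr// divr_ge0// ltW.
  by rewrite -[leLHS]real_normK ?num_real// lerXn2r ?nnegrE ?(ltW (Hf i)) ?(ltW d0).
rewrite sumr_const card_ord -[_ *+ n]mulr_natr mulrAC ltr_pdivrMr// ltr_pM2l//.
by rewrite ltr_nat.
Qed.

Lemma sqn_ball_open x (e : R) : open [set y | sqn (y - x) < e].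
Proof.
have -> : [set y | sqn (y - x) < e] = (fun y => sqn (y - x)) @^-1` [set t | t < e] by [].
apply: open_comp; last exact: open_lt.
move=> y _; apply: (@continuous_comp _ _ _ (fun y => y - x) (@sqn R n)); last exact: continuous_sqn.
by apply: (continuous_mxB (f := id) (g := fun=> x)) => ?; [exact: cvg_id|exact: cst_continuous].
Qed.

Lemma open_sqn_ball (U : set 'rV[R]_n) x : open U -> U x ->
  exists2 e, 0 < e & [set y | sqn (y - x) < e] `<=` U.
Proof.
move=> oU Ux; have /nbhs_ballP[e /= e0 eU] : nbhs x U by exact: open_nbhs_nbhs.
exists (e ^+ 2); first by rewrite exprn_gt0.
move=> y /= ye; apply: eU; split => // i j; rewrite ord1.
rewrite /ball/= -ltr_sqr ?nnegrE ?(ltW e0)// real_normK ?num_real//.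
apply: le_lt_trans ye; rewrite /sqn (bigD1 j)//= !mxE -sqrrN opprB lerDl.
by apply: sumr_ge0 => ? _; exact: sqr_ge0.
Qed.

End metric.

Section support.
Context {R : realType} (n : nat).

(** A point outside the support lies in a null ball with rational centre and radius 1/(k+1) in
    [sqn], and there are countably many of these. *)
Lemma spt_negligible (mu : {measure set (Borel 'rV[R]_n) -> \bar R}) :
  mu.-negligible (~` (spt mu) : set (Borel 'rV[R]_n)).
Proof.
pose W (p : 'rV[rat]_n * nat) : set 'rV[R]_n := [set y | sqn (y - vrat p.1) < p.2.+1%:R^-1].
pose F p : set (Borel 'rV[R]_n) := if mu (W p) == 0%E then W p else set0.
apply: (@negligibleS _ _ _ _ (\bigcup_p F p)); last first.
  apply: countable_negligible => p; rewrite /F; case: ifPn => [/eqP W0|_]; last exact: negligible_set0.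
  by exists (W p); split => //; apply: open_Borel; exact: sqn_ball_open.
move=> x /= /existsNP[U] /not_implyP[oU /not_implyP[Ux mU]].
have [e e0 eU] := open_sqn_ball oU Ux.
(* For squared distances the triangle inequality [sqn_tri] costs a factor 2, and two steps of size
   [e / 4] stay below [e]. *)
have [k] : exists k : nat, k.+1%:R^-1 < e / 4.
  have /ltr_add_invr[k] : 0 < e / 4 by rewrite divr_gt0.
  by rewrite add0r => ?; exists k.
move=> ke; have [a ax] := @vrat_dense R n x k.+1%:R^-1 ltac:(by rewrite invr_gt0).
exists (a, k) => //; rewrite /F; case: ifPn => [_|/eqP]; first by rewrite /W /= sqnB.
case; apply/eqP; rewrite eq_le measure_ge0 andbT.
have WU : W (a, k) `<=` U.
  apply: subset_trans eU => y /= ya.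
  apply: le_lt_trans (sqn_tri y (vrat a) x) _.
  by have := lt_trans (ya : sqn (y - vrat a) < _) ke; have := lt_trans ax ke; lra.
have h : (mu (W (a, k)) <= mu U)%E.
  apply: le_measure => //; rewrite inE; apply: open_Borel => //.
  exact: sqn_ball_open.
by rewrite (le_trans h)// leNgt; apply/negP.
Qed.

End support.

(** * Measurability of the exceptional sets of planes *)

Section hitting.
Context {R : realType} (n : nat).
Implicit Types (A B : set 'rV[R]_n) (P : 'M[R]_n).

(** The squared projected differences form a compact set of reals that omits 0. *)
Lemma disjoint_proj_gap A B P : compact A -> compact B ->
  ~ (projset P A `&` projset P B !=set0) ->
  exists2 e, 0 < e & forall x y, A x -> B y -> e <= sqn ((x - y) *m P).
Proof.
move=> cA cB AB.
pose h (p : 'rV[R]_n * 'rV[R]_n) := sqn ((p.1 - p.2) *m P).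
have ch : continuous h.
  move=> p; apply: (@continuous_comp _ _ _ (fun p : 'rV[R]_n * 'rV[R]_n => (p.1 - p.2) *m P) (@sqn R n)); last exact: continuous_sqn.
  apply: continuous_mulmx; last by move=> ?; exact: cst_continuous.
  by apply: (continuous_mxB (f := fst) (g := snd)) => ?; [exact: cvg_fst|exact: cvg_snd].
have cAB : compact (h @` (A `*` B)).
  apply: continuous_compact; last exact: compact_setX.
  exact: continuous_subspaceT.
have cl := compact_closed (@Rhausdorff R) cAB.
have n0 : ~ (h @` (A `*` B)) 0.
  move=> [[x y] [/= Ax By]] /eqP; rewrite /h/= sqn_eq0 mulmxBl subr_eq0 => /eqP xy.
  by apply: AB; exists (x *m P); split; [exists x|exists y].
have /nbhs_ballP[e /= e0 he] : nbhs (0 : R) (~` (h @` (A `*` B))).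
  by apply: open_nbhs_nbhs; split => //; exact: closed_openC.
exists e => // x y Ax By; rewrite leNgt; apply/negP => lt_e.
apply: (he (sqn ((x - y) *m P))); last by exists (x, y).
by rewrite /ball/= sub0r normrN ger0_norm ?sqn_ge0.
Qed.

Definition hit A B : set (Borel 'M[R]_n) := [set P : 'M[R]_n | projset P A `&` projset P B !=set0].

(** By the gap of [disjoint_proj_gap], projections that come arbitrarily close do meet, which
    presents the set as a countable intersection of open sets. *)
Lemma measurable_hit A B : compact A -> compact B -> measurable (hit A B).
Proof.
move=> cA cB.
pose U (k : nat) : set 'M[R]_n := \bigcup_(p in A `*` B) [set P | sqn ((p.1 - p.2) *m P) < k.+1%:R^-1].
have -> : hit A B = \bigcap_k (U k : set (Borel 'M[R]_n)).
  apply/seteqP; split => P.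
    move=> [z [[x Ax xz] [y By yz]]] k _; exists (x, y) => //=.
    by rewrite mulmxBl xz yz subrr sqn0 invr_gt0.
  move=> UP; apply: contrapT => /(disjoint_proj_gap cA cB)[e e0 he].
  have [k] : exists k : nat, k.+1%:R^-1 < e.
    by have /ltr_add_invr[k] := e0; rewrite add0r => ?; exists k.
  have [[x y] [/= Ax By] xy] := UP k I.
  by rewrite ltNge (le_trans (he _ _ Ax By) (ltW xy)).
apply: bigcapT_measurable => k; apply: open_Borel; apply: bigcup_open => -[x y] _ /=.
rewrite (_ : [set P | _] = (fun P => sqn ((x - y) *m P)) @^-1` [set t | t < k.+1%:R^-1])//.
apply: open_comp; last exact: open_lt.
move=> P _; apply: (@continuous_comp _ _ _ (fun P : 'M[R]_n => (x - y) *m P) (@sqn R n)); last exact: continuous_sqn.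
by apply: continuous_mulmx => ?; [exact: cst_continuous|exact: cvg_id].
Qed.

Lemma hit1 A P y : projset P A (y *m P) -> hit [set y] A P.
Proof. by move=> h; exists (y *m P); split => //; exists y. Qed.

Lemma hit1P A P y : hit [set y] A P -> projset P A (y *m P).
Proof. by move=> [z [[_ -> <-]]]. Qed.

(** The interior is nonempty exactly when, for some rational centre and radius 1/(k+1), every
    rational point whose projection is that close to the centre's projects into both sets. This is a
    countable condition on [P]. *)
Lemma measurable_relint m A B : compact A -> compact B ->
  measurable ([set P : 'M[R]_n | grass m P /\
     relint (subsp P) (projset P A `&` projset P B) !=set0] : set (Borel 'M[R]_n)).
Proof.
move=> cA cB.
pose G (p : nat * 'rV[rat]_n) (y : 'rV[rat]_n) : set (Borel 'M[R]_n) :=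
  [set P : 'M[R]_n | p.1.+1%:R^-1 <= sqn ((vrat y - vrat p.2) *m P)] `|`
  (hit [set vrat y] A `&` hit [set vrat y] B).
have -> : ([set P : 'M[R]_n | grass m P /\
     relint (subsp P) (projset P A `&` projset P B) !=set0] : set (Borel 'M[R]_n)) =
     (grass m : set (Borel 'M[R]_n)) `&` \bigcup_p \bigcap_y G p y.
  apply/seteqP; split => P.
    move=> [gP [x [Vx [ABx [e e0 he]]]]]; split => //.
    have [_ [PP _]] := gP.
    have e20 : 0 < (e ^+ 2) / 4 by rewrite divr_gt0// exprn_gt0.
    have [k] : exists k : nat, k.+1%:R^-1 < e ^+ 2 / 4.
      by have /ltr_add_invr[k] := e20; rewrite add0r => ?; exists k.
    move=> ke; have [a ax] := vrat_dense x e20.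
    exists (k, a) => // y _; case: (leP (k.+1%:R^-1) (sqn ((vrat y - vrat a) *m P))) => [|ya]; [by left|right].
    have : (projset P A `&` projset P B) (vrat y *m P).
      apply: he; first by rewrite /subsp /= -mulmxA PP.
      rewrite enorm_sqn -(ger0_norm (ltW e0)) -sqrtr_sqr ltr_sqrt ?exprn_gt0//.
      apply: le_lt_trans (sqn_tri _ (vrat a *m P) _) _.
      rewrite -mulmxBl (_ : vrat a *m P - x = (vrat a - x) *m P); last by rewrite mulmxBl Vx.
      by have := sqn_proj_le (vrat a - x) gP; have := lt_trans ya ke; lra.
    by move=> [? ?]; split; exact: hit1.
  move=> [gP [[k a] _ h]]; split => //; have [_ [PP _]] := gP.
  (* Rational points suffice: a point of the plane missing the projection of [C] would keep a gap
     [d] from it, but a rational point near [y] projects into it. *)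
  have key C y : compact C -> subsp P y -> sqn (y - vrat a *m P) < k.+1%:R^-1 ->
      (forall y', ~ (k.+1%:R^-1 <= sqn ((vrat y' - vrat a) *m P)) -> hit [set vrat y'] C P) -> projset P C y.
    move=> cC Vy ya hC; apply: contrapT => yC.
    have := @disjoint_proj_gap [set y] C P (@compact_set1 _ _) cC.
    case; first by move=> [z [[_ -> <-]]]; rewrite Vy.
    move=> d d0 hd.
    have co : continuous (fun y' : 'rV[R]_n => sqn ((y' - vrat a) *m P)).
      move=> u; apply: (@continuous_comp _ _ _ (fun y' : 'rV[R]_n => (y' - vrat a) *m P) (@sqn R n)); last exact: continuous_sqn.
      apply: continuous_mulmx; last by move=> ?; exact: cst_continuous.
      by apply: (continuous_mxB (f := id) (g := fun=> vrat a)) => ?; [exact: cvg_id|exact: cst_continuous].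
    have oU : open ((fun y' : 'rV[R]_n => sqn ((y' - vrat a) *m P)) @^-1` [set t | t < k.+1%:R^-1]).
      by apply: open_comp; [move=> ? _; exact: co|exact: open_lt].
    have [r r0 hr] := open_sqn_ball (x := y) oU ltac:(by rewrite /= mulmxBl Vy).
    have [y' yy'] := vrat_dense y (e := Num.min r (d / 2)) ltac:(by rewrite lt_min r0 divr_gt0).
    have y'a : sqn ((vrat y' - vrat a) *m P) < k.+1%:R^-1.
      by apply: hr; rewrite /= (lt_le_trans yy')// ge_min lexx.
    have /hC/hit1P[x Cx xy'] : ~ (k.+1%:R^-1 <= sqn ((vrat y' - vrat a) *m P)) by apply/negP; rewrite -ltNge.
    have := hd y x erefl Cx; rewrite mulmxBl xy' -mulmxBl => dd.
    have := sqn_proj_le (y - vrat y') gP; rewrite sqnB in yy' => h2.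
    have : sqn (y - vrat y') < d / 2 by rewrite (lt_le_trans yy')// ge_min lexx orbT.
    lra.
  have AB y : subsp P y -> sqn (y - vrat a *m P) < k.+1%:R^-1 -> (projset P A `&` projset P B) y.
    by move=> Vy ya; split; apply: key => // y' ny; have [//|[]] := h y' I.
  exists (vrat a *m P); split; first by rewrite /subsp/= -mulmxA PP.
  split; first by apply: AB; rewrite ?subrr ?sqn0 ?invr_gt0// /subsp/= -mulmxA PP.
  exists (Num.sqrt k.+1%:R^-1); first by rewrite sqrtr_gt0 invr_gt0.
  move=> y Vy; rewrite enorm_sqn ltr_sqrt ?invr_gt0// => ya; exact: AB.
apply: measurableI; first by apply: closed_Borel; exact: closed_grass.
apply: countable_bigcup_measurable => -[k a]; apply: countable_bigcap_measurable => y.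
apply: measurableU; last by apply: measurableI; apply: measurable_hit => //; exact: compact_set1.
apply: closed_Borel.
rewrite (_ : [set P | _] = (fun P : 'M[R]_n => sqn ((vrat y - vrat a) *m P)) @^-1` [set t | k.+1%:R^-1 <= t])//.
apply: closed_comp; last exact: closed_ge.
move=> P _; apply: (@continuous_comp _ _ _ (fun P : 'M[R]_n => (vrat y - vrat a) *m P) (@sqn R n)); last exact: continuous_sqn.
by apply: continuous_mulmx => ?; [exact: cst_continuous|exact: cvg_id].
Qed.

End hitting.

(** * Energies and domination *)

Section finite_measure.
Context {R : realType} d (T : measurableType d) (mu : {finite_measure set T -> \bar R}).

Lemma bint_gt0 (f : T -> R) : (0 < mu setT)%E -> bmf f -> (forall x, 0 < f x) ->
  0 < \int[mu]_x f x.
Proof.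
move=> mu0 bf f0; rewrite lt_neqAle bint_ge0 ?andbT; last by move=> x; exact/ltW.
apply/eqP => E0.
have : (\int[mu]_x `|(f x)%:E|)%E = 0%E.
  under eq_integral do rewrite gee0_abs ?lee_fin ?(ltW (f0 _))//.
  by rewrite -EFin_bint// -E0.
move/(ae_eq_integral_abs mu measurableT _).1 => /(_ _)[|A [mA A0 sA]].
  by apply/measurable_EFinP; exact: bf.1.
move: mu0; rewrite lt_neqAle => /andP[/eqP + _]; apply; rewrite -A0; congr (mu _).
apply/seteqP; split => // x _; apply: sA => /= /(_ I) [] fx0.
by have := f0 x; rewrite fx0 ltxx.
Qed.

End finite_measure.

Section dominated.
Context {R : realType} d (T : measurableType d) (P : probability T R).

Lemma ae_summable (u : nat -> T -> R) C : (forall k, bmf (u k)) ->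
  (forall k x, 0 <= u k x) -> (forall K, \sum_(0 <= k < K) \int[P]_x u k x <= C) ->
  P.-integrable setT (fun x => \sum_(k <oo) (u k x)%:E)%E.
Proof.
move=> bu u0 uC.
have mu_ k : measurable_fun setT (fun x => (u k x)%:E) by apply/measurable_EFinP; exact: (bu k).1.
apply/integrableP; split.
  by apply: ge0_emeasurable_sum => // k x _ _; rewrite lee_fin.
have S0 x : (0 <= \sum_(k <oo) (u k x)%:E)%E by apply: nneseries_ge0 => k _ _; rewrite lee_fin.
under eq_integral do rewrite gee0_abs//.
rewrite integral_nneseries//; last by move=> k x _; rewrite lee_fin.
apply: (@le_lt_trans _ _ C%:E); last exact: ltry.
apply: lime_le; first by apply: is_cvg_nneseries => k _ _; apply: integral_ge0 => x _; rewrite lee_fin.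
apply: nearW => K; apply: (@le_trans _ _ (\sum_(0 <= k < K) \int[P]_x u k x)%:E); last by rewrite lee_fin.
by rewrite -sumEFin; apply: lee_sum => k _; rewrite EFin_bint.
Qed.

Lemma no_vanishing (phi u : nat -> T -> R) (M C c : R) : (forall k, bmf (phi k)) ->
  (forall k, bmf (u k)) -> (forall k x, 0 <= u k x) ->
  (forall K, \sum_(0 <= k < K) \int[P]_x u k x <= C) ->
  {ae P, forall x, forall K, `|phi K x| <= M + \sum_(0 <= k < K) u k x} ->
  0 < c -> (forall K, c <= \int[P]_x phi K x) ->
  ~ {ae P, forall x, phi ^~ x @ \oo --> (0 : R)}.
Proof.
move=> bphi bu u0 uC phiu c0 cphi phi0.
have iS := ae_summable bu u0 uC.
have iG : P.-integrable setT (fun x => (`|M|%:E + \sum_(k <oo) (u k x)%:E)%E).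
  by apply: integrableD => //; exact: (bmf_integrable P (bmf_cst _ _)).
have [] := @dominated_convergence _ _ _ P setT measurableT (fun k x => (phi k x)%:E) (cst 0%E) _ _ _ _ iG.
- by move=> k; apply/measurable_EFinP; exact: (bphi k).1.
- exact: measurable_cst.
- by apply: filterS phi0 => x h _; apply: cvg_EFin; [exact: nearW|exact: h].
- apply: filterS phiu => x h K _; apply: (@le_trans _ _ (`|M| + \sum_(0 <= k < K) u k x)%:E).
    by rewrite lee_fin (le_trans (h K))// lerD2r ler_norm.
  rewrite EFinD leeD2l// -sumEFin.
  by apply: nneseries_lim_ge => k _ _; rewrite lee_fin.
move=> _ _; rewrite integral0 => /fine_cvgP [_] /= h.
have [K /= hK] := filter_ex (cvgr_lt _ h _ c0).
by have := cphi K; rewrite leNgt hK.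
Qed.

End dominated.

Section energy.
Context {R : realType} (n : nat).
Notation V := (Borel 'rV[R]_n).
Variable mu : {finite_measure set V -> \bar R}.

Lemma coord_meas_diff : coord_meas (fun p : V * V => (p.1 : 'rV[R]_n) - p.2).
Proof.
apply: coord_measB.
  exact: (coord_meas_comp (h := fst) _ (@coord_meas_Borel R 1 n)).
exact: (coord_meas_comp (h := snd) _ (@coord_meas_Borel R 1 n)).
Qed.

Lemma rieszkE s (x y : 'rV[R]_n) : rieszk s x y =
  if sqn (x - y) == 0 then +oo%E else (Num.sqrt (sqn (x - y)) `^ (- s))%:E.
Proof. by rewrite /rieszk enorm_sqn sqn_eq0 subr_eq0. Qed.

Lemma rieszk_ge0 s (x y : 'rV[R]_n) : (0 <= rieszk s x y)%E.
Proof. by rewrite /rieszk; case: ifP => // _; rewrite lee_fin powR_ge0. Qed.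

Lemma measurable_rieszk s : measurable_fun setT (fun p : V * V => rieszk s (p.1 : 'rV[R]_n) p.2).
Proof.
have ms := measurable_sqn coord_meas_diff.
under eq_fun do rewrite rieszkE.
apply: measurable_fun_ifT => //.
  exact: measurable_fun_eqr.
apply/measurable_EFinP; apply: (measurableT_comp (measurable_powR _)).
by apply: measurableT_comp => //; apply: continuous_measurable_fun; exact: sqrt_continuous.
Qed.

Lemma le_energy s (h : V * V -> R) C : bmf h -> (forall p, 0 <= h p) -> 0 <= C ->
  (forall x y : 'rV[R]_n, ((h (x, y))%:E <= C%:E * rieszk s x y)%E) ->
  ((\int[mu]_x \int[mu]_y h (x, y))%:E <= C%:E * energy mu s)%E.
Proof.
move=> bh h0 C0 hC.
have mr := measurable_rieszk s.
have mrx (x : V) : measurable_fun setT (fun y : V => rieszk s (x : 'rV[R]_n) y).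
  exact: (measurableT_comp mr (pair1_measurable x)).
have mR : measurable_fun setT (fun x : V => \int[mu]_y rieszk s (x : 'rV[R]_n) y)%E.
  exact: (@measurable_fun_fubini_tonelli_F _ _ _ _ _ mu _ mr (fun p => rieszk_ge0 s p.1 p.2)).
have r0 x : (0 <= \int[mu]_y rieszk s x y)%E by apply: integral_ge0 => y _; exact: rieszk_ge0.
rewrite EFin_bint; last exact: (bmf_bint1 mu mu bh).
rewrite /energy -ge0_integralZl//.
apply: ge0_le_integral => //.
- by move=> x _; rewrite lee_fin bint_ge0.
- by apply/measurable_EFinP; exact: (bmf_bint1 mu mu bh).1.
- by apply: measurable_funeM.
move=> x _; rewrite EFin_bint; last exact: bmf_pair1.
have ry y : [set: V] y -> (0 <= rieszk s x y)%E by move=> _; exact: rieszk_ge0.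
have C0E : (0 <= C%:E)%E by rewrite lee_fin.
rewrite -(ge0_integralZl mu measurableT (mrx x) ry C0E).
apply: ge0_le_integral => //.
- by move=> y _; rewrite lee_fin.
- by apply/measurable_EFinP; exact: (bmf_pair1 x bh).1.
exact: (measurable_funeM _ (mrx x)).
Qed.

Lemma energy_mono s s' : 0 < s' -> s' <= s -> (energy mu s < +oo)%E -> (energy mu s' < +oo)%E.
Proof.
move=> s0 ss es.
have mrx u (x : V) : measurable_fun setT (fun y : V => rieszk u (x : 'rV[R]_n) y).
  exact: (measurableT_comp (measurable_rieszk u) (pair1_measurable x)).
have mR u : measurable_fun setT (fun x : V => \int[mu]_y rieszk u (x : 'rV[R]_n) y)%E.
  exact: (@measurable_fun_fubini_tonelli_F _ _ _ _ _ mu _ (measurable_rieszk u) (fun p => rieszk_ge0 u p.1 p.2)).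
have r0 u x : (0 <= \int[mu]_y rieszk u x y)%E by apply: integral_ge0 => y _; exact: rieszk_ge0.
have le1 x y : (rieszk s' x y <= 1 + rieszk s x y)%E.
  rewrite /rieszk; case: ifP => // _; rewrite -EFinD lee_fin.
  have e0 : 0 <= enorm (x - y) by exact: sqrtr_ge0.
  case: (leP 1 (enorm (x - y))) => [e1|e1].
    apply: (@le_trans _ _ 1); last by rewrite lerDl powR_ge0.
    by rewrite -(powRr0 (enorm (x - y))) ler_powR// oppr_le0 ltW.
  (* At 0 a power with nonzero exponent is 0 by convention, and the bound is trivial. *)
  move: e0; rewrite le_eqVlt => /orP[/eqP <-|e0].
    by rewrite !powR0 ?oppr_eq0 ?gt_eqF// (lt_le_trans s0).
  by rewrite ler_wpDl// ger_powR ?e0 ?(ltW e1)// lerN2.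
have E1 : (\int[mu]_x (mu setT + \int[mu]_y rieszk s x y) < +oo)%E.
  rewrite ge0_integralD//.
  rewrite integral_cst// lte_add_pinfty//.
  by rewrite -ge0_fin_numE ?mule_ge0// fin_numM// fin_num_measure.
apply: le_lt_trans E1; apply: ge0_le_integral => //.
- exact: emeasurable_funD.
move=> x _; rewrite -[X in (X + _)%E](mul1e (mu setT)) -integral_cst//.
rewrite -ge0_integralD//; last by move=> y _; exact: rieszk_ge0.
apply: ge0_le_integral => //.
- by move=> y _; exact: rieszk_ge0.
- exact: emeasurable_funD.
Qed.

End energy.

Lemma ae_imply d (T : measurableType d) (R : realType) (mu : {measure set T -> \bar R}) (A B : T -> Prop) :
  (forall x, A x -> B x) -> {ae mu, forall x, A x} -> {ae mu, forall x, B x}.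
Proof. by move=> AB; exact: filterS. Qed.

Lemma ae_imply2 d (T : measurableType d) (R : realType) (mu : {measure set T -> \bar R}) (A B C : T -> Prop) :
  (forall x, A x -> B x -> C x) -> {ae mu, forall x, A x} -> {ae mu, forall x, B x} -> {ae mu, forall x, C x}.
Proof. by move=> ABC; exact: filterS2. Qed.

Section radial_kernel.
Context {R : realType} (m : nat).

Lemma Ker_mm_ge0 l tau (r : R) : 0 < tau -> 0 <= r ->
  (forall y, 0 < y -> y <= 1 -> 0 <= wpol l y) -> 0 <= Ker m m l tau r.
Proof.
move=> t0 r0 wl.
have [d [T [Q [X [mX fX _]]]]] := @gaussian_vector R m.
have y01 h w : 0 <= h -> 0 < expR (- (h * sqn (X w) / 2)) <= 1.
  by move=> h0; rewrite expR_gt0/= expR_le1 oppr_le0 divr_ge0// mulr_ge0// sqn_ge0.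
move: r0; rewrite le_eqVlt => /orP[/eqP <-|r0]; last first.
  have h0 : 0 <= tau / r by rewrite divr_ge0// ltW.
  rewrite (Ker_mm mX fX)// mulr_ge0 ?invr_ge0 ?exprn_ge0// bint_ge0// => w.
  have /andP[y0 y1] := y01 _ w h0.
  by rewrite mulr_ge0 ?wl// ltW.
(* At [r = 0] the parameter [tau / r] is meaningless; the factor (i+1)^(-m/2) that remains in each
   term is itself a Laplace transform, at [i]. *)
suff -> : Ker m m l tau 0 = Num.sqrt tau ^- m * \int[Q]_w wpol l (expR (- (1 * sqn (X w) / 2))).
  rewrite mulr_ge0 ?invr_ge0 ?exprn_ge0// bint_ge0// => w.
  by have /andP[y0 y1] := y01 1 w ler01; exact: wl.
have be : bmf (fun w => expR (- (1 * sqn (X w) / 2))).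
  apply: bmf_expN; last by move=> w; rewrite divr_ge0// mulr_ge0// sqn_ge0.
  by apply: measurable_funM => //; apply: measurable_funM => //; exact: measurable_sqn.
rewrite /wpol bint_sum; last by move=> p; apply: bmfM; [exact: bmf_cst|exact: bmfX].
rewrite mulr_sumr /Ker; apply: eq_bigr => p _.
rewrite bintZl; last exact: bmfX.
rewrite [RHS]mulrCA; congr (p.1 * _).
rewrite /psi mul0r addr0 sqrtr1 expr1n invr1 mulr1 sqrtrM// exprMn invfM mulrC; congr (_ * _).
rewrite -natr1 addrC -(gaussian_laplace fX)//.
by apply: eq_Rintegral => w _; rewrite -expRM_natl; congr expR; ring.
Qed.

Lemma psi_mmE tau (r : R) : 0 < tau -> 0 <= r -> psi m m tau r = Num.sqrt (tau + r) ^- m.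
Proof.
move=> t0 r0; rewrite /psi -invfM -exprMn -sqrtrM ?ltW//; congr (Num.sqrt _ ^- _).
by field; rewrite gt_eqF.
Qed.

(** The comparison [1 - (1 - y) ^+ j.+1 >= y] of symbols gives a pointwise one after averaging. The
    bound does not involve [tau], which keeps the means away from 0 at all scales. *)
Lemma Ker_mm_Psi_ge j tau (r : R) : 0 < tau -> tau <= 1 -> 0 <= r ->
  psi m m 1 r <= Ker m m (lPsi j.+1) tau r.
Proof.
move=> t0 t1 r0; apply: (@le_trans _ _ (psi m m tau r)).
  rewrite !psi_mmE// lef_pV2 ?posrE ?exprn_gt0 ?sqrtr_gt0 ?ltr_pwDl//.
  by rewrite lerXn2r ?nnegrE// ler_wsqrtr// lerD2r.
rewrite -subr_ge0; have -> : Ker m m (lPsi j.+1) tau r - psi m m tau r =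
    Ker m m (lPsi j.+1 ++ lopp (lone 0)) tau r.
  by rewrite Ker_cat Ker_opp Ker_one mul1r.
by apply: Ker_mm_ge0 => // y; exact: wpol_Psi_ge0.
Qed.

End radial_kernel.

Section double_integral.
Context {R : realType} (n : nat).
Notation V := (Borel 'rV[R]_n).
Notation fmeas := {finite_measure set V -> \bar R}.
Implicit Types (mu nu : fmeas) (kap : 'rV[R]_n -> R).

Definition E2 kap mu nu : R := \int[mu]_x \int[nu]_y kap ((x : 'rV[R]_n) - y).

Definition bker kap := bmf (fun p : V * V => kap ((p.1 : 'rV[R]_n) - p.2)).

Lemma E2_sum I (l : seq I) (c : I -> R) (kap : I -> 'rV[R]_n -> R) mu nu :
  (forall i, bker (kap i)) ->
  E2 (fun z => \sum_(i <- l) c i * kap i z) mu nu = \sum_(i <- l) c i * E2 (kap i) mu nu.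
Proof.
move=> bk; rewrite /E2.
have bi i : bmf (fun p : V * V => c i * kap i ((p.1 : 'rV[R]_n) - p.2)).
  by apply: bmfM; [exact: bmf_cst|exact: bk].
transitivity (\int[mu]_x \sum_(i <- l) \int[nu]_y (c i * kap i ((x : 'rV[R]_n) - y))).
  by apply: eq_Rintegral => x _; rewrite bint_sum// => i; exact: (bmf_pair1 x (bi i)).
rewrite bint_sum; last by move=> i; exact: (bmf_bint1 mu nu (bi i)).
apply: eq_bigr => i _; rewrite -bintZl; last exact: (bmf_bint1 mu nu (bk i)).
by apply: eq_Rintegral => x _; rewrite bintZl//; exact: (bmf_pair1 x (bk i)).
Qed.

Lemma E2_le kap kap' mu nu : bker kap -> bker kap' -> (forall z, kap z <= kap' z) ->
  E2 kap mu nu <= E2 kap' mu nu.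
Proof.
move=> bk bk' kk; apply: bint_le; [exact: (bmf_bint1 mu nu bk)|exact: (bmf_bint1 mu nu bk')|].
by move=> x; apply: bint_le => //; [exact: (bmf_pair1 x bk)|exact: (bmf_pair1 x bk')].
Qed.

Lemma E2B kap kap' mu nu : bker kap -> bker kap' ->
  E2 (fun z => kap z - kap' z) mu nu = E2 kap mu nu - E2 kap' mu nu.
Proof.
move=> bk bk'; rewrite /E2 -bintB; [|exact: (bmf_bint1 mu nu bk)|exact: (bmf_bint1 mu nu bk')].
by apply: eq_Rintegral => x _; rewrite bintB//; [exact: (bmf_pair1 x bk)|exact: (bmf_pair1 x bk')].
Qed.

Lemma E2_gt0 kap mu nu : bker kap -> (forall z, 0 < kap z) ->
  (0 < mu setT)%E -> (0 < nu setT)%E -> 0 < E2 kap mu nu.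
Proof.
move=> bk k0 mu0 nu0; apply: bint_gt0 => //; first exact: (bmf_bint1 mu nu bk).
by move=> x; apply: bint_gt0 => //; exact: (bmf_pair1 x bk).
Qed.

Lemma En_cst kap mu nu a b : bker kap ->
  En kap mu (fun=> a) nu (fun=> b) = a * b * E2 kap mu nu.
Proof.
move=> bk; rewrite /En /E2 -bintZl; last exact: (bmf_bint1 mu nu bk).
by apply: eq_Rintegral => x _; rewrite bintZl//; exact: (bmf_pair1 x bk).
Qed.

End double_integral.

Section projected.
Context {R : realType} (m n : nat).
Notation V := (Borel 'rV[R]_n).
Notation fmeas := {finite_measure set V -> \bar R}.
Implicit Types (mu nu : fmeas) (P : 'M[R]_n).

Lemma bmf_KP_joint l tau : 0 < tau ->
  bmf (fun q : (V * Borel 'M[R]_n) * V => KP m (q.1.2 : 'M[R]_n) l tau ((q.1.1 : 'rV[R]_n) - q.2)).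
Proof.
move=> t0; apply: bmf_Ker => //; first by move=> q; exact: sqn_ge0.
apply: measurable_sqn; apply: coord_meas_mul.
  apply: coord_measB; last exact: (coord_meas_comp (h := snd) _ (@coord_meas_Borel R 1 n)).
  apply: (coord_meas_comp (h := fun q => q.1.1) _ (@coord_meas_Borel R 1 n)).
  exact: (measurableT_comp measurable_fst measurable_fst).
apply: (coord_meas_comp (h := fun q => q.1.2) _ (@coord_meas_Borel R n n)).
exact: (measurableT_comp measurable_snd measurable_fst).
Qed.

Lemma bker_KP P l tau : 0 < tau -> bker (KP m P l tau).
Proof.
move=> t0; apply: bmf_Ker => //; first by move=> q; exact: sqn_ge0.
apply: measurable_sqn; apply: coord_meas_mul; last exact: coord_meas_cst.
exact: coord_meas_diff.
Qed.

Lemma bker_Ker k l tau : 0 < tau -> bker (fun z : 'rV[R]_n => Ker m k l tau (sqn z)).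
Proof.
move=> t0; apply: bmf_Ker => //; first by move=> q; exact: sqn_ge0.
apply: measurable_sqn; exact: coord_meas_diff.
Qed.

Lemma bmf_E2_KP l tau mu nu : 0 < tau ->
  bmf (fun P : Borel 'M[R]_n => E2 (KP m (P : 'M[R]_n) l tau) mu nu).
Proof.
(* The Dirac masses supply the finite measures that [bmf_bint1] and [bmf_bint2] ask for on the
   parameter spaces. *)
move=> t0; have b1 := bmf_bint1 (dirac ((0, 0) : V * Borel 'M[R]_n)) nu (bmf_KP_joint l t0).
exact: (bmf_bint2 mu (dirac (0 : Borel 'M[R]_n)) b1).
Qed.

Lemma gint_Ker (gam : probability (Borel 'M[R]_n) R) l tau z : grass_invariant_prob m gam ->
  0 < tau -> \int[gam]_P KP m (P : 'M[R]_n) l tau z = Ker m m l tau (sqn z).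
Proof.
move=> gamP t0.
have [d1 [T1 [Q1 [Y [mY fY _]]]]] := @gaussian_vector R n.
have [d2 [T2 [Q2 [X [mX fX _]]]]] := @gaussian_vector R m.
have bp (p : R * nat) : bmf (fun P : Borel 'M[R]_n => psi m n (p.2.+1%:R * tau) (sqn (z *m (P : 'M[R]_n)))).
  apply: bmf_psi; [by rewrite mulr_gt0|by move=> P; exact: sqn_ge0|exact: measurable_sqn_proj].
rewrite /KP /Ker bint_sum; last by move=> p; apply: bmfM; [exact: bmf_cst|exact: bp].
apply: eq_bigr => p _; rewrite bintZl//; congr (_ * _).
by apply: (gint_psi mY fY mX fX) => //; rewrite mulr_gt0.
Qed.

Lemma gint_E2 (gam : probability (Borel 'M[R]_n) R) l tau mu nu : grass_invariant_prob m gam ->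
  0 < tau -> \int[gam]_P E2 (KP m (P : 'M[R]_n) l tau) mu nu =
             E2 (fun z => Ker m m l tau (sqn z)) mu nu.
Proof.
move=> gamP t0; have bj := bmf_KP_joint l t0.
have b1 := bmf_bint1 (dirac ((0, 0) : V * Borel 'M[R]_n)) nu bj.
rewrite /E2 -(bint_fubini mu gam b1); apply: eq_Rintegral => x _ /=.
have b2 : bmf (fun q : Borel 'M[R]_n * V => KP m (q.1 : 'M[R]_n) l tau ((x : 'rV[R]_n) - q.2)).
  apply: (bmf_comp (h := fun q : Borel 'M[R]_n * V => ((x, q.1), q.2)) _ bj).
  apply/measurable_fun_pairP; split; last exact: measurable_snd.
  exact: (measurableT_comp (pair1_measurable x) measurable_fst).
rewrite (bint_fubini gam nu b2); congr Rintegral; apply/funext => y.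
by rewrite -(gint_Ker l ((x : 'rV[R]_n) - y) gamP t0).
Qed.

Lemma E2_pd P l tau mu nu a b : grass m P -> 0 < tau ->
  (forall y, 0 < y -> y <= 1 -> 0 <= wpol l y) ->
  0 <= a ^+ 2 * E2 (KP m P l tau) mu mu + 2 * (a * b) * E2 (KP m P l tau) mu nu
       + b ^+ 2 * E2 (KP m P l tau) nu nu.
Proof.
move=> gP t0 wl; have bk := @bker_KP P l tau t0.
have := Ker_pd mu nu gP t0 wl (bmf_cst _ a) (bmf_cst _ b).
by rewrite !En_cst// !expr2 !mulrA.
Qed.

Lemma E2_ge0 P l tau mu : grass m P -> 0 < tau ->
  (forall y, 0 < y -> y <= 1 -> 0 <= wpol l y) -> 0 <= E2 (KP m P l tau) mu mu.
Proof.
move=> gP t0 wl; have := E2_pd mu mu 1 0 gP t0 wl.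
by rewrite !expr2 !(mulr0, mul0r, mul1r, addr0).
Qed.

(* Positive definiteness for the combinations [sqrt th mu +/- nu / sqrt th]. *)
Lemma E2_cauchy_schwarz P l tau mu nu th : grass m P -> 0 < tau ->
  (forall y, 0 < y -> y <= 1 -> 0 <= wpol l y) -> 0 < th ->
  `|E2 (KP m P l tau) mu nu| <=
  (th * E2 (KP m P l tau) mu mu + th^-1 * E2 (KP m P l tau) nu nu) / 2.
Proof.
move=> gP t0 wl th0; set a := Num.sqrt th.
have a0 : 0 < a by rewrite sqrtr_gt0.
have -> : th = a ^+ 2 by rewrite sqr_sqrtr// ltW.
have h1 := E2_pd mu nu a a^-1 gP t0 wl; have h2 := E2_pd mu nu a (- a^-1) gP t0 wl.
move: h1 h2; rewrite mulrN mulfV ?gt_eqF// sqrrN exprVn ler_norml.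
by move=> h1 h2; apply/andP; split; lra.
Qed.

Definition Phi j k P mu nu := E2 (KP m P (lPsi j) (tk k)) mu nu.
(** [lD] compares a scale with its double, so it must be taken at [tk k.+1] to give the increment
    from [Phi] at [k] to [Phi] at [k.+1]. *)
Definition Dif j k P mu nu := E2 (KP m P (lD j) (tk k.+1)) mu nu.

Lemma PhiS j k P mu nu : Phi j k.+1 P mu nu = Phi j k P mu nu + Dif j k P mu nu.
Proof.
have kE : KP m P (lD j) (tk k.+1) = fun z => KP m P (lPsi j) (tk k.+1) z - KP m P (lPsi j) (tk k) z.
  by apply/funext => z; rewrite /KP KerD tk2.
rewrite /Dif kE E2B; [|exact/bker_KP/tk_gt0..].
by rewrite addrC subrK.
Qed.

Lemma Phi_sum j K P mu nu : Phi j K P mu nu = Phi j 0 P mu nu + \sum_(0 <= k < K) Dif j k P mu nu.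
Proof.
elim: K => [|K IH]; first by rewrite big_geq// addr0.
by rewrite PhiS IH big_nat_recr//= addrA.
Qed.

Lemma Dif_ge0 j k P mu : grass m P -> 0 <= Dif j k P mu mu.
Proof. by move=> gP; apply: E2_ge0 => //; [exact: tk_gt0|move=> y; exact: wpol_D_ge0]. Qed.

Lemma theta_gt0 (s tau : R) : 0 < tau -> 0 < theta m s tau.
Proof. by move=> t0; rewrite powR_gt0. Qed.

Lemma theta_inv (s t tau : R) : 0 < tau -> s + t = 2 * m%:R -> (theta m s tau)^-1 = theta m t tau.
Proof.
move=> t0 st; rewrite /theta -powRN; congr (_ `^ _); lra.
Qed.

(** The absolute value makes the summands nonnegative for all matrices [P], as [ae_summable] wants;
    on the Grassmannian it changes nothing, by [Dif_ge0]. *)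
Lemma Dif_sum_le (gam : probability (Borel 'M[R]_n) R) mu s j : grass_invariant_prob m gam ->
  0 < s -> s < m%:R + 2 * j%:R -> (energy mu s < +oo)%E ->
  exists C, forall K, \sum_(0 <= k < K)
    \int[gam]_P (theta m s (tk k.+1) * `|Dif j k (P : 'M[R]_n) mu mu|) <= C.
Proof.
move=> gamP s0 sj es; have [C C0 HC] := averaged_sum s0 sj.
(* On the diagonal the Riesz kernel is infinite, and only a positive factor keeps the product
   infinite; [C] itself may be 0. *)
have C10 : 0 < C + 1 by rewrite ltr_wpDl.
exists (fine ((C + 1)%:E * energy mu s)%E) => K.
have e0 : (0 <= energy mu s)%E.
  by apply: integral_ge0 => x _; apply: integral_ge0 => y _; exact: rieszk_ge0.
have t0 k : 0 < tk k :> R := tk_gt0 _.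
have -> : \sum_(0 <= k < K) \int[gam]_P (theta m s (tk k.+1) * `|Dif j k (P : 'M[R]_n) mu mu|) =
    \sum_(0 <= k < K) theta m s (tk k.+1) * E2 (fun z => Ker m m (lD j) (tk k.+1) (sqn z)) mu mu.
  apply: eq_bigr => k _; have bD := bmf_E2_KP (lD j) mu mu (t0 k.+1).
  rewrite bintZl; last exact: bmf_norm.
  rewrite -(gint_E2 _ _ _ gamP)//; congr (_ * _); apply: (gint_eq gamP) => //.
    exact: bmf_norm.
  by move=> P gP; rewrite ger0_norm//; exact: Dif_ge0.
rewrite -E2_sum; last by move=> k; exact: bker_Ker.
have bh : bmf (fun p : V * V => \sum_(0 <= k < K) theta m s (tk k.+1) * Ker m m (lD j) (tk k.+1) (sqn ((p.1 : 'rV[R]_n) - p.2))).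
  by apply: bmf_sum => k; apply: bmfM; [exact: bmf_cst|exact: bker_Ker].
rewrite -lee_fin [X in (_ <= X)%E]fineK; last by apply: fin_numM => //; rewrite ge0_fin_numE.
have h0 : forall p : V * V, 0 <= \sum_(0 <= k < K) theta m s (tk k.+1) * Ker m m (lD j) (tk k.+1) (sqn ((p.1 : 'rV[R]_n) - p.2)).
  move=> p; apply: sumr_ge0 => k _; rewrite mulr_ge0 ?(ltW (theta_gt0 _ _))//.
  by apply: Ker_mm_ge0 => //; [exact: sqn_ge0|move=> y; exact: wpol_D_ge0].
apply: (le_energy mu bh h0 (ltW C10)).
move=> x y; rewrite rieszkE; case: eqP => [z0|/eqP z0].
  by rewrite gt0_muley ?lte_fin// leey.
rewrite -EFinM lee_fin; apply: le_trans (HC K _ _) _.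
  by rewrite lt_neqAle eq_sym z0 sqn_ge0.
by rewrite ler_wpM2r ?powR_ge0// lerDl.
Qed.

Lemma grass_measure_gt0 (gam : probability (Borel 'M[R]_n) R) mu nu s t j (F : set (Borel 'M[R]_n)) :
  grass_invariant_prob m gam -> 0 < s -> 0 < t -> s + t = 2 * m%:R ->
  s < m%:R + 2 * j.+1%:R -> t < m%:R + 2 * j.+1%:R ->
  (energy mu s < +oo)%E -> (energy nu t < +oo)%E ->
  (0 < mu setT)%E -> (0 < nu setT)%E -> measurable F ->
  {ae gam, forall P : Borel 'M[R]_n, ~ F P ->
     (fun k => Phi j.+1 k (P : 'M[R]_n) mu nu) @ \oo --> (0 : R)} ->
  (0 < gam F)%E.
Proof.
move=> gamP s0 t0 st sj tj es et mu0 nu0 mF Fcvg.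
rewrite lt_neqAle measure_ge0 andbT eq_sym; apply/eqP => F0.
have aeF : {ae gam, forall P, ~ F P} by exists F; split => // P /=; exact: contrapT.
have [A HA] := Dif_sum_le gamP s0 sj es; have [B HB] := Dif_sum_le gamP t0 tj et.
have tk0 k : 0 < tk k :> R := tk_gt0 _.
have bPhi k : bmf (fun P : Borel 'M[R]_n => Phi j.+1 k (P : 'M[R]_n) mu nu) by exact: bmf_E2_KP.
have bD k mu' nu' : bmf (fun P : Borel 'M[R]_n => Dif j.+1 k (P : 'M[R]_n) mu' nu') by exact: bmf_E2_KP.
(* [M] bounds the first term of the telescoping sum for all matrices at once. *)
have [_ [M HM]] := bPhi 0%N.
pose U r k (lam : fmeas) (P : Borel 'M[R]_n) := theta m r (tk k.+1) * `|Dif j.+1 k (P : 'M[R]_n) lam lam|.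
have bU r k lam : bmf (U r k lam) := bmfM (bmf_cst _ (theta m r (tk k.+1))) (bmf_norm (bD k lam lam)).
have U0 r k lam P : 0 <= U r k lam P by rewrite mulr_ge0// ltW// theta_gt0.
pose u k (P : Borel 'M[R]_n) := (U s k mu P + U t k nu P) / 2.
have bker1 l tau : 0 < tau -> bker (fun z : 'rV[R]_n => Ker m m l tau (sqn z)) := @bker_Ker m l tau.
have bpsi1 : bker (fun z : 'rV[R]_n => psi m m 1 (sqn z)).
  have -> : (fun z : 'rV[R]_n => psi m m 1 (sqn z)) = fun z => Ker m m (lone 0) 1 (sqn z).
    by apply/funext => z; rewrite Ker_one mul1r.
  exact: bker1.
pose c := E2 (fun z : 'rV[R]_n => psi m m 1 (sqn z)) mu nu.
apply: (@no_vanishing _ _ _ gam (fun k P => Phi j.+1 k (P : 'M[R]_n) mu nu) u M ((A + B) / 2) c) => //.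
- by move=> k; apply: bmfM; [exact: bmfD|exact: bmf_cst].
- by move=> k P; rewrite divr_ge0// addr_ge0.
- move=> K; have -> : \sum_(0 <= k < K) \int[gam]_x u k x =
     (\sum_(0 <= k < K) \int[gam]_P U s k mu P + \sum_(0 <= k < K) \int[gam]_P U t k nu P) / 2.
    rewrite -big_split/= mulr_suml; apply: eq_bigr => k _.
    by rewrite bintZr; [rewrite bintD|exact: bmfD].
  by rewrite ler_pM2r ?invr_gt0// lerD.
- apply: ae_imply (ae_grass gamP) => P gP K; rewrite Phi_sum.
  apply: le_trans (ler_normD _ _) _; apply: lerD (HM P) _.
  apply: le_trans (ler_norm_sum _ _ _) _; apply: ler_sum => k _.
  rewrite /u /U -(theta_inv (tk0 k.+1) st) !(ger0_norm (Dif_ge0 _ _ _ gP)).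
  apply: E2_cauchy_schwarz => //; [by move=> y; exact: wpol_D_ge0|exact: theta_gt0].
- by apply: E2_gt0 => // z; apply: psi_gt0 => //; exact: sqn_ge0.
- move=> K; rewrite (gint_E2 _ _ _ gamP)//; apply: E2_le => //; first exact: bker1.
  move=> z; apply: Ker_mm_Psi_ge => //; last exact: sqn_ge0.
  by rewrite /tk exprn_ile1// invf_le1// ler1n.
by apply: ae_imply2 aeF Fcvg => P nF; exact.
Qed.

End projected.

(** * Disjoint projections *)

Section ae.
Context {R : realType} d (T : measurableType d) (mu : {finite_measure set T -> \bar R}).

Lemma bint_ae_le (f g : T -> R) : bmf f -> bmf g -> {ae mu, forall x, f x <= g x} ->
  \int[mu]_x f x <= \int[mu]_x g x.
Proof.
(* [h] is the positive part of [f - g]: its integral is 0, and [f <= g + h] holds at every point. *)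
move=> bf bg fg; pose h x := (`|f x - g x| + (f x - g x)) / 2.
have bh : bmf h.
  by apply: bmfM; [apply: bmfD; [apply: bmf_norm|]; exact: bmfB|exact: bmf_cst].
have h0 : \int[mu]_x h x = 0.
  transitivity (\int[mu]_x (0 : R)); last by rewrite bint_cst mul0r.
  congr fine.
  apply: ae_eq_integral => //; first by apply/measurable_EFinP; exact: bh.1.
  apply: ae_imply fg => x /= fgx _; rewrite /h ler0_norm ?subr_le0// addNr mul0r//.
apply: (@le_trans _ _ (\int[mu]_x (g x + h x))); last by rewrite bintD// h0 addr0.
apply: bint_le => //; first exact: bmfD.
by move=> x; have := ler_norm (f x - g x); rewrite /h; lra.
Qed.

Lemma bint_ae_norm_le (f : T -> R) M : bmf f -> {ae mu, forall x, `|f x| <= M} ->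
  `|\int[mu]_x f x| <= M * fine (mu setT).
Proof.
move=> bf fM; rewrite (le_trans (bint_norm _ bf))// -bint_cst.
by apply: bint_ae_le => //; [exact: bmf_norm|exact: bmf_cst].
Qed.

End ae.

Section vanish.
Context {R : realType}.

Lemma cvg0_le (u v : nat -> R) : (forall k, `|u k| <= v k) -> v @ \oo --> (0 : R) ->
  u @ \oo --> (0 : R).
Proof.
move=> uv v0; apply: (@squeeze_cvgr _ _ _ _ (fun k => - v k) v) => //.
  by apply: nearW => k; rewrite -ler_norml.
by rewrite -oppr0; exact: cvgN.
Qed.

Lemma tk_cvg : (@tk R) @ \oo --> (0 : R).
Proof. by apply: cvg_expr; rewrite ger0_norm ?invr_ge0// invf_lt1// ltr1n. Qed.

(** At scale [tau] the kernel equals tau^((n-m)/2) (tau + e)^(-n/2); this is where [m < n]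
    enters. *)
Lemma psi_vanish m n (c e : R) : (m < n)%N -> 0 < c -> 0 < e ->
  (fun k => psi m n (c * tk k) e) @ \oo --> (0 : R).
Proof.
move=> mn c0 e0; apply: (@cvg0_le _ (fun k => Num.sqrt (c * tk k) ^+ (n - m) * Num.sqrt e ^- n)).
  move=> k; have t0 : 0 < c * tk k by rewrite mulr_gt0// tk_gt0.
  rewrite ger0_norm; last by rewrite ltW// psi_gt0// ltW.
  have -> : psi m n (c * tk k) e = Num.sqrt (c * tk k) ^+ (n - m) * Num.sqrt (c * tk k + e) ^- n.
    have -> : c * tk k + e = c * tk k * (1 + e / (c * tk k)) by rewrite mulrDr mulr1 [X in _ = _ + X]mulrC divfK// gt_eqF.
    rewrite /psi (sqrtrM _ (ltW t0)) exprMn.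
    have x0 : Num.sqrt (c * tk k) != 0 by rewrite gt_eqF// sqrtr_gt0.
    move: x0; set x := Num.sqrt (c * tk k); set y := Num.sqrt _ => x0.
    by rewrite -{3}(subnK (ltnW mn)) exprD -mulrA invfM mulrA mulfV ?mul1r ?invfM// expf_neq0.
  rewrite ler_wpM2l ?exprn_ge0// lef_pV2 ?posrE ?exprn_gt0 ?sqrtr_gt0//; last by rewrite addr_gt0.
  by rewrite lerXn2r ?nnegrE// ler_wsqrtr// lerDr ltW.
rewrite -[X in _ --> X](mul0r (Num.sqrt e ^- n)); apply: cvgMl.
have -> : 0 = Num.sqrt (c * 0) ^+ (n - m) :> R by rewrite mulr0 sqrtr0 expr0n subn_eq0 leqNgt mn.
have hc : continuous (fun x : R => Num.sqrt (c * x) ^+ (n - m)).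
  move=> x; apply: (@continuous_comp _ _ _ (fun x : R => Num.sqrt (c * x)) (fun y => y ^+ (n - m))); last exact: exprn_continuous.
  apply: (@continuous_comp _ _ _ (fun x : R => c * x) Num.sqrt); last exact: sqrt_continuous.
  exact: mulrl_continuous.
exact: (continuous_cvg _ (hc 0) tk_cvg).
Qed.

Lemma Ker_vanish m n (l : seq (R * nat)) (e : R) : (m < n)%N -> 0 < e ->
  exists2 v : nat -> R, v @ \oo --> (0 : R) &
    forall k q, e <= q -> `|Ker m n l (tk k) q| <= v k.
Proof.
move=> mn e0; exists (fun k => \sum_(p <- l) `|p.1| * psi m n (p.2.+1%:R * tk k) e).
  elim: l => [|p l IH].
    have -> : (fun k => \sum_(p <- [::] : seq (R * nat)) `|p.1| * psi m n (p.2.+1%:R * tk k) e) = (fun=> 0 : R).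
      by apply/funext => k; rewrite big_nil.
    exact: cvg_cst.
  have -> : (fun k => \sum_(p <- p :: l) `|p.1| * psi m n (p.2.+1%:R * tk k) e) =
     fun k => `|p.1| * psi m n (p.2.+1%:R * tk k) e + \sum_(p <- l) `|p.1| * psi m n (p.2.+1%:R * tk k) e.
    by apply/funext => k; rewrite big_cons.
  rewrite -[X in _ --> X]addr0; apply: cvgD => //.
  by rewrite -[X in _ --> X](mulr0 `|p.1|); apply: cvgMr; exact: psi_vanish.
move=> k q eq; rewrite (le_trans (ler_norm_sum _ _ _))// ler_sum// => p _.
have t0 : 0 < p.2.+1%:R * tk k :> R by rewrite mulr_gt0// tk_gt0.
rewrite normrM ler_wpM2l// ger0_norm ?psi_anti ?(ltW e0)//.
by rewrite ltW// psi_gt0// (le_trans (ltW e0)).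
Qed.

End vanish.

Section hitting_set.
Context {R : realType} (m n : nat).
Notation V := (Borel 'rV[R]_n).
Notation fmeas := {finite_measure set V -> \bar R}.
Implicit Types (mu nu : fmeas) (P : 'M[R]_n).

Lemma ae_spt mu : {ae mu, forall x : V, spt mu (x : 'rV[R]_n)}.
Proof. exact: (spt_negligible mu). Qed.

Lemma E2_spt_le kap mu nu M : bker kap ->
  (forall x y, spt mu x -> spt nu y -> `|kap (x - y)| <= M) ->
  `|E2 kap mu nu| <= M * fine (nu setT) * fine (mu setT).
Proof.
move=> bk kM; apply: bint_ae_norm_le; first exact: (bmf_bint1 mu nu bk).
apply: ae_imply (ae_spt mu) => x sx; apply: bint_ae_norm_le; first exact: (bmf_pair1 x bk).
by apply: ae_imply (ae_spt nu) => y sy; exact: kM.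
Qed.

Lemma Phi_vanish j P mu nu : (m < n)%N -> compact (spt mu) -> compact (spt nu) ->
  ~ hit (spt mu) (spt nu) P -> (fun k => Phi m j k P mu nu) @ \oo --> (0 : R).
Proof.
move=> mn cmu cnu /(disjoint_proj_gap cmu cnu)[e e0 gap].
have [v v0 vK] := Ker_vanish (lPsi j) mn e0.
apply: (@cvg0_le _ _ (fun k => v k * fine (nu setT) * fine (mu setT))).
  move=> k; apply: E2_spt_le; first exact/bker_KP/tk_gt0.
  by move=> x y sx sy; apply: vK; exact: gap.
rewrite -[X in _ --> X](mul0r (fine (mu setT))); apply: cvgMl.
by rewrite -[X in _ --> X](mul0r (fine (nu setT))); apply: cvgMl.
Qed.

Lemma hit_gt0 (gam : probability (Borel 'M[R]_n) R) mu nu s t :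
  (0 < m)%N -> (m < n)%N -> 0 < s -> 0 < t -> 2 * m%:R <= s + t ->
  (0 < mu setT)%E -> (0 < nu setT)%E ->
  compact (spt mu) -> compact (spt nu) ->
  (energy mu s < +oo)%E -> (energy nu t < +oo)%E ->
  grass_invariant_prob m gam ->
  (0 < gam ([set P : 'M[R]_n | grass m P /\
                 projset P (spt mu) `&` projset P (spt nu) !=set0]
            : set (Borel 'M[R]_n)))%E.
Proof.
move=> m0 mn s0 t0 st mu0 nu0 cmu cnu es et gamP.
have m0R : 0 < m%:R :> R by rewrite ltr0n.
have st0 : 0 < s + t by rewrite addr_gt0.
(* Lowering both exponents by the factor [a <= 1] makes their sum exactly 2m and keeps the energies
   finite. Each is then below 2m, so [j = m] is large enough. *)
pose a := 2 * m%:R / (s + t).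
have a0 : 0 < a by rewrite divr_gt0// mulr_gt0.
have a1 : a <= 1 by rewrite ler_pdivrMr// mul1r.
have aE : a * s + a * t = 2 * m%:R by rewrite -mulrDr divfK// gt_eqF.
have as0 := mulr_gt0 a0 s0; have at0 := mulr_gt0 a0 t0.
have mS : m.+1%:R = m%:R + 1 :> R by rewrite natr1.
have sm : a * s < m%:R + 2 * m.+1%:R by rewrite mS; lra.
have tm : a * t < m%:R + 2 * m.+1%:R by rewrite mS; lra.
have es' : (energy mu (a * s) < +oo)%E by apply: energy_mono es => //; rewrite ler_piMl// ltW.
have et' : (energy nu (a * t) < +oo)%E by apply: energy_mono et => //; rewrite ler_piMl// ltW.
apply: (grass_measure_gt0 gamP as0 at0 aE sm tm es' et' mu0 nu0).
  apply: measurableI; last exact: measurable_hit.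
  by apply: (@closed_Borel 'M[R]_n); exact: closed_grass.
apply: ae_imply (ae_grass gamP) => P gP nh; apply: Phi_vanish => // h.
by apply: nh; split.
Qed.

End hitting_set.

(** * Potentials and interior points *)

Section uniform_limit.
Context {R : realType}.

(* With [S k] the partial sums of [b], [F k a + S k] is nondecreasing and [F k a - S k] is nonincreasing. *)
Lemma unif_limit T (F : nat -> T -> R) (b : nat -> R) M : (forall k, 0 <= b k) ->
  (forall k a, `|F k.+1 a - F k a| <= b k) -> (forall K, \sum_(0 <= k < K) b k <= M) ->
  exists f r, r @ \oo --> (0 : R) /\ forall k a, `|F k a - f a| <= r k.
Proof.
move=> b0 Fb bM; pose S K := \sum_(0 <= k < K) b k.
have SS k : S k.+1 = S k + b k by rewrite /S big_nat_recr.
have S_nd : {homo S : k k' / (k <= k')%N >-> k <= k'}.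
  by apply/nondecreasing_seqP => k; rewrite SS lerDl.
have S_cvg : cvgn S.
  apply: nondecreasing_is_cvgn => //; exists M => _ [K _ <-]; exact: bM.
pose l := limn S; pose U a k := F k a + S k.
have Sl k : S k <= l by exact: nondecreasing_cvgn_le.
have Fk a k : - b k <= F k.+1 a - F k a <= b k by rewrite -ler_norml.
have U_nd a : {homo (U a) : k k' / (k <= k')%N >-> k <= k'}.
  by apply/nondecreasing_seqP => k; rewrite /U SS; have := Fk a k; lra.
have L_ni a : {homo (fun k => F k a - S k) : k k' / (k <= k')%N >-> k' <= k}.
  by apply/nonincreasing_seqP => k; rewrite SS; have := Fk a k; lra.
have U_cvg a : cvgn (U a).
  apply: nondecreasing_is_cvgn => //; exists (F 0%N a - S 0%N + 2 * M) => _ [K _ <-].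
  by have := L_ni a _ _ (leq0n K); have := bM K; rewrite -/(S K) /U; lra.
exists (fun a => limn (U a) - l), (fun k => l - S k); split.
  by rewrite -(subrr l); apply: cvgB => //; exact: cvg_cst.
move=> k a; rewrite ler_norml.
have h1 : U a k <= limn (U a) by exact: nondecreasing_cvgn_le.
have h2 : limn (U a) <= F k a - S k + 2 * l.
  apply: limr_le => //; near=> K.
  have kK : (k <= K)%N by near: K; exists k.
  by have := L_ni a _ _ kK; have := Sl K; rewrite /U; lra.
by move: h1; rewrite /U => h1; apply/andP; split; lra.
Unshelve. all: by end_near. Qed.

Lemma sum_geometric_le (rho : R) K : 0 <= rho -> rho < 1 ->
  \sum_(0 <= k < K) rho ^+ k.+1 <= (1 - rho)^-1.
Proof.
move=> r0 r1; have d0 : 0 < 1 - rho by rewrite subr_gt0.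
suff H : \sum_(0 <= k < K) rho ^+ k.+1 <= (1 - rho)^-1 * (1 - rho ^+ K).
  apply: le_trans H _; rewrite ler_piMr ?invr_ge0 ?(ltW d0)//.
  by rewrite lerBlDr lerDl exprn_ge0.
elim: K => [|K IH]; first by rewrite big_geq// expr0 subrr mulr0.
rewrite big_nat_recr//= (le_trans (lerD IH (lexx _)))//.
have -> : (1 - rho)^-1 * (1 - rho ^+ K.+1) = (1 - rho)^-1 * (1 - rho ^+ K) + rho ^+ K.
  by rewrite exprS; field; rewrite gt_eqF.
by rewrite lerD2l exprS ler_piMl ?exprn_ge0// ltW.
Qed.

End uniform_limit.

Section uniform_continuity.
Context {R : realType} (m n : nat) (P : 'M[R]_n).
Notation V := (Borel 'rV[R]_n).

(* Uniform continuity with respect to the seminorm [|zP|]. *)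
Definition ucP (f : 'rV[R]_n -> R) := forall e, 0 < e ->
  exists2 del, 0 < del & forall a b, sqn ((a - b) *m P) < del -> `|f a - f b| <= e.

(* Young's inequality for the cross term. *)
Lemma sqnD_eps (h : R) (u v : 'rV[R]_n) : 0 < h ->
  sqn (u + v) <= (1 + h) * sqn u + (1 + h^-1) * sqn v.
Proof.
move=> h0; rewrite /sqn !mulr_sumr -big_split /=; apply: ler_sum => i _; rewrite mxE.
move: (u ord0 i) (v ord0 i) => x y; rewrite -subr_ge0.
have -> : (1 + h) * x ^+ 2 + (1 + h^-1) * y ^+ 2 - (x + y) ^+ 2 = h * (x - y / h) ^+ 2.
  by field; rewrite gt_eqF.
by rewrite mulr_ge0 ?sqr_ge0// ltW.
Qed.

(** The estimate is multiplicative: if the bases [1 + q / tau] at the two points differ by a factor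
    of at most [1 + h], the kernels differ by at most (1 + h)^(n/2) <= 1 + e/C, where [C] bounds the
    kernel. *)
Lemma ucP_psi tau : 0 < tau -> ucP (fun z => psi m n tau (sqn (z *m P))).
Proof.
move=> t0 e e0; set C := Num.sqrt tau ^- m.
have C0 : 0 < C by rewrite invr_gt0 exprn_gt0// sqrtr_gt0.
pose g (x : R) := Num.sqrt (1 + x) ^+ n.
have cg : continuous g.
  move=> x; apply: (@continuous_comp _ _ _ (fun x : R => Num.sqrt (1 + x)) (fun y => y ^+ n)); last exact: exprn_continuous.
  apply: (@continuous_comp _ _ _ (fun x : R => 1 + x) Num.sqrt); last exact: sqrt_continuous.
  by apply: cvgD; [exact: cvg_cst|exact: cvg_id].
have g0 : g 0 = 1 by rewrite /g addr0 sqrtr1 expr1n.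
have [h h0 gh] : exists2 h, 0 < h & g h <= 1 + e / C.
  have cg0 : g x @[x --> (0 : R)] --> (1 : R) by rewrite -g0; exact: cg.
  have eC : 1 < 1 + e / C by rewrite ltrDl divr_gt0.
  have /nbhs_ballP[r /= r0 rg] : \forall x \near (0 : R), g x <= 1 + e / C by apply: (cvgr_le _ cg0).
  exists (r / 2); first by rewrite divr_gt0.
  by apply: rg; rewrite /ball/= sub0r normrN gtr0_norm ?divr_gt0//; lra.
pose k := h / 2; have k0 : 0 < k by rewrite divr_gt0.
(* This makes the second term of [sqnD_eps] at most [tau * k]; with [k = h / 2] both terms fit into
   the factor [1 + h]. *)
pose del := tau * k / (1 + k^-1).
have K0 : 0 < 1 + k^-1 by rewrite addr_gt0// invr_gt0.
have d0 : 0 < del by rewrite divr_gt0// mulr_gt0.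
have half a b : sqn ((a - b) *m P) < del ->
    psi m n tau (sqn (b *m P)) - psi m n tau (sqn (a *m P)) <= e.
  move=> ab; set p := sqn (a *m P); set q := sqn (b *m P).
  have p0 : 0 <= p := sqn_ge0 _; have q0 : 0 <= q := sqn_ge0 _.
  have pq : p <= (1 + k) * q + tau * k.
    have -> : p = sqn (b *m P + (a - b) *m P) by rewrite -mulmxDl addrC subrK.
    apply: le_trans (sqnD_eps _ _ k0) _; rewrite lerD2l.
    by rewrite mulrC -ler_pdivlMr// ltW.
  have E : 1 + p / tau <= (1 + h) * (1 + q / tau).
    have -> : p / tau = tau^-1 * p by rewrite mulrC.
    have : tau^-1 * p <= (1 + k) * (q / tau) + k.
      apply: (@le_trans _ _ (tau^-1 * ((1 + k) * q + tau * k))); first by rewrite ler_pM2l ?invr_gt0.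
      by rewrite le_eqVlt; apply/orP; left; apply/eqP; move: (k) => ?; field; rewrite gt_eqF.
    have : 0 <= q / tau by rewrite divr_ge0// ltW.
    by rewrite /k; move: (q / tau) (tau^-1 * p) => Q PP; nra.
  have q1 : 0 < 1 + q / tau by rewrite ltr_pwDl// divr_ge0// ltW.
  have p1 : 0 < 1 + p / tau by rewrite ltr_pwDl// divr_ge0// ltW.
  have le : psi m n tau q <= g h * psi m n tau p.
    rewrite /psi -/C mulrCA ler_pM2l// /g -[leLHS]mul1r.
    rewrite ler_pdivrMr ?exprn_gt0 ?sqrtr_gt0// mulrAC ler_pdivlMr ?exprn_gt0 ?sqrtr_gt0// mul1r.
    rewrite -exprMn lerXn2r ?nnegrE ?mulr_ge0// -sqrtrM; last by rewrite addr_ge0// ltW.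
    by rewrite ler_wsqrtr.
  have pC : psi m n tau p <= C by exact: psi_le.
  have pp : 0 < psi m n tau p by exact: psi_gt0.
  apply: (@le_trans _ _ ((e / C) * psi m n tau p)).
    by rewrite lerBlDr; apply: le_trans le _; rewrite -[X in _ + X]mul1r -mulrDl ler_pM2r// addrC.
  by rewrite mulrAC ler_pdivrMr// ler_pM2l.
exists del => // a b ab; rewrite ler_norml; apply/andP; split.
  by have := half a b ab; lra.
by apply: half; rewrite -opprB mulNmx sqnN.
Qed.

Lemma ucP_Ker l tau : 0 < tau -> ucP (KP m P l tau).
Proof.
move=> t0; rewrite /KP /Ker; elim: l => [|p l IH] e e0.
  by exists 1 => // a b _; rewrite !big_nil subrr normr0 ltW.
have e20 : 0 < e / 2 by rewrite divr_gt0.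
have pt : 0 < p.2.+1%:R * tau by rewrite mulr_gt0.
have p10 : 0 < `|p.1| + 1 by rewrite ltr_wpDl.
have [d1 d10 h1] := IH _ e20.
have [d2 d20 h2] := ucP_psi pt (divr_gt0 e20 p10).
exists (Num.min d1 d2); first by rewrite lt_min d10.
move=> a b; rewrite lt_min => /andP[/h1 H1 /h2 H2]; rewrite !big_cons opprD addrACA.
apply: le_trans (ler_normD _ _) _; rewrite [leRHS](splitr e) lerD//.
rewrite -mulrBr normrM; apply: le_trans (ler_wpM2l (normr_ge0 _) H2) _.
rewrite mulrA ler_pdivrMr// mulrC ler_pM2l//.
by rewrite lerDl.
Qed.

Lemma ucP_limit (F : nat -> 'rV[R]_n -> R) f r : r @ \oo --> (0 : R) ->
  (forall k a, `|F k a - f a| <= r k) -> (forall k, ucP (F k)) -> ucP f.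
Proof.
move=> r0 Fr uF e e0; have e30 : 0 < e / 3 by rewrite divr_gt0.
have [k /= rk] := filter_ex (cvgr_lt _ r0 _ e30).
have [d d0 hd] := uF k _ e30; exists d => // a b /hd; have := Fr k a; have := Fr k b.
by rewrite !ler_norml => ? ? ?; apply/andP; split; lra.
Qed.

Lemma ucP_norm f : ucP f -> ucP (fun a => `|f a|).
Proof.
move=> uf e e0; have [d d0 hd] := uf _ e0; exists d => // a b /hd.
by apply: le_trans; exact: ler_dist_dist.
Qed.

End uniform_continuity.

Section potential.
Context {R : realType} (m n : nat) (P : 'M[R]_n) (j : nat).
Notation V := (Borel 'rV[R]_n).
Notation fmeas := {finite_measure set V -> \bar R}.
Implicit Types mu nu : fmeas.
Hypothesis gP : grass m P.

Lemma bint_dirac d (T : measurableType d) (a : T) (f : T -> R) : bmf f ->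
  \int[dirac a]_x f x = f a.
Proof.
move=> bf; rewrite /Rintegral integral_dirac//; last by apply/measurable_EFinP; exact: bf.1.
by rewrite diracE in_setT mul1e.
Qed.

Definition pot k mu (a : V) := \int[mu]_x KP m P (lPsi j) (tk k) ((x : 'rV[R]_n) - a).

Lemma bmf_pot k mu : bmf (pot k mu).
Proof. exact: (bmf_bint2 mu mu (bker_KP m P (lPsi j) (tk_gt0 k))). Qed.

Lemma E2_dirac kap mu (a : V) : bker kap -> E2 kap mu (dirac a) = \int[mu]_x kap ((x : 'rV[R]_n) - a).
Proof.
move=> bk; apply: eq_Rintegral => x _.
by rewrite bint_dirac//; exact: (bmf_pair1 x bk).
Qed.

(** Seen as a mutual energy with a point mass, a potential falls under the Cauchy-Schwarz bound. *)
Lemma potE k mu a : pot k mu a = Phi m j k P mu (dirac a).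
Proof. by rewrite /Phi E2_dirac//; exact/bker_KP/tk_gt0. Qed.

Lemma Phi_pot k mu nu : Phi m j k P mu nu = \int[nu]_y pot k mu y.
Proof. exact: (bint_fubini mu nu (bker_KP m P (lPsi j) (tk_gt0 k))). Qed.

(** Cauchy-Schwarz against the point mass, whose self-energy is the kernel at 0, of order
    tau^(-m/2). Divided by the weight this is tau^((s-2m)/2), independent of [a] and summable over
    the scales when [s > 2m]. *)
Lemma potS k mu a s : `|pot k.+1 mu a - pot k mu a| <=
  (theta m s (tk k.+1) * `|Dif m j k P mu mu|
   + (\sum_(p <- @lD R j) `|p.1|) * (tk k.+1 `^ ((s - 2 * m%:R) / 2))) / 2.
Proof.
have t0 := @tk_gt0 R k.+1; have th0 := @theta_gt0 R m s _ t0.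
rewrite !potE PhiS addrC addKr.
apply: le_trans (E2_cauchy_schwarz mu (dirac a) gP t0 (@wpol_D_ge0 R j) th0) _.
rewrite ler_pM2r ?invr_gt0// lerD//.
  by rewrite ler_pM2l// ler_norm.
rewrite E2_dirac; last exact: bker_KP.
rewrite bint_dirac; last exact: (bmf_pair2 a (bker_KP m P (lD j) t0)).
rewrite subrr /KP mul0mx sqn0.
apply: (@le_trans _ _ ((theta m s (tk k.+1))^-1 * ((\sum_(p <- @lD R j) `|p.1|) * Num.sqrt (tk k.+1) ^- m))).
  by rewrite ler_pM2l ?invr_gt0// Ker_le.
rewrite mulrCA ler_wpM2l ?sumr_ge0// sqrtXn_powR ?(ltW t0)// /theta -powRN -powRD.
  by rewrite le_eqVlt; apply/orP; left; apply/eqP; congr (_ `^ _); lra.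
by rewrite (gt_eqF t0) implybT.
Qed.

Lemma pot_limit mu s M : 2 * m%:R < s ->
  (forall K, \sum_(0 <= k < K) theta m s (tk k.+1) * `|Dif m j k P mu mu| <= M) ->
  exists f r, r @ \oo --> (0 : R) /\ forall k a, `|pot k mu a - f a| <= r k.
Proof.
move=> sm HM; pose A := \sum_(p <- @lD R j) `|p.1|.
have A0 : 0 <= A by apply: sumr_ge0.
pose del := (s - 2 * m%:R) / 2; have d0 : 0 < del by rewrite divr_gt0// subr_gt0.
pose rho : R := 2^-1 `^ del.
have rho0 : 0 <= rho by rewrite powR_ge0.
have rho1 : rho < 1.
  have : 2^-1 `^ del < 1 `^ del :> R by apply: gt0_ltr_powR; rewrite ?nnegrE ?invr_ge0//; lra.
  by rewrite powR1.
have tE k : tk k.+1 `^ del = rho ^+ k.+1.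
  have h0 : 0 <= 2^-1 :> R by rewrite invr_ge0.
  by rewrite /tk -(powR_mulrn k.+1 h0) -(powR_mulrn k.+1 (powR_ge0 _ _)) -2!powRrM mulrC.
apply: (@unif_limit _ _ _ (fun k => (theta m s (tk k.+1) * `|Dif m j k P mu mu| + A * tk k.+1 `^ del) / 2) ((M + A * (1 - rho)^-1) / 2)).
- by move=> k; rewrite divr_ge0// addr_ge0// mulr_ge0// ?powR_ge0// ltW// theta_gt0// tk_gt0.
- by move=> k a; exact: potS.
move=> K; rewrite -mulr_suml ler_pM2r ?invr_gt0// big_split/= lerD//.
rewrite -mulr_sumr ler_wpM2l//; under eq_bigr do rewrite tE.
exact: sum_geometric_le.
Qed.

Lemma ucP_pot k mu : ucP P (pot k mu).
Proof.
move=> e e0; pose M := fine (mu setT) + 1.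
have M0 : 0 < M by rewrite ltr_wpDl// fine_ge0.
have [d d0 hd] := ucP_Ker m P (lPsi j) (tk_gt0 k) (divr_gt0 e0 M0).
exists d => // a b ab; have bk (c : V) := bmf_pair2 c (bker_KP m P (lPsi j) (tk_gt0 k)).
rewrite /pot -bintB; [|exact: bk..].
apply: (@le_trans _ _ (e / M * fine (mu setT))).
  apply: bint_norm_le; first by apply: bmfB; exact: bk.
  by move=> x; apply: hd; rewrite opprB addrC addrA subrK -opprB mulNmx sqnN.
by rewrite mulrAC ler_pdivrMr// ler_pM2l// lerDl.
Qed.

Lemma pot_vanish mu (a : 'rV[R]_n) : (m < n)%N -> compact (spt mu) ->
  ~ projset P (spt mu) (a *m P) -> (fun k => pot k mu a) @ \oo --> (0 : R).
Proof.
move=> mn cmu na.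
have nh : ~ hit (spt mu) [set a] P.
  by move=> [z [Az [_ -> za]]]; apply: na; rewrite za.
have [e e0 gap] := disjoint_proj_gap cmu (@compact_set1 _ a) nh.
have [v v0 vK] := Ker_vanish (lPsi j) mn e0.
apply: (@cvg0_le _ _ (fun k => v k * fine (mu setT))).
  move=> k; rewrite /pot; apply: bint_ae_norm_le; first exact: (bmf_pair2 (a : V) (bker_KP m P (lPsi j) (tk_gt0 k))).
  by apply: ae_imply (ae_spt mu) => x sx; apply: vK; exact: gap.
by rewrite -[X in _ --> X](mul0r (fine (mu setT))); apply: cvgMl.
Qed.

End potential.

Lemma bint_mul_eq0 (R : realType) d (T : measurableType d) (mu : {finite_measure set T -> \bar R})
  (f w : T -> R) : bmf f -> (forall x, 0 <= f x) -> bmf w -> (forall x, 0 < w x) ->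
  \int[mu]_x (f x * w x) = 0 -> \int[mu]_x f x = 0.
Proof.
move=> bf f0 bw w0 E0; apply/eqP; rewrite eq_le bint_ge0// andbT.
have -> : 0 = \int[mu]_x (0 : R) by rewrite bint_cst mul0r.
apply: bint_ae_le => //; first exact: bmf_cst.
have bfw := bmfM bf bw.
have : (\int[mu]_x `|(f x * w x)%:E|)%E = 0%E.
  under eq_integral do rewrite gee0_abs ?lee_fin ?mulr_ge0 ?(ltW (w0 _))//.
  by rewrite -EFin_bint// E0.
move/(ae_eq_integral_abs mu measurableT _).1 => /(_ _)[|].
  by apply/measurable_EFinP; exact: bfw.1.
move=> A [mA A0 sA]; exists A; split => // x /= fx; apply: sA => /= /(_ I) [] /eqP.
by rewrite mulf_eq0 (gt_eqF (w0 x)) orbF => /eqP fx0; apply: fx; rewrite fx0.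
Qed.

Section mutual_energy_algebra.
Context {R : realType} (n : nat).
Notation V := (Borel 'rV[R]_n).
Notation fmeas := {finite_measure set V -> \bar R}.
Implicit Types (mu nu : fmeas) (kap : 'rV[R]_n -> R) (f g : V -> R).

Lemma bmf_En kap f g : bker kap -> bmf f -> bmf g ->
  bmf (fun p : V * V => f p.1 * g p.2 * kap ((p.1 : 'rV[R]_n) - p.2)).
Proof.
move=> bk bf bg; apply: bmfM => //; apply: bmfM; first exact: bmf_fst.
exact: bmf_snd.
Qed.

Lemma EnB kap kap' mu f nu g : bker kap -> bker kap' -> bmf f -> bmf g ->
  En (fun z => kap z - kap' z) mu f nu g = En kap mu f nu g - En kap' mu f nu g.
Proof.
move=> bk bk' bf bg; have b1 := bmf_En bk bf bg; have b2 := bmf_En bk' bf bg.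
rewrite /En -bintB; [|exact: (bmf_bint1 mu nu b1)|exact: (bmf_bint1 mu nu b2)].
apply: eq_Rintegral => x _; rewrite -bintB; [|exact: (bmf_pair1 x b1)|exact: (bmf_pair1 x b2)].
by apply: eq_Rintegral => y _; rewrite mulrBr.
Qed.

Lemma En0r kap mu f nu : En kap mu f nu (fun=> 0) = 0.
Proof.
rewrite /En; under eq_Rintegral do under eq_Rintegral do rewrite mulr0 mul0r.
by under eq_Rintegral do rewrite bint_cst mul0r; rewrite bint_cst mul0r.
Qed.

(* [f] times the potential of [f nu] integrates to 0, and that potential is positive unless [f] is null. *)
Lemma En_pos_eq0 kap nu f : bker kap -> bmf f -> (forall z, 0 < kap z) -> (forall x, 0 <= f x) ->
  En kap nu f nu f <= 0 -> \int[nu]_x f x = 0.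
Proof.
move=> bk bf k0 f0 En0; have bE := bmf_En bk bf bf.
have bkx (x : V) : bmf (fun y : V => kap ((x : 'rV[R]_n) - y)) := bmf_pair1 x bk.
pose h (x : V) := \int[nu]_y (f y * kap ((x : 'rV[R]_n) - y)).
have bh : bmf h.
  have b : bmf (fun p : V * V => f p.2 * kap ((p.1 : 'rV[R]_n) - p.2)).
    by apply: bmfM => //; exact: bmf_snd.
  exact: (bmf_bint1 nu nu b).
have h0 x : 0 <= h x by apply: bint_ge0 => y; rewrite mulr_ge0// ltW.
have E : En kap nu f nu f = \int[nu]_x (f x * h x).
  apply: eq_Rintegral => x _; rewrite -bintZl; last exact: bmfM.
  by apply: eq_Rintegral => y _; rewrite mulrA.
apply: contrapT => nf0.
have hp x : 0 < h x.
  rewrite lt_neqAle h0 andbT eq_sym; apply/eqP => hx0; apply: nf0.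
  exact: (bint_mul_eq0 bf f0 (bkx x) _ hx0).
apply: nf0; apply: (bint_mul_eq0 bf f0 bh hp).
by apply/eqP; rewrite eq_le -E En0 E bint_ge0// => x; rewrite mulr_ge0.
Qed.

(* Polarisation: [f x * f y = (f x ^+ 2 + f y ^+ 2 - (f x - f y) ^+ 2) / 2]. *)
Lemma En_polar kap nu f : bker kap -> bmf f -> (forall z, kap (- z) = kap z) ->
  En kap nu f nu f = \int[nu]_x (f x ^+ 2 * \int[nu]_y kap ((y : 'rV[R]_n) - x))
   - (\int[nu]_x \int[nu]_y ((f x - f y) ^+ 2 * kap ((x : 'rV[R]_n) - y))) / 2.
Proof.
move=> bk bf kN; set I1 := (X in _ = X - _); set I2 := (X in _ = _ - X / 2).
have b1 : bmf (fun p : V * V => f p.1 ^+ 2 * kap ((p.1 : 'rV[R]_n) - p.2)).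
  by apply: bmfM => //; apply: bmfX; exact: bmf_fst.
have b2 : bmf (fun p : V * V => f p.2 ^+ 2 * kap ((p.1 : 'rV[R]_n) - p.2)).
  by apply: bmfM => //; apply: bmfX; exact: bmf_snd.
have b3 : bmf (fun p : V * V => (f p.1 - f p.2) ^+ 2 * kap ((p.1 : 'rV[R]_n) - p.2)).
  by apply: bmfM => //; apply: bmfX; apply: bmfB; [exact: bmf_fst|exact: bmf_snd].
have E1 : \int[nu]_x \int[nu]_y (f x ^+ 2 * kap ((x : 'rV[R]_n) - y)) = I1.
  apply: eq_Rintegral => x _; rewrite bintZl; last exact: (bmf_pair1 x bk).
  by congr (_ * _); apply: eq_Rintegral => y _; rewrite -kN opprB.
have E2 : \int[nu]_x \int[nu]_y (f y ^+ 2 * kap ((x : 'rV[R]_n) - y)) = I1.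
  rewrite (bint_fubini nu nu b2); apply: eq_Rintegral => y _.
  by rewrite /= bintZl//; exact: (bmf_pair2 y bk).
have -> : I1 = (I1 + I1) / 2 by field.
rewrite -{1}E1 -E2 -mulrBl -bintD; [|exact: (bmf_bint1 nu nu b1)|exact: (bmf_bint1 nu nu b2)].
rewrite /I2 -bintB; last 2 first.
- by apply: bmfD; [exact: (bmf_bint1 nu nu b1)|exact: (bmf_bint1 nu nu b2)].
- exact: (bmf_bint1 nu nu b3).
have b1x x := bmf_pair1 x b1; have b2x x := bmf_pair1 x b2; have b3x x := bmf_pair1 x b3.
have b12 x := bmfD (b1x x) (b2x x).
have bI x := bmf_bint1 nu nu (bmfB (bmfD b1 b2) b3).
rewrite -bintZr; last first.
  by apply: bmfB; [apply: bmfD; [exact: (bmf_bint1 nu nu b1)|exact: (bmf_bint1 nu nu b2)]|exact: (bmf_bint1 nu nu b3)].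
apply: eq_Rintegral => x _; rewrite -bintD; [|exact: b1x|exact: b2x].
rewrite -bintB; [|exact: b12|exact: b3x].
rewrite -bintZr; last exact: (bmfB (b12 x) (b3x x)).
by apply: eq_Rintegral => y _ /=; field.
Qed.

End mutual_energy_algebra.

(** From 1 - (1 - y)^(j+1) >= y >= y^(i+1): as a positive definite kernel, [lPsi] dominates [psi] at
    every multiple of its scale. *)
Lemma wpol_Psi_one_ge0 (R : realType) j i (y : R) : 0 < y -> y <= 1 ->
  0 <= wpol (lPsi j.+1 ++ lopp (lone i)) y.
Proof.
move=> y0 y1; have := wpol_Psi_ge0 j y0 y1; have := wpol_one_ge0 i y0 y1.
by rewrite !wpol_cat !wpol_opp; lra.
Qed.

(** * Energy of a density supported where the potential vanishes *)

Section self_energy.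
Context {R : realType} (m n : nat) (P : 'M[R]_n) (j : nat).
Notation V := (Borel 'rV[R]_n).
Notation fmeas := {finite_measure set V -> \bar R}.
Hypothesis gP : grass m P.
Variable nu : fmeas.

Let N := fine (nu setT).
Let N0 : 0 <= N. Proof. exact: fine_ge0. Qed.

(** The coefficients of [lPsi] alternate in sign, so its kernel may take negative values; [labs]
    gives a positive majorant, whose self-energy is still bounded by that of [lPsi]. *)
Definition labs (l : seq (R * nat)) := [seq (`|p.1|, p.2) | p <- l].

Lemma Ker_labs_ge l tau q : 0 < tau -> 0 <= q -> `|Ker m n l tau q| <= Ker m n (labs l) tau q.
Proof.
move=> t0 q0; rewrite /Ker big_map; apply: le_trans (ler_norm_sum _ _ _) _.
apply: ler_sum => p _; rewrite normrM (ger0_norm (ltW (psi_gt0 _ _ _ _)))// mulr_gt0//.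
Qed.

Lemma KP_Psi_one i k z : KP m P (lPsi j.+1 ++ lopp (lone i)) (tk k) z =
  KP m P (lPsi j.+1) (tk k) z - KP m P (lone i) (tk k) z.
Proof. by rewrite /KP Ker_cat Ker_opp. Qed.

Lemma E2_one_le i k : E2 (KP m P (lone i) (tk k)) nu nu <= Phi m j.+1 k P nu nu.
Proof.
have t0 := @tk_gt0 R k.
have := E2_ge0 nu gP t0 (@wpol_Psi_one_ge0 R j i).
rewrite (_ : KP m P _ _ = fun z => KP m P (lPsi j.+1) (tk k) z - KP m P (lone i) (tk k) z); last first.
  by apply/funext => z; exact: KP_Psi_one.
by rewrite E2B ?subr_ge0//; exact: bker_KP.
Qed.

Lemma E2_labs_le l k : E2 (KP m P (labs l) (tk k)) nu nu <=
  (\sum_(p <- l) `|p.1|) * Phi m j.+1 k P nu nu.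
Proof.
have -> : KP m P (labs l) (tk k) = fun z => \sum_(p <- l) `|p.1| * KP m P (lone p.2) (tk k) z.
  apply/funext => z; rewrite /KP /Ker big_map; apply: eq_bigr => p _.
  by rewrite big_seq1 mul1r.
rewrite E2_sum; last by move=> p; exact/bker_KP/tk_gt0.
rewrite mulr_suml; apply: ler_sum => p _; rewrite ler_wpM2l//.
exact: E2_one_le.
Qed.

(* [1 = 2 ^ k * tk k], so both kernels are combinations at scale [tk k]. *)
Lemma En_one_le phi k : bmf phi -> En (KP m P (lone 0) 1) nu phi nu phi <=
  En (KP m P (lPsi j.+1) (tk k)) nu phi nu phi.
Proof.
move=> bphi; have t0 := @tk_gt0 R k.
have := Ker_pd nu nu gP t0 (@wpol_Psi_one_ge0 R j (2 ^ k).-1) bphi (bmf_cst _ 0).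
rewrite !En0r mulr0 !addr0.
rewrite (_ : KP m P _ _ = fun z => KP m P (lPsi j.+1) (tk k) z - KP m P (lone 0) 1 z); last first.
  apply/funext => z; rewrite KP_Psi_one /KP !Ker_one prednK ?expn_gt0//.
  by rewrite natrX /tk exprVn mulfV ?expf_neq0// mul1r.
by rewrite EnB ?subr_ge0//; exact: bker_KP.
Qed.

(** In [En_polar] the first term tends to 0 because [phi * g = 0]. The squared difference has no
    definite sign, the kernel being signed: near the diagonal uniform continuity of [phi] makes it
    small against a bounded kernel mass, and away from it the kernel tends to 0 uniformly. *)
Lemma vanish_self (phi g : V -> R) (r : nat -> R) : (m < n)%N ->
  bmf phi -> (forall a, 0 <= phi a) -> ucP P phi -> bmf g ->
  r @ \oo --> (0 : R) -> (forall k a, `|pot m P j.+1 k nu a - g a| <= r k) ->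
  (forall a, phi a * g a = 0) -> \int[nu]_x phi x = 0.
Proof.
move=> mn bphi phi0 uphi bg r0 rg phig.
have bkP l tau : 0 < tau -> bker (KP m P l tau) := @bker_KP R m n P l tau.
apply: (@En_pos_eq0 _ _ (KP m P (lone 0) 1)) => //.
- exact: bkP.
- by move=> z; rewrite /KP Ker_one psi_gt0 ?mul1r// sqn_ge0.
have [_ [B0 B0phi]] := bphi; have [_ [G Gg]] := bg.
pose B : R := `|B0|.
have phiB a : phi a <= B by apply: le_trans (ler_norm _) _; apply: le_trans (B0phi a) (ler_norm _).
have B_ge0 : 0 <= B := normr_ge0 _.
pose C := \sum_(p <- @lPsi R j.+1) `|p.1|.
have C0 : 0 <= C by apply: sumr_ge0.
have G0 : 0 <= G by apply: le_trans (Gg 0).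
apply/ler_addgt0Pl => e e0; rewrite addr0.
(* [(G + 1) * N] bounds [Phi] once [r k < 1], and [C] passes to the majorant [labs]. The
   near-diagonal part is then at most [e], halved by the polarisation; the added 1 keeps [c]
   positive. *)
pose c := C * ((G + 1) * N) + 1.
have c0 : 0 < c by rewrite ltr_wpDl// mulr_ge0// mulr_ge0// addr_ge0.
pose e1 := Num.sqrt (e / c).
have e10 : 0 < e1 by rewrite sqrtr_gt0 divr_gt0.
have e1E : e1 ^+ 2 = e / c by rewrite sqr_sqrtr// divr_ge0// ltW.
have [del del0 hdel] := uphi _ e10.
have [v v0 hv] := Ker_vanish (labs (lPsi j.+1)) mn del0.
pose w k := B ^+ 2 * N * r k + (B ^+ 2 * (N * N) * v k) / 2.
have w0 : w @ \oo --> (0 : R).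
  have -> : 0 = B ^+ 2 * N * 0 + B ^+ 2 * (N * N) * 0 / 2 :> R by rewrite !mulr0 mul0r addr0.
  by apply: cvgD; [exact: cvgMr|apply: cvgMl; exact: cvgMr].
have e20 : 0 < e / 2 by rewrite divr_gt0.
have [k [wk rk]] := filter_ex (filterI (cvgr_lt _ w0 _ e20) (cvgr_lt _ r0 _ ltr01)).
have t0 := @tk_gt0 R k.
apply: le_trans (En_one_le k bphi) _.
have vk0 : 0 <= v k by apply: le_trans (hv k del (lexx _)).
have bK := bkP (lPsi j.+1) _ t0.
rewrite En_polar//; last by move=> z; rewrite /KP mulNmx sqnN.
have bphi2 : bmf (fun x => phi x ^+ 2) := bmfX 2 bphi.
have phi2 x : 0 <= phi x ^+ 2 <= B ^+ 2.
  by rewrite sqr_ge0 lerXn2r ?nnegrE.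
have I1 : \int[nu]_x (phi x ^+ 2 * pot m P j.+1 k nu x) <= B ^+ 2 * N * r k.
  rewrite -mulrA mulrCA -[leRHS]mulrCA mulrA mulrAC -bint_cst.
  apply: bint_le; [by apply: bmfM => //; exact: bmf_pot|exact: bmf_cst|move=> x].
  have rk0 : 0 <= r k by apply: le_trans (rg k x).
  apply: (@le_trans _ _ (phi x ^+ 2 * (g x + r k))).
    by rewrite ler_wpM2l ?sqr_ge0//; have := rg k x; rewrite ler_norml; lra.
  rewrite mulrDr expr2 -mulrA phig mulr0 add0r -expr2.
  by rewrite ler_wpM2r//; case/andP: (phi2 x).
have PhiG : Phi m j.+1 k P nu nu <= (G + 1) * N.
  rewrite Phi_pot; apply: le_trans (ler_norm _) _; apply: bint_norm_le; first exact: bmf_pot.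
  move=> x; have := rg k x; have := Gg x; rewrite !ler_norml => h1 h2; apply/andP; split; lra.
have I2 : (- (\int[nu]_x \int[nu]_y ((phi x - phi y) ^+ 2 * KP m P (lPsi j.+1) (tk k) ((x : 'rV[R]_n) - y))))%R
   <= e1 ^+ 2 * (C * ((G + 1) * N)) + B ^+ 2 * (N * N) * v k.
  have bL := bkP (labs (lPsi j.+1)) _ t0.
  have b3 : bmf (fun p : V * V => (phi p.1 - phi p.2) ^+ 2 * KP m P (lPsi j.+1) (tk k) ((p.1 : 'rV[R]_n) - p.2)).
    by apply: bmfM => //; apply: bmfX; apply: bmfB; [exact: bmf_fst|exact: bmf_snd].
  have b4 : bmf (fun p : V * V => e1 ^+ 2 * KP m P (labs (lPsi j.+1)) (tk k) ((p.1 : 'rV[R]_n) - p.2)).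
    by apply: bmfM => //; exact: bmf_cst.
  have b5 := bmfD b4 (bmf_cst _ (B ^+ 2 * v k)).
  apply: (@le_trans _ _ (\int[nu]_x \int[nu]_y (e1 ^+ 2 * KP m P (labs (lPsi j.+1)) (tk k) ((x : 'rV[R]_n) - y) + B ^+ 2 * v k))).
    rewrite -mulN1r -bintZl; last exact: (bmf_bint1 nu nu b3).
    apply: bint_le; [by apply: bmfM; [exact: bmf_cst|exact: (bmf_bint1 nu nu b3)]|exact: (bmf_bint1 nu nu b5)|].
    move=> x; rewrite -bintZl; last exact: (bmf_pair1 x b3).
    apply: bint_le; [by apply: bmfM; [exact: bmf_cst|exact: (bmf_pair1 x b3)]|exact: (bmf_pair1 x b5)|].
    move=> y /=; rewrite mulN1r -mulrN /KP; set q := sqn _.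
    have q0 : 0 <= q := sqn_ge0 _.
    have KL := Ker_labs_ge (lPsi j.+1) t0 q0.
    set L := Ker m n (labs _) _ _ in KL *.
    have L0 : 0 <= L by apply: le_trans KL.
    apply: (@le_trans _ _ ((phi x - phi y) ^+ 2 * L)).
      by rewrite ler_wpM2l ?sqr_ge0// (le_trans _ KL)// -normrN ler_norm.
    case: (ltP q del) => qd.
      apply: (@le_trans _ _ (e1 ^+ 2 * L)); last by rewrite lerDl mulr_ge0// sqr_ge0.
      rewrite ler_wpM2r// -[leLHS]real_normK ?num_real// lerXn2r ?nnegrE ?(ltW e10)//.
      exact: hdel.
    apply: (@le_trans _ _ (B ^+ 2 * v k)); last by rewrite lerDr mulr_ge0// sqr_ge0.
    apply: ler_pM => //; first exact: sqr_ge0.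
      rewrite -[leLHS]real_normK ?num_real// lerXn2r ?nnegrE// ler_norml.
      by have := phi0 x; have := phi0 y; have := phiB x; have := phiB y; move=> *; apply/andP; split; lra.
    by apply: le_trans (hv k q qd); rewrite ler_norm.
  have -> : \int[nu]_x \int[nu]_y (e1 ^+ 2 * KP m P (labs (lPsi j.+1)) (tk k) ((x : 'rV[R]_n) - y) + B ^+ 2 * v k)
     = e1 ^+ 2 * E2 (KP m P (labs (lPsi j.+1)) (tk k)) nu nu + B ^+ 2 * v k * N * N.
    transitivity (\int[nu]_x (e1 ^+ 2 * (\int[nu]_y KP m P (labs (lPsi j.+1)) (tk k) ((x : 'rV[R]_n) - y)) + B ^+ 2 * v k * N)).
      apply: eq_Rintegral => x _; rewrite bintD; [|exact: (bmf_pair1 x b4)|exact: bmf_cst].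
      by rewrite bint_cst bintZl//; exact: (bmf_pair1 x bL).
    have bL1 := bmf_bint1 nu nu bL.
    rewrite bintD; [|exact: (bmfM (bmf_cst _ _) bL1)|exact: bmf_cst].
    by rewrite bint_cst bintZl.
  apply: lerD.
    rewrite ler_wpM2l ?sqr_ge0//; apply: le_trans (E2_labs_le _ _) _.
    by rewrite ler_wpM2l.
  by rewrite le_eqVlt; apply/orP; left; apply/eqP; ring.
have e1c : e1 ^+ 2 * (C * ((G + 1) * N)) <= e.
  rewrite e1E mulrAC ler_pdivrMr// ler_pM2l// /c; lra.
move: wk I1 I2; rewrite /w /KP /pot.
set J := \int[nu]_x \int[nu]_y _; set J1 := \int[nu]_x _.
lra.
Qed.

End self_energy.

Section interior.
Context {R : realType} (m n : nat).
Notation V := (Borel 'rV[R]_n).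
Notation fmeas := {finite_measure set V -> \bar R}.
Implicit Types (mu nu : fmeas).

(** Where [f] and [g] are both nonzero, they stay so on a ball of the plane, and every point of it
    must lie in both projections. *)
Lemma relint_projset (P : 'M[R]_n) (A B : set 'rV[R]_n) (f g : 'rV[R]_n -> R) a : grass m P ->
  ucP P f -> ucP P g -> (forall b, ~ projset P A (b *m P) -> f b = 0) ->
  (forall b, ~ projset P B (b *m P) -> g b = 0) -> f a * g a != 0 ->
  relint (subsp P) (projset P A `&` projset P B) !=set0.
Proof.
move=> [_ [PP _]] uf ug fA gB; rewrite mulf_eq0 negb_or => /andP[fa ga].
have near0 (h : 'rV[R]_n -> R) : ucP P h -> h a != 0 ->
    exists2 d, 0 < d & forall b, sqn ((a - b) *m P) < d -> h b != 0.
  move=> uh ha; have [|d d0 hd] := uh (`|h a| / 2); first by rewrite divr_gt0// normr_gt0.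
  exists d => // b /hd hab; apply: contra ha => /eqP hb0.
  by rewrite hb0 subr0 in hab; rewrite -normr_le0; move: hab; set x := `|h a|; lra.
have [d1 d10 h1] := near0 _ uf fa; have [d2 d20 h2] := near0 _ ug ga.
have inA b : f b != 0 -> projset P A (b *m P) by move=> /eqP fb; apply: contrapT => /fA.
have inB b : g b != 0 -> projset P B (b *m P) by move=> /eqP gb; apply: contrapT => /gB.
exists (a *m P); split; first by rewrite /subsp/= -mulmxA PP.
split; first by split; [exact: inA|exact: inB].
exists (Num.sqrt (Num.min d1 d2)); first by rewrite sqrtr_gt0 lt_min d10.
move=> y Vy; rewrite enorm_sqn ltr_sqrt ?lt_min ?d10// => /andP[y1 y2].
have E : sqn ((a - y) *m P) = sqn (y - a *m P) by rewrite mulmxBl Vy sqnB.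
by rewrite -Vy; split; [apply: inA; apply: h1|apply: inB; apply: h2]; rewrite E.
Qed.

Lemma ae_Dif_bounded (gam : probability (Borel 'M[R]_n) R) mu s j : grass_invariant_prob m gam ->
  0 < s -> s < m%:R + 2 * j%:R -> (energy mu s < +oo)%E ->
  {ae gam, forall P : Borel 'M[R]_n, exists M, forall K,
    \sum_(0 <= k < K) theta m s (tk k.+1) * `|Dif m j k (P : 'M[R]_n) mu mu| <= M}.
Proof.
move=> gamP s0 sj es; have [C HC] := Dif_sum_le gamP s0 sj es.
pose u k (P : Borel 'M[R]_n) := theta m s (tk k.+1) * `|Dif m j k (P : 'M[R]_n) mu mu|.
have bu k : bmf (u k).
  exact: (bmfM (bmf_cst _ (theta m s (tk k.+1))) (bmf_norm (bmf_E2_KP m (lD j) mu mu (tk_gt0 k.+1)))).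
have u0 k P : 0 <= u k P by rewrite mulr_ge0// ltW// theta_gt0// tk_gt0.
have iS := ae_summable bu u0 HC.
apply: ae_imply (integrable_ae measurableT iS) => P /(_ I) fS.
exists (fine (\sum_(k <oo) (u k P)%:E)%E) => K.
rewrite -lee_fin fineK// -sumEFin; apply: nneseries_lim_ge => k _ _.
by rewrite lee_fin; exact: u0.
Qed.

Lemma bmf_unif_limit (F : nat -> V -> R) f r : (forall k, bmf (F k)) -> r @ \oo --> (0 : R) ->
  (forall k a, `|F k a - f a| <= r k) -> bmf f.
Proof.
move=> bF r0 Ff; split.
  apply: (measurable_fun_cvg (h := F)) => [k|a _]; first exact: (bF k).1.
  apply/subr_cvg0; apply: cvg0_le r0 => k; exact: Ff.
have [_ [M HM]] := bF 0%N; exists (M + r 0%N) => a.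
by have := HM a; have := Ff 0%N a; rewrite !ler_norml => h1 h2; apply/andP; split; lra.
Qed.

Lemma Phi_vanish_relint (P : 'M[R]_n) j mu nu s M M' : grass m P -> (m < n)%N ->
  compact (spt mu) -> compact (spt nu) -> 2 * m%:R < s ->
  (forall K, \sum_(0 <= k < K) theta m s (tk k.+1) * `|Dif m j.+1 k P mu mu| <= M) ->
  (forall K, \sum_(0 <= k < K) theta m s (tk k.+1) * `|Dif m j.+1 k P nu nu| <= M') ->
  ~ (relint (subsp P) (projset P (spt mu) `&` projset P (spt nu)) !=set0) ->
  (fun k => Phi m j.+1 k P mu nu) @ \oo --> (0 : R).
Proof.
move=> gP mn cmu cnu sm HM HM' nrel.
have [f [r [r0 rf]]] := pot_limit gP sm HM.
have [g [r' [r'0 rg]]] := pot_limit gP sm HM'.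
have bpot k lam : bmf (pot m P j.+1 k lam) := bmf_pot m P j.+1 k lam.
have bf : bmf f := bmf_unif_limit (fun k => bpot k mu) r0 rf.
have bg : bmf g := bmf_unif_limit (fun k => bpot k nu) r'0 rg.
have uf : ucP P f := ucP_limit r0 rf (fun k => ucP_pot m P j.+1 k mu).
have ug : ucP P g := ucP_limit r'0 rg (fun k => ucP_pot m P j.+1 k nu).
have lim0 (h : V -> R) q lam : q @ \oo --> (0 : R) -> (forall k a, `|pot m P j.+1 k lam a - h a| <= q k) ->
    compact (spt lam) -> forall b : 'rV[R]_n, ~ projset P (spt lam) (b *m P) -> h b = 0.
  move=> q0 qh cl b nb; have c0 := pot_vanish j.+1 mn cl nb.
  have ch : (fun k => pot m P j.+1 k lam b) @ \oo --> h b.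
    apply/subr_cvg0; apply: cvg0_le q0 => k; exact: qh.
  exact: (cvg_unique _ ch c0).
have fg0 a : f a * g a = 0.
  apply/eqP; apply: contrapT => /negP fg; apply: nrel.
  exact: (relint_projset gP uf ug (lim0 _ _ _ r0 rf cmu) (lim0 _ _ _ r'0 rg cnu) fg).
have nf0 : \int[nu]_x `|f x| = 0.
  apply: (vanish_self gP mn (bmf_norm bf) _ (ucP_norm uf) bg r'0 rg) => a //.
  have /eqP := fg0 a; rewrite mulf_eq0 => /orP[/eqP ->|/eqP ->].
    by rewrite normr0 mul0r.
  by rewrite mulr0.
(* As [f] is null for [nu], only the uniform error [r k] of the potential contributes to [Phi]. *)
apply: (@cvg0_le _ _ (fun k => r k * fine (nu setT))); last first.
  by rewrite -[X in _ --> X](mul0r (fine (nu setT))); apply: cvgMl.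
move=> k; rewrite Phi_pot; apply: le_trans (bint_norm _ (bpot k mu)) _.
apply: (@le_trans _ _ (\int[nu]_x (`|f x| + r k))).
  apply: bint_le; [exact: bmf_norm|exact: (bmfD (bmf_norm bf) (bmf_cst _ _))|move=> x].
  rewrite -lerBlDl; apply: le_trans (rf k x); exact: lerB_dist.
by rewrite bintD ?nf0 ?add0r ?bint_cst//; [exact: bmf_norm|exact: bmf_cst].
Qed.

Lemma relint_gt0 (gam : probability (Borel 'M[R]_n) R) mu nu s t :
  (0 < m)%N -> (m < n)%N -> 2 * m%:R < s -> 2 * m%:R < t ->
  (0 < mu setT)%E -> (0 < nu setT)%E ->
  compact (spt mu) -> compact (spt nu) ->
  (energy mu s < +oo)%E -> (energy nu t < +oo)%E ->
  grass_invariant_prob m gam ->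
  (0 < gam ([set P : 'M[R]_n | grass m P /\
                  relint (subsp P) (projset P (spt mu) `&` projset P (spt nu)) !=set0]
             : set (Borel 'M[R]_n)))%E.
Proof.
move=> m0 mn sm tm mu0 nu0 cmu cnu es et gamP.
have m0R : 0 < m%:R :> R by rewrite ltr0n.
(* One exponent for both measures: above 2m for the uniform convergence of potentials, and capped so
   that [j = m] still suffices. *)
pose v := Num.min (Num.min s t) (2 * m%:R + 1).
have vm : 2 * m%:R < v by rewrite !lt_min sm tm ltrDl ltr01.
have v0 : 0 < v by rewrite (lt_trans _ vm)// mulr_gt0.
have vs : v <= s by rewrite !ge_min lexx.
have vt : v <= t by rewrite !ge_min lexx orbT.
have v1 : v <= 2 * m%:R + 1 by rewrite ge_min lexx orbT.
have mS : m.+1%:R = m%:R + 1 :> R by rewrite natr1.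
have vj : v < m%:R + 2 * m.+1%:R by rewrite mS; lra.
have mj : m%:R < m%:R + 2 * m.+1%:R :> R by rewrite mS; lra.
(* The domination argument needs exponents with sum 2m, and runs with [m] and [m]; the exponent [v]
   serves the potentials only. *)
have mm : m%:R + m%:R = 2 * m%:R :> R by lra.
have Emu : (energy mu m%:R < +oo)%E by apply: energy_mono es => //; lra.
have Enu : (energy nu m%:R < +oo)%E by apply: energy_mono et => //; lra.
have Smu := ae_Dif_bounded gamP v0 vj (energy_mono v0 vs es).
have Snu := ae_Dif_bounded gamP v0 vj (energy_mono v0 vt et).
apply: (grass_measure_gt0 gamP m0R m0R mm mj mj Emu Enu mu0 nu0); first exact: measurable_relint.
have Sboth := ae_imply2 (fun P a b => conj a b) Smu Snu.
apply: ae_imply2 (ae_grass gamP) Sboth => P gP [[M HM] [M' HM']] nF.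
apply: (Phi_vanish_relint gP mn cmu cnu vm HM HM') => h.
by apply: nF; split.
Qed.

End interior.

Section as_finite_measure.
Context {R : realType} d (T : measurableType d) (mu : {measure set T -> \bar R}).

(* Carries the canonical finite-measure structure; convertible to [mu]. *)
Definition as_finite (_ : (mu setT < +oo)%E) : set T -> \bar R := mu.

Hypothesis muF : (mu setT < +oo)%E.

HB.instance Definition _ := Measure.copy (as_finite muF) mu.
HB.instance Definition _ := Measure_isFinite.Build _ _ _ (as_finite muF) (lty_fin_num_fun muF).

End as_finite_measure.

Theorem theorem3p3 (R : realType) (n m : nat) (s t : R)
  (mu nu : {measure set (Borel 'rV[R]_n) -> \bar R})
  (gam : probability (Borel 'M[R]_n) R) :
  (1 <= m)%N -> (m < n)%N ->
  0 < s -> 0 < t -> 2 * m%:R <= s + t ->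
  (mu setT < +oo)%E -> (0 < mu setT)%E ->
  (nu setT < +oo)%E -> (0 < nu setT)%E ->
  compact (spt mu) -> compact (spt nu) ->
  (energy mu s < +oo)%E -> (energy nu t < +oo)%E ->
  grass_invariant_prob m gam ->
  (0 < gam ([set P : 'M[R]_n | grass m P /\
                 projset P (spt mu) `&` projset P (spt nu) !=set0]
            : set (Borel 'M[R]_n)))%E
  /\
  (2 * m%:R < s -> 2 * m%:R < t ->
   (0 < gam ([set P : 'M[R]_n | grass m P /\
                  relint (subsp P) (projset P (spt mu) `&` projset P (spt nu)) !=set0]
             : set (Borel 'M[R]_n)))%E).
Proof.
move=> m0 mn s0 t0 st muF mu0 nuF nu0 cmu cnu es et gamP.
pose mu' : {finite_measure set _ -> \bar R} := as_finite muF.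
pose nu' : {finite_measure set _ -> \bar R} := as_finite nuF.
split.
  exact: (@hit_gt0 R m n gam mu' nu' s t).
by move=> sm tm; exact: (@relint_gt0 R m n gam mu' nu' s t).
Qed.
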